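(* Let $\mathbf{u}=u_r\mathbf{e}_r+u_\theta\mathbf{e}_\theta+u_z\mathbf{e}_z$ be an axially symmetric smooth solution of the steady Navier-Stokes equations $(\mathbf{u}\cdot\nabla)\mathbf{u}+\nabla p=\Delta\mathbf{u}$, $\operatorname{div}\mathbf{u}=0$ in $\mathbb{R}^3$ with $\lim_{|\mathbf{x}|\to\infty}\mathbf{u}(\mathbf{x})=0$ and with finite Dirichlet integral $\int_{\mathbb{R}^3}|\nabla\mathbf{u}|^2\,d\mathbf{x}<\infty$. Assume that $$\left\|\frac{u_r}{r}\mathbf{1}_{\{u_r<-\frac1r\}}\right\|_{L^{3/2}(\mathbb{R}^3)}<\frac{8}{9C_*^2}.$$ Then $\mathbf{u}\equiv 0$. In particular, if $u_r\ge-\frac1r$ for all $(r,z)\in[0,\infty)\times\mathbb{R}$, then the displayed condition is automatically satisfied and $\mathbf{u}\equiv 0$.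
   Context: Cylindrical coordinates: $r=\sqrt{x_1^2+x_2^2}$, $\theta=\arctan(x_2/x_1)$, $z=x_3$, with $\mathbf{e}_r=(\cos\theta,\sin\theta,0)$, $\mathbf{e}_\theta=(-\sin\theta,\cos\theta,0)$, $\mathbf{e}_z=(0,0,1)$. A vector field $\mathbf{u}=u_r\mathbf{e}_r+u_\theta\mathbf{e}_\theta+u_z\mathbf{e}_z$ is axially symmetric if $u_r,u_\theta,u_z$ do not depend on $\theta$. The scalar function $p$ is the associated pressure. $C_*$ is the optimal constant in the Sobolev inequality $\|f\|_{L^6(\mathbb{R}^3)}\le C_*\|\nabla f\|_{L^2(\mathbb{R}^3)}$ for all $f\in C_0^\infty(\mathbb{R}^3)$. $\mathbf{1}_E$ is the characteristic function of a set $E\subset\mathbb{R}^3$. *)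

(* Defs.v *)
From HB Require Import structures.
From mathcomp Require Import all_boot all_order all_algebra.
From mathcomp Require Import all_classical all_reals all_analysis.

Set Implicit Arguments.
Unset Strict Implicit.
Unset Printing Implicit Defensive.

Import Order.TTheory GRing.Theory Num.Theory.
Import numFieldNormedType.Exports.

Local Open Scope classical_set_scope.
Local Open Scope ring_scope.

Section EuclideanSpace.
Context {R : realType}.

Definition vec3 (a b c : R) : 'rV[R]_3 := \row_(i < 3) [:: a; b; c]`_i.

(* The library norm on 'rV[R]_3 is the sup norm, hence this Euclidean one. *)
Definition enorm (x : 'rV[R]_3) : R := Num.sqrt (\sum_(i < 3) x 0 i ^+ 2).

Definition partial {V : normedModType R} (i : 'I_3) (f : 'rV[R]_3 -> V) :
    'rV[R]_3 -> V :=
  fun x => 'D_(delta_mx 0 i) f x.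

Fixpoint Cn {V : normedModType R} (n : nat) (f : 'rV[R]_3 -> V) : Prop :=
  if n is k.+1 then
    continuous f /\
    forall i, (forall x, derivable f x (delta_mx 0 i)) /\ Cn k (partial i f)
  else continuous f.

Definition smooth {V : normedModType R} (f : 'rV[R]_3 -> V) : Prop :=
  forall n, Cn n f.

(* Matrices carry no measurable structure in the library: integration over R^3
   is with respect to Lebesgue measure on R * R * R, read through [pt3]. *)
Definition pt3 (q : R * R * R) : 'rV[R]_3 := vec3 q.1.1 q.1.2 q.2.

Definition leb3 :
    {measure set (measurableTypeR R * measurableTypeR R * measurableTypeR R)
      -> \bar R} :=
  ((@lebesgue_measure R \x @lebesgue_measure R) \x @lebesgue_measure R)%E.

Definition LpNorm (p : R) (f : 'rV[R]_3 -> R) : \bar R :=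
  Lnorm leb3 p%:E (fun q => (f (pt3 q))%:E).

End EuclideanSpace.

Section Sobolev.
Context (R : realType).

Definition test_function (f : 'rV[R]_3 -> R) : Prop :=
  smooth f /\ compact (closure [set x | f x != 0]).

Definition grad_norm (f : 'rV[R]_3 -> R) (x : 'rV[R]_3) : R :=
  Num.sqrt (\sum_(i < 3) partial i f x ^+ 2).

Definition sobolev_admissible : set R :=
  [set C | forall f, test_function f ->
    (LpNorm 6 f <= C%:E * LpNorm 2 (grad_norm f))%E].

(* The optimal constant C_* in the Sobolev inequality. *)
Definition sobolev_const : R := inf sobolev_admissible.

End Sobolev.

Section NavierStokes.
Context {R : realType}.
Implicit Types (u : 'rV[R]_3 -> 'rV[R]_3) (p : 'rV[R]_3 -> R).

Definition convection u (x : 'rV[R]_3) : 'rV[R]_3 :=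
  \sum_(i < 3) u x 0 i *: partial i u x.

Definition gradient p (x : 'rV[R]_3) : 'rV[R]_3 := \row_(i < 3) partial i p x.

Definition laplacian u (x : 'rV[R]_3) : 'rV[R]_3 :=
  \sum_(i < 3) partial i (partial i u) x.

Definition divergence u (x : 'rV[R]_3) : R := \sum_(i < 3) partial i u x 0 i.

Definition steady_navier_stokes u p : Prop :=
  forall x, convection u x + gradient p x = laplacian u x /\
            divergence u x = 0.

Definition dirichlet_integral u : \bar R :=
  (\int[leb3]_q
    (\sum_(i < 3) \sum_(j < 3) (partial i u (pt3 q) 0 j) ^+ 2)%:E)%E.

Definition vanishes_at_infinity u : Prop :=
  forall e : R, 0 < e ->
    exists M : R, forall x, M < enorm x -> enorm (u x) < e.

End NavierStokes.

Section Axisymmetric.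
Context {R : realType}.

Definition e_r (t : R) : 'rV[R]_3 := vec3 (cos t) (sin t) 0.
Definition e_theta (t : R) : 'rV[R]_3 := vec3 (- sin t) (cos t) 0.
Definition e_z : 'rV[R]_3 := vec3 0 0 1.

Definition cyl_r (x : 'rV[R]_3) : R :=
  Num.sqrt (x 0 (inord 0) ^+ 2 + x 0 (inord 1) ^+ 2).
Definition cyl_z (x : 'rV[R]_3) : R := x 0 (inord 2).

(* u = u_r e_r + u_theta e_theta + u_z e_z with components depending only on
   (r, z); theta and the frame are undefined on the axis r = 0, so the values
   of the component functions at r = 0 are left unconstrained. *)
Definition axisymmetric_with (ur ut uz : R -> R -> R)
    (u : 'rV[R]_3 -> 'rV[R]_3) : Prop :=
  forall r t z : R, 0 < r ->
    u (vec3 (r * cos t) (r * sin t) z) =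
      ur r z *: e_r t + ut r z *: e_theta t + uz r z *: e_z.

(* (u_r / r) 1_{u_r < -1/r}; it is 0 on the (null) axis, where 0^-1 = 0. *)
Definition strong_inflow (ur : R -> R -> R) (x : 'rV[R]_3) : R :=
  ur (cyl_r x) (cyl_z x) / cyl_r x *
  \1_[set y | ur (cyl_r y) (cyl_z y) < - (1 / cyl_r y)] x.

Definition small_inflow (ur : R -> R -> R) : Prop :=
  (LpNorm (3 / 2) (strong_inflow ur) < (8 / (9 * sobolev_const R ^+ 2))%:E)%E.

End Axisymmetric.

(* Main.v *)
(* Let s be the square of the swirl v = u_theta e_theta. It satisfies
     1/2 lap s - 1/2 u . grad s = |grad v|^2 + (u_r / r) s,  r^2 |grad s|^2 + 4 s^2 <= 4 s r^2 |grad v|^2.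
   Testing with a truncation f of sqrt(1 + k s) supported in {k s > 1}, which is compact because
   u -> 0, the term -s / r^2 in the second relation absorbs the part u_r >= -1/r of the inflow; what
   is left is bounded by Hoelder and Sobolev, so |grad f|_2^2 <= th |grad f|_2^2 + o(1) with th < 1,
   and s = 0.  Without swirl the vorticity w is horizontal and tangential, and S = |w|^2 satisfies
     1/2 lap S - 1/2 u . grad S = |grad w|^2 - (u_r / r) S.
   Cut-offs of radius n give first S / r^2 in L^1, then, with the weight 1 / (r^2 + 1/n) and the field
   (x, y, 0) / (r^2 + 1/n)^2, that w does not depend on z; as S is integrable it vanishes.  So u is
   harmonic and tends to 0, hence u = 0.  The only fact about integration by parts that is used is
   that partial derivatives of compactly supported functions have integral 0. *)

(* With N the L^{3/2} norm of the strong inflow, the swirl estimate closes as soon as N C^2 < 1 for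
   one admissible Sobolev constant C; the gap between 8/9 and 1 pays for taking C slightly above the
   infimum. The threshold is this good because sqrt(1 + k s) grows linearly in |v|: its gradient
   costs at most |grad v|^2 minus the Hardy term s / r^2, and the layer where the truncation varies
   only leaves an error. Polar components are singular on the axis and the pressure is not supposed
   axisymmetric. Hence everything is expressed by smooth Cartesian functions: axial symmetry becomes
   the action of x d_y - y d_x, identities are proved after multiplication by r^2, and r^2 is
   cancelled because the complement of the axis is dense. For the vorticity the sign of u_r is of no
   help. Boundedness of u makes r u_r of order r, so near the axis (u_r / r) S is dominated by the
   Hardy term S / r^2, and far from it by the integrable S. *)
From HB Require Import structures.
Require Import Defs.
From mathcomp Require Import all_boot all_order all_algebra.
From mathcomp Require Import all_classical all_reals all_analysis.
From mathcomp Require Import measurable_realfun.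
From mathcomp Require Import ring lra.

Set Implicit Arguments.
Unset Strict Implicit.
Unset Printing Implicit Defensive.

Import Order.TTheory GRing.Theory Num.Theory.
Import numFieldNormedType.Exports.
Local Open Scope classical_set_scope.
Local Open Scope ring_scope.

(** * The ring of smooth functions *)

Section SmoothFunctions.
Context {R : realType}.
Implicit Types f g : 'rV[R]_3 -> R.

Lemma Cn_continuous n f : Cn n f -> continuous f.
Proof. by case: n => [|n] //= []. Qed.

Lemma CnW n f : Cn n.+1 f -> Cn n f.
Proof.
elim: n f => [|n IH] f [cf df] //.
by split=> // i; have [di Ci] := df i; split=> //; exact: IH.
Qed.

Lemma Cn_cst n (c : R) : Cn n (cst c : 'rV[R]_3 -> R).
Proof.
elim: n c => [|n IH] c /=; first exact: cst_continuous.
split=> [|i]; first exact: cst_continuous.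
split=> [x|]; first exact: derivable_cst.
rewrite (_ : partial i (cst c) = cst 0)//.
by apply/funext => x; rewrite /partial derive_cst.
Qed.

Lemma CnD n f g : Cn n f -> Cn n g -> Cn n (f + g).
Proof.
elim: n f g => [|n IH] f g Cf Cg.
  by move=> x; apply: continuousD; [exact: Cf|exact: Cg].
split=> [x|i].
  by apply: continuousD; [exact: (Cn_continuous Cf)|exact: (Cn_continuous Cg)].
have [df Cfi] := Cf.2 i; have [dg Cgi] := Cg.2 i.
split=> [x|]; first exact: derivableD.
rewrite (_ : partial i (f + g) = partial i f + partial i g); first exact: IH.
by apply/funext => x; rewrite /partial deriveD.
Qed.

Lemma CnM n f g : Cn n f -> Cn n g -> Cn n (f * g).
Proof.
elim: n f g => [|n IH] f g Cf Cg.
  by move=> x; apply: continuousM; [exact: Cf|exact: Cg].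
split=> [x|i].
  by apply: continuousM; [exact: (Cn_continuous Cf)|exact: (Cn_continuous Cg)].
have [df Cfi] := Cf.2 i; have [dg Cgi] := Cg.2 i.
split=> [x|]; first exact: derivableM.
rewrite (_ : partial i (f * g) = f * partial i g + g * partial i f).
  by apply: CnD; apply: IH => //; exact: CnW.
by apply/funext => x; rewrite /partial deriveM.
Qed.

Lemma Cn_coord n (j : 'I_3) : Cn n (fun x : 'rV[R]_3 => x 0 j).
Proof.
have cj : continuous (fun x : 'rV[R]_3 => x 0 j) by move=> x; exact: coord_continuous.
case: n => [|n]; first exact: cj.
have dj (i : 'I_3) (x : 'rV[R]_3) : is_derive x (delta_mx 0 i : 'rV[R]_3)
    (fun x : 'rV[R]_3 => x 0 j) ((delta_mx 0 i : 'rV[R]_3) 0 j).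
  have h := @differentiable_coord R 1 3 x 0 j.
  apply: DeriveDef; first exact: diff_derivable.
  rewrite deriveE//.
  have lin : linear (fun x : 'rV[R]_3 => x 0 j) by move=> a u v; rewrite !mxE.
  pose L : {linear 'rV[R]_3 -> R} := HB.pack (fun x : 'rV[R]_3 => x 0 j)
    (GRing.isLinear.Build _ _ _ _ (fun x : 'rV[R]_3 => x 0 j) lin).
  have := @diff_lin _ _ _ L x; rewrite /= => -> //.
split=> // i; split=> [x|]; first by case: (dj i x).
rewrite (_ : partial i _ = cst ((delta_mx 0 i : 'rV[R]_3) 0 j)); first exact: Cn_cst.
by apply/funext => x; rewrite /partial; case: (dj i x).
Qed.

Lemma is_derive_comp1 (phi dphi : R -> R) f x v :
  derivable f x v -> is_derive (f x) 1 phi (dphi (f x)) ->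
  is_derive x v (phi \o f) (dphi (f x) * 'D_v f x).
Proof.
move=> /derivable1P df dphi_f.
have e0 : (fun h : R => f (h *: v + x)) 0 = f x by rewrite scale0r add0r.
have D1 : is_derive (0 : R) (1 : R) (fun h : R => f (h *: v + x)) ('D_v f x).
  apply: DeriveDef => //; rewrite /derive.
  by under eq_fun do rewrite /= addr0 scale0r add0r [_%:A]mulr1.
have D2 := @is_derive1_comp _ phi _ 0 (dphi (f x)) _ _ D1.
have {}D2 := D2 ltac:(by rewrite e0).
apply: DeriveDef.
  by apply/derivable1P; case: D2.
case: D2 => _ <-; rewrite /derive.
by under [in RHS]eq_fun do rewrite /= addr0 scale0r add0r [_%:A]mulr1.
Qed.

Lemma Cn_inv n f : (forall x, f x != 0) -> Cn n f -> Cn n (fun x => (f x)^-1).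
Proof.
move=> f0; elim: n f f0 => [|n IH] f f0 Cf.
  by move=> x; apply: continuousV; [exact: f0|exact: Cf].
split=> [x|i]; first by apply: continuousV; [exact: f0|exact: Cn_continuous Cf _].
have [df Cfi] := Cf.2 i.
split=> [x|]; first exact: derivableV.
rewrite (_ : partial i _ =
  cst (-1) * ((fun x => (f x)^-1) * ((fun x => (f x)^-1) * partial i f))).
  by apply: CnM; [exact: Cn_cst|apply: CnM; [|apply: CnM]] => //; apply: IH => //; exact: CnW.
apply/funext => x; rewrite /partial deriveV//.
rewrite -[RHS]/(-1 * ((f x)^-1 * ((f x)^-1 * 'D_(delta_mx 0 i) f x))).
by rewrite mulN1r mulrA -invfM -expr2 scaleNr.
Qed.

Lemma Cn_sqrt n f : (forall x, 0 < f x) -> Cn n f -> Cn n (fun x => Num.sqrt (f x)).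
Proof.
move=> f0; have cs g : continuous g -> continuous (fun x : 'rV[R]_3 => Num.sqrt (g x)).
  by move=> cg x; apply: (continuous_comp (cg x)); exact: sqrt_continuous.
elim: n => [|n IH] Cf; first exact: cs.
have [cf df'] := Cf.
split=> [|i]; first exact: cs.
have [df Cfi] := df' i.
have D x := is_derive_comp1 (dphi := fun t => (2 * Num.sqrt t)^-1) (df x) (is_derive1_sqrt (f0 x)).
split=> [x|]; first by case: (D x).
rewrite (_ : partial i _ = (fun x => ((cst 2 * (fun x => Num.sqrt (f x))) x)^-1) * partial i f).
  apply: CnM => //; apply: Cn_inv => [x|].
    by rewrite -[_ x]/(2 * Num.sqrt (f x)) mulf_neq0 ?gt_eqF ?sqrtr_gt0.
  by apply: CnM; [exact: Cn_cst|apply: IH; exact: CnW].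
by apply/funext => x; rewrite /partial; case: (D x).
Qed.

End SmoothFunctions.

Section SmoothAlgebra.
Context {R : realType}.

Definition smooth_pred : {pred ('rV[R]_3 -> R)} := mem [set f : 'rV[R]_3 -> R | smooth f].

Lemma smooth_predP (f : 'rV[R]_3 -> R) : reflect (smooth f) (f \in smooth_pred).
Proof. by apply: (iffP idP) => [|h]; rewrite inE. Qed.

Lemma smooth_subring_closed : subring_closed smooth_pred.
Proof.
have sm (c : R) : smooth (cst c : 'rV[R]_3 -> R) by move=> n; exact: Cn_cst.
split=> [|f g|f g]; rewrite ?inE.
- exact: (sm 1).
- move=> sf sg n; rewrite (_ : f - g = f + cst (-1) * g).
    by apply: CnD; [exact: sf|apply: CnM; [exact: sm|exact: sg]].
  by apply/funext => x; rewrite -[RHS]/(f x + -1 * g x) mulN1r.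
- by move=> sf sg n; apply: CnM; [exact: sf|exact: sg].
Qed.

HB.instance Definition _ :=
  GRing.isSubringClosed.Build _ smooth_pred smooth_subring_closed.

(** As a commutative ring, smooth functions are open to [ring] and to the abstract identities
    between derivations; evaluation at points is left to the inequalities. *)
Definition sfun := {f : 'rV[R]_3 -> R | f \in smooth_pred}.
HB.instance Definition _ := SubType.on sfun.
HB.instance Definition _ := Choice.on sfun.
HB.instance Definition _ := [SubChoice_isSubComNzRing of sfun by <:].

Definition sfun_fun (f : sfun) : 'rV[R]_3 -> R := val f.
Coercion sfun_fun : sfun >-> Funclass.

Lemma sfun_smooth (f : sfun) : smooth f.
Proof. exact/smooth_predP/(valP f). Qed.

Definition mksf (f : 'rV[R]_3 -> R) (sf : smooth f) : sfun :=
  exist _ f (introT (smooth_predP f) sf).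

Lemma sfun_eq (f g : sfun) : f =1 g -> f = g.
Proof. by move=> fg; apply: val_inj; exact/funext. Qed.

Lemma sfD (f g : sfun) x : (f + g : sfun) x = f x + g x. Proof. by []. Qed.
Lemma sfM (f g : sfun) x : (f * g : sfun) x = f x * g x. Proof. by []. Qed.
Lemma sfN (f : sfun) x : (- f : sfun) x = - f x. Proof. by []. Qed.
Lemma sf1 x : (1 : sfun) x = 1. Proof. by []. Qed.
Lemma sf0 x : (0 : sfun) x = 0. Proof. by []. Qed.
Lemma sfMn (f : sfun) n x : (f *+ n : sfun) x = f x *+ n.
Proof. by elim: n => [|n IH] //; rewrite !mulrS sfD IH. Qed.
Lemma sfX (f : sfun) n x : (f ^+ n : sfun) x = f x ^+ n.
Proof. by elim: n => [|n IH] //; rewrite !exprS sfM IH. Qed.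

Definition sfE := (sfD, sfM, sfN, sf1, sf0, sfMn, sfX).

Lemma smooth_cst (c : R) : smooth (cst c : 'rV[R]_3 -> R).
Proof. by move=> n; exact: Cn_cst. Qed.
Definition sfc (c : R) : sfun := mksf (smooth_cst c).
Lemma sfcE c x : sfc c x = c. Proof. by []. Qed.

Lemma smooth_coord (i : 'I_3) : smooth (fun x : 'rV[R]_3 => x 0 i).
Proof. by move=> n; exact: Cn_coord. Qed.
Definition X (i : 'I_3) : sfun := mksf (smooth_coord i).
Lemma XE i x : X i x = x 0 i. Proof. by []. Qed.

Lemma smooth_partial (V : normedModType R) i (f : 'rV[R]_3 -> V) :
  smooth f -> smooth (partial i f).
Proof. by move=> sf n; have [_ /(_ i)[]] := sf n.+1. Qed.
Definition d (i : 'I_3) (f : sfun) : sfun := mksf (smooth_partial i (sfun_smooth f)).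
Lemma dE i (f : sfun) x : d i f x = partial i f x. Proof. by []. Qed.

Lemma sfun_continuous (f : sfun) : continuous f.
Proof. exact: (@sfun_smooth f 0%N). Qed.

Lemma sfun_derivable i (f : sfun) (x : 'rV[R]_3) : derivable f x (delta_mx 0 i).
Proof. by have [_ /(_ i)[]] := @sfun_smooth f 1%N. Qed.
Arguments sfun_derivable : clear implicits.

Lemma dD i f g : d i (f + g) = d i f + d i g.
Proof.
apply: sfun_eq => x; rewrite sfD !dE /partial.
by have := deriveD (sfun_derivable i f x) (sfun_derivable i g x).
Qed.

Lemma dM i f g : d i (f * g) = d i f * g + f * d i g.
Proof.
apply: sfun_eq => x; rewrite !sfE !dE /partial.
have h := deriveM (sfun_derivable i f x) (sfun_derivable i g x).
by rewrite [LHS]h /GRing.scale /= addrC [X in X + _]mulrC.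
Qed.

Lemma dc i c : d i (sfc c) = 0.
Proof. by apply: sfun_eq => x; rewrite dE /partial derive_cst. Qed.

Lemma dN i f : d i (- f) = - d i f.
Proof. by apply: sfun_eq => x; rewrite sfN !dE /partial; have := deriveN (sfun_derivable i f x). Qed.

Lemma dB i f g : d i (f - g) = d i f - d i g.
Proof. by rewrite dD dN. Qed.

Lemma d1 i : d i 1 = 0.
Proof. by rewrite (_ : (1 : sfun) = sfc 1) ?dc//; exact: sfun_eq. Qed.

Lemma d0 i : d i 0 = 0.
Proof. by rewrite (_ : (0 : sfun) = sfc 0) ?dc//; exact: sfun_eq. Qed.

Lemma dMn i f n : d i (f *+ n) = d i f *+ n.
Proof. by elim: n => [|n IH]; rewrite ?mulr0n ?d0// !mulrS dD IH. Qed.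

Lemma dX i j : d i (X j) = (i == j)%:R.
Proof.
apply: sfun_eq => x; rewrite dE.
have lin : linear (fun x : 'rV[R]_3 => x 0 j) by move=> a u v; rewrite !mxE.
pose L : {linear 'rV[R]_3 -> R} := HB.pack (fun x : 'rV[R]_3 => x 0 j)
  (GRing.isLinear.Build _ _ _ _ (fun x : 'rV[R]_3 => x 0 j) lin).
have diffL := @diff_lin _ _ _ L x.
have h := @differentiable_coord R 1 3 x 0 j.
rewrite /partial deriveE//= diffL /=; last exact: coord_continuous.
by rewrite mxE eqxx /= eq_sym; case: eqP.
Qed.

Definition sfinv (f : sfun) (f0 : forall x, f x != 0) : sfun :=
  mksf (fun n => Cn_inv f0 (sfun_smooth f n)).

Lemma sfinvE f f0 x : @sfinv f f0 x = (f x)^-1. Proof. by []. Qed.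

Lemma sfinvK f f0 : @sfinv f f0 * f = 1.
Proof. by apply: sfun_eq => x; rewrite sfM sfinvE mulVf. Qed.

Lemma d_inv i f f0 : d i (@sfinv f f0) = - (sfinv f0 ^+ 2 * d i f).
Proof.
set g := sfinv f0; have h := sfinvK f0; rewrite -/g in h.
have /(congr1 (d i)) := h; rewrite dM d1 => e.
(* Only g f = 1 and its derivative are used: [d i g * f = - (g * d i f)] is multiplied by [g]. *)
have -> : d i g = d i g * (g * f) by rewrite h mulr1.
rewrite (_ : d i g * (g * f) = g * (d i g * f)); last by ring.
by rewrite (_ : d i g * f = - (g * d i f)); [ring|apply/eqP; rewrite -addr_eq0 e].
Qed.

Definition sfsqrt (f : sfun) (f0 : forall x, 0 < f x) : sfun :=
  mksf (fun n => Cn_sqrt f0 (sfun_smooth f n)).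

Lemma sfsqrtE f f0 x : @sfsqrt f f0 x = Num.sqrt (f x). Proof. by []. Qed.

Lemma sfsqrtK f f0 : @sfsqrt f f0 ^+ 2 = f.
Proof. by apply: sfun_eq => x; rewrite sfX sfsqrtE sqr_sqrtr// ltW. Qed.

Lemma d_sqrt i f f0 : sfc 2 * @sfsqrt f f0 * d i (sfsqrt f0) = d i f.
Proof.
have := congr1 (d i) (sfsqrtK f0); rewrite expr2 dM => <-.
by rewrite (_ : sfc 2 = 2%:R); [ring|apply: sfun_eq => x; rewrite sfMn].
Qed.

End SmoothAlgebra.
Arguments sfun R : clear implicits.
Global Opaque d sfinv sfsqrt sfc X.

(** * Mixed derivatives and curves *)

Section LineCalculus.
Context {R : realType}.
Implicit Types f g : sfun R.

Definition be (i : 'I_3) : 'rV[R]_3 := delta_mx 0 i.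

Lemma is_derive_line (f : 'rV[R]_3 -> R) (x v : 'rV[R]_3) (t : R) :
  derivable f (t *: v + x) v ->
  is_derive t (1 : R) (fun t => f (t *: v + x)) ('D_v f (t *: v + x)).
Proof.
move=> df.
have e : (fun h : R => h^-1 *: (f ((h *: (1 : R) + t) *: v + x) - f (t *: v + x))) =
         (fun h : R => h^-1 *: (f (h *: v + (t *: v + x)) - f (t *: v + x))).
  by apply/funext => h; rewrite [_%:A]mulr1 scalerDl addrA.
apply: DeriveDef; first by rewrite /derivable /= e.
by rewrite /derive /= e.
Qed.

Lemma sf_line f i x t : is_derive t (1 : R) (fun t => f (t *: be i + x)) (d i f (t *: be i + x)).
Proof. by rewrite dE; exact/is_derive_line/sfun_derivable. Qed.

Lemma continuous_derive1 (g dg : R -> R) :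
  (forall t, is_derive t (1 : R) g (dg t)) -> continuous g.
Proof. by move=> h t; apply/differentiable_continuous/derivable1_diffP; case: (h t). Qed.

(** The intermediate point is a fraction [th] of the step, so that positive, negative and zero [h]
    are covered at once. *)
Lemma sf_MVT f i x h : exists th : R, [/\ 0 <= th, th <= 1 &
  f (h *: be i + x) - f x = h * d i f ((th * h) *: be i + x)].
Proof.
pose g t := f (t *: be i + x); pose dg t := d i f (t *: be i + x).
have dgE t : is_derive t (1 : R) g (dg t) by exact: sf_line.
have cg : continuous g by apply: continuous_derive1 dgE.
have g0 : g 0 = f x by rewrite /g scale0r add0r.
have [h0|h0|h0] := ltgtP 0 h.
- have [c] := MVT h0 (fun t _ => dgE t) (continuous_subspaceT cg).
  rewrite in_itv /= => /andP[c0 ch] e; exists (c / h).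
  split; first by rewrite divr_ge0 ?ltW.
    by rewrite ler_pdivrMr ?mul1r ?ltW.
  by rewrite divfK ?gt_eqF// -g0 -/(g h) e subr0 mulrC.
- have [c] := MVT h0 (fun t _ => dgE t) (continuous_subspaceT cg).
  rewrite in_itv /= => /andP[c0 ch] e; exists (c / h).
  split; first by rewrite -mulrNN mulr_ge0 ?oppr_ge0 ?invr_le0 ?ltW.
    by rewrite ler_ndivrMr ?mul1r ?ltW.
  rewrite divfK ?lt_eqF// -g0 -/(g h) -opprB e sub0r mulrN opprK mulrC //.
- exists 0; rewrite lexx ler01; split=> //; rewrite -h0 !scale0r add0r subrr mul0r //.
Qed.

(* Both mixed derivatives are values of the same second difference quotient. *)
Lemma d_sym i j f : d i (d j f) = d j (d i f).
Proof.
have key (a b : 'I_3) (x : 'rV[R]_3) (h : R) : 0 < h ->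
    exists s t : R, [/\ 0 <= s <= h, 0 <= t <= h &
    f (h *: be a + (h *: be b + x)) - f (h *: be a + x) - f (h *: be b + x) + f x =
    h * h * d a (d b f) (s *: be a + (t *: be b + x))].
  move=> h0.
  (* Mean value theorem along [b] for the first difference of [f] in direction [a], then along [a]
     for [d b f]. *)
  pose g t := f (h *: be a + (t *: be b + x)) - f (t *: be b + x).
  pose dg t := d b f (h *: be a + (t *: be b + x)) - d b f (t *: be b + x).
  have dgE t : is_derive t (1 : R) g (dg t).
    apply: is_deriveB; last exact: sf_line.
    have -> : (fun t0 => f (h *: be a + (t0 *: be b + x))) = (fun t0 => f (t0 *: be b + (h *: be a + x))).
      by apply/funext => t0; rewrite addrCA.
    by rewrite addrCA; exact: sf_line.
  have [c cI e] := MVT h0 (fun t _ => dgE t) (continuous_subspaceT (continuous_derive1 dgE)).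
  have [th [th0 th1 e2]] := sf_MVT (d b f) a (c *: be b + x) h.
  exists (th * h), c; split.
  - by apply/andP; split; [exact: mulr_ge0 (ltW h0)|rewrite ger_pMl].
  - by move: cI; rewrite in_itv /= => /andP[/ltW -> /ltW ->].
  move: e; rewrite /g /dg e2 !scale0r !add0r !subr0 => e.
  by rewrite mulrAC -e; ring.
apply: sfun_eq => x; apply/eqP; rewrite -subr_eq0 -normr_le0.
apply/ler_addgt0Pl => e e0; rewrite addr0.
have near_x (g : sfun R) : exists2 h : R, 0 < h & forall (a b : 'I_3) (s t : R),
    0 <= s <= h -> 0 <= t <= h -> `|g x - g (s *: be a + (t *: be b + x))| <= e / 2.
  have := @sfun_continuous _ g x; move/cvgrPdist_le => /(_ (e / 2)).
  rewrite divr_gt0// => /(_ isT) /nbhs_normP [r /= r0 rg].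
  exists (r / 3); first by rewrite divr_gt0.
  move=> a b s t /andP[s0 sr] /andP[t0 tr]; apply: rg => /=.
  rewrite distrC addrA addrK (le_lt_trans (ler_normD _ _))// !normrZ.
  have nb (k : 'I_3) : `|be k| <= 1.
    rewrite /be [leLHS]/Num.Def.normr /= mx_normrE bigmax_le// => -[u v] _.
    by rewrite !mxE; case: (_ && _); rewrite ?normr1 ?normr0.
  rewrite !ger0_norm//.
  have := ler_wpM2l s0 (nb a); have := ler_wpM2l t0 (nb b); lra.
have [h1 h1p n1] := near_x (d i (d j f)); have [h2 h2p n2] := near_x (d j (d i f)).
have h0 : 0 < Num.min h1 h2 by rewrite lt_min h1p.
set h := Num.min h1 h2 in h0.
have [s [t [sI tI e1]]] := key i j x h h0.
have [s' [t' [sI' tI' e2]]] := key j i x h h0.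
have /mulfI cancel : h * h != 0 by rewrite mulf_neq0 ?gt_eqF.
have hh1 : h <= h1 by rewrite ge_min lexx.
have hh2 : h <= h2 by rewrite ge_min lexx orbT.
have widen (r m M : R) : m <= M -> 0 <= r <= m -> 0 <= r <= M.
  by move=> mM /andP[-> /le_trans]; exact.
have {}n1 := n1 i j s t (widen _ _ _ hh1 sI) (widen _ _ _ hh1 tI).
have {}n2 := n2 j i s' t' (widen _ _ _ hh2 sI') (widen _ _ _ hh2 tI').
have E : d i (d j f) (s *: be i + (t *: be j + x)) = d j (d i f) (s' *: be j + (t' *: be i + x)).
  apply: (cancel); apply: etrans (esym e1) _; apply: etrans _ e2.
  rewrite (addrCA (h *: be j)).
  by move: (f _) (f (h *: be i + x)) (f (h *: be j + x)) (f x) => A B C D; ring.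
have {E n1}n1 : `|d i (d j f) x - d j (d i f) (s' *: be j + (t' *: be i + x))| <= e / 2.
  by rewrite -E.
move: (d i (d j f) x) (d j (d i f) x) (d j (d i f) _) n1 n2 => A B C n1 n2.
by rewrite (le_trans (ler_distD C _ _))// [leRHS]splitr lerD// distrC.
Qed.

End LineCalculus.

Definition o0 : 'I_3 := @Ordinal 3 0 isT.
Definition o1 : 'I_3 := @Ordinal 3 1 isT.
Definition o2 : 'I_3 := @Ordinal 3 2 isT.

Section Coordinates.
Context {R : realType}.
Implicit Types f g : sfun R.

Lemma sum3 (V : nmodType) (G : 'I_3 -> V) : \sum_(i < 3) G i = G o0 + G o1 + G o2.
Proof.
rewrite !big_ord_recl big_ord0 addr0 addrA.
by congr (G _ + G _ + G _); exact: val_inj.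
Qed.

Lemma ord3P (P : 'I_3 -> Prop) : P o0 -> P o1 -> P o2 -> forall i, P i.
Proof.
move=> h0 h1 h2 [[|[|[|//]]] hi].
- by rewrite (_ : Ordinal hi = o0)//; exact: val_inj.
- by rewrite (_ : Ordinal hi = o1)//; exact: val_inj.
- by rewrite (_ : Ordinal hi = o2)//; exact: val_inj.
Qed.

Lemma inord0 : (inord 0 : 'I_3) = o0. Proof. by apply: val_inj; rewrite /= inordK. Qed.
Lemma inord1 : (inord 1 : 'I_3) = o1. Proof. by apply: val_inj; rewrite /= inordK. Qed.
Lemma inord2 : (inord 2 : 'I_3) = o2. Proof. by apply: val_inj; rewrite /= inordK. Qed.

Lemma vec3E (a b c : R) : (vec3 a b c 0 o0 = a) * (vec3 a b c 0 o1 = b) * (vec3 a b c 0 o2 = c).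
Proof. by rewrite /vec3 !mxE. Qed.

Lemma vec3_eta (x : 'rV[R]_3) : x = vec3 (x 0 o0) (x 0 o1) (x 0 o2).
Proof. by apply/rowP; apply: ord3P; rewrite !vec3E. Qed.

Lemma vec3_be (a b c : R) : vec3 a b c = a *: be o0 + (b *: be o1 + c *: be o2).
Proof. by apply/rowP; apply: ord3P; rewrite !vec3E !mxE /=; ring. Qed.

(** Smoothness is given by partial derivatives only, so the chain rule is built by hand: the
    increment is split into one step per coordinate, each step is an instance of [sf_MVT], and
    continuity of the partial derivatives at the intermediate points [xi] and [xi'] yields the
    Caratheodory slope. *)
Lemma sf_curve f (a b : R -> R) (da db t : R) (x : 'rV[R]_3) :
  is_derive t (1 : R) a da -> is_derive t (1 : R) b db ->
  is_derive t (1 : R) (fun t => f (a t *: be o0 + (b t *: be o1 + x)))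
   (d o0 f (a t *: be o0 + (b t *: be o1 + x)) * da +
    d o1 f (a t *: be o0 + (b t *: be o1 + x)) * db).
Proof.
move=> Da Db.
have [A [Ae Ac At]] := (is_derive1_caratheodory a t da).1 Da.
have [B [Be Bc Bt]] := (is_derive1_caratheodory b t db).1 Db.
have ca : {for t, continuous a} by apply/differentiable_continuous/derivable1_diffP; case: Da.
have cb : {for t, continuous b} by apply/differentiable_continuous/derivable1_diffP; case: Db.
have H z : exists c : R, [/\ 0 <= c, c <= 1 &
    f (a z *: be o0 + (b z *: be o1 + x)) - f (a t *: be o0 + (b z *: be o1 + x)) =
    (a z - a t) * d o0 f ((c * (a z - a t)) *: be o0 + (a t *: be o0 + (b z *: be o1 + x)))].
  have [c [h0 h1 e]] := sf_MVT f o0 (a t *: be o0 + (b z *: be o1 + x)) (a z - a t).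
  exists c; split=> //; rewrite -e; congr (f _ - _).
  by rewrite [RHS]addrA -scalerDl subrK.
have H' z : exists c : R, [/\ 0 <= c, c <= 1 &
    f (a t *: be o0 + (b z *: be o1 + x)) - f (a t *: be o0 + (b t *: be o1 + x)) =
    (b z - b t) * d o1 f ((c * (b z - b t)) *: be o1 + (a t *: be o0 + (b t *: be o1 + x)))].
  have [c [h0 h1 e]] := sf_MVT f o1 (a t *: be o0 + (b t *: be o1 + x)) (b z - b t).
  exists c; split=> //; rewrite -e; congr (f _ - _).
  by rewrite [RHS]addrCA [X in _ = _ + X]addrA -scalerDl subrK.
have [th thP] := choice H; have [th' thP'] := choice H'.
apply/is_derive1_caratheodory.
pose xi z := (th z * (a z - a t)) *: be o0 + (a t *: be o0 + (b z *: be o1 + x)).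
pose xi' z := (th' z * (b z - b t)) *: be o1 + (a t *: be o0 + (b t *: be o1 + x)).
have xit : xi t = a t *: be o0 + (b t *: be o1 + x) by rewrite /xi subrr mulr0 scale0r add0r.
have xit' : xi' t = a t *: be o0 + (b t *: be o1 + x) by rewrite /xi' subrr mulr0 scale0r add0r.
have small (k c : R -> R) : (forall z, 0 <= k z) -> (forall z, k z <= 1) ->
    {for t, continuous c} -> k z * (c z - c t) @[z --> t] --> (0 : R).
  move=> k0 k1 cc; apply/cvgrPdist_le => e e0.
  move/cvgrPdist_le: cc => /(_ e e0); apply: filterS => z /= cz.
  rewrite sub0r normrN normrM (ger0_norm (k0 z)) -(mul1r e).
  by apply: ler_pM => //; rewrite distrC.
have cxi : xi z @[z --> t] --> xi t.
  have h1 : (th z * (a z - a t)) *: be o0 @[z --> t] --> (0 : R) *: be o0.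
    by apply: cvgZr_tmp; apply: small => // z; case: (thP z).
  have h2 : a t *: be o0 + (b z *: be o1 + x) @[z --> t] --> a t *: be o0 + (b t *: be o1 + x).
    by apply: cvgD; [exact: cvg_cst|apply: cvgD; [exact: cvgZr_tmp|exact: cvg_cst]].
  have h : xi z @[z --> t] --> (0 : R) *: be o0 + (a t *: be o0 + (b t *: be o1 + x)).
    exact: (cvgD h1 h2).
  by move: h; rewrite scale0r add0r xit.
have cxi' : xi' z @[z --> t] --> xi' t.
  have h1 : (th' z * (b z - b t)) *: be o1 @[z --> t] --> (0 : R) *: be o1.
    by apply: cvgZr_tmp; apply: small => // z; case: (thP' z).
  have h : xi' z @[z --> t] --> (0 : R) *: be o1 + (a t *: be o0 + (b t *: be o1 + x)).
    by apply: (cvgD h1); exact: cvg_cst.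
  by move: h; rewrite scale0r add0r xit'.
have c0 : {for t, continuous (d o0 f \o xi)}.
  by apply: continuous_comp; [exact: cxi|exact: sfun_continuous].
have c1 : {for t, continuous (d o1 f \o xi')}.
  by apply: continuous_comp; [exact: cxi'|exact: sfun_continuous].
exists ((d o0 f \o xi) \* A \+ (d o1 f \o xi') \* B); split.
- move=> z; have [_ _ e1] := thP z; have [_ _ e2] := thP' z.
  rewrite -[LHS](subrKA (f (a t *: be o0 + (b z *: be o1 + x)))) e1 e2 -/(xi z) -/(xi' z) Ae Be /=.
  by move: (d o0 f _) (d o1 f _) => u v; ring.
- have m0 := continuousM c0 Ac; have m1 := continuousM c1 Bc.
  exact: (continuousD m0 m1).
- by rewrite /= xit xit' At Bt.
Qed.

Definition reflect_y (x : 'rV[R]_3) : 'rV[R]_3 := vec3 (x 0 o0) (- x 0 o1) (x 0 o2).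

(** Eigenvalue of the reflection on the [i]-th coordinate vector. *)
Definition rsign (i : 'I_3) : R := if i == o1 then -1 else 1.

Lemma reflect_yD h i x : reflect_y (h *: be i + x) = (rsign i * h) *: be i + reflect_y x.
Proof.
apply/rowP; move: i; apply: ord3P; apply: ord3P; rewrite /rsign !(vec3E, mxE)/=; ring.
Qed.

End Coordinates.

(** * Composition with the reflection; the equations component by component *)

Section ReflectionComponents.
Context {R : realType}.
Implicit Types f g : sfun R.

Lemma is_derive_reflect f i x :
  is_derive x (be i) (fun x => f (reflect_y x)) (@rsign R i * d i f (reflect_y x)).
Proof.
have D1 : is_derive (0 : R) (1 : R) (fun h : R => f (h *: be i + reflect_y x)) (d i f (reflect_y x)).
  by have := sf_line f i (reflect_y x) 0; rewrite scale0r add0r.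
have D0 : is_derive (0 : R) (1 : R) (fun h => @rsign R i * h) (@rsign R i).
  have := @is_deriveZ R R R id (@rsign R i) 0 1 1 (is_derive_id _ _).
  by rewrite /GRing.scale /= mulr1.
have D2 : is_derive (0 : R) (1 : R) (fun h : R => f (reflect_y (h *: be i + x)))
    (d i f (reflect_y x) * @rsign R i).
  under eq_fun do rewrite reflect_yD.
  apply: (@is_derive1_comp _ (fun h : R => f (h *: be i + reflect_y x))) => //.
  by rewrite mulr0.
rewrite mulrC; apply: DeriveDef.
  by apply/derivable1P; case: D2.
case: D2 => _ <-; rewrite /derive.
by under [in RHS]eq_fun do rewrite /= addr0 scale0r add0r [_%:A]mulr1.
Qed.

Lemma smooth_reflect f : smooth (fun x => f (reflect_y x)).
Proof.
have cont g : continuous (fun x => g (reflect_y x)).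
  move=> x; apply: (@continuous_comp _ _ _ (@reflect_y R)); last exact: sfun_continuous.
  have -> : @reflect_y R = (fun x => x - (2 * x 0 o1) *: be o1).
    by apply/funext => y; apply/rowP; apply: ord3P; rewrite /reflect_y vec3E !mxE/=; ring.
  have h1 : (fun y : 'rV[R]_3 => y 0 o1) y @[y --> x] --> x 0 o1 by exact: coord_continuous.
  have h2 : (fun y : 'rV[R]_3 => 2 * y 0 o1) y @[y --> x] --> 2 * x 0 o1.
    exact: (@cvgMl_tmp _ _ (nbhs x) _ (fun y : 'rV[R]_3 => y 0 o1) 2 _ h1).
  have h3 : (fun y : 'rV[R]_3 => (2 * y 0 o1) *: be o1) y @[y --> x] --> (2 * x 0 o1) *: be o1.
    exact: (@cvgZr_tmp _ _ _ (nbhs x) _ (fun y : 'rV[R]_3 => 2 * y 0 o1) _ (be o1) h2).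
  by apply: (cvgB _ h3); exact: cvg_id.
move=> n; elim: n f => [|n IH] f; first exact: cont.
split=> [|i]; first exact: cont.
have D x := is_derive_reflect f i x.
split=> [x|]; first by case: (D x).
rewrite (_ : partial i _ = cst (@rsign R i) * (fun x => d i f (reflect_y x))).
  by apply: CnM; [exact: Cn_cst|exact: IH].
by apply/funext => x; rewrite /partial; case: (D x).
Qed.

Definition sfrefl f : sfun R := mksf (smooth_reflect f).
Lemma sfreflE f x : sfrefl f x = f (reflect_y x). Proof. by []. Qed.

Global Opaque sfrefl.

Lemma Cn_comp_mx n (u : 'rV[R]_3 -> 'rV[R]_3) j : Cn n u -> Cn n (fun x => u x 0 j).
Proof.
have cj : continuous (fun x : 'rV[R]_3 => x 0 j) by move=> x; exact: coord_continuous.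
have cc (v : 'rV[R]_3 -> 'rV[R]_3) : continuous v -> continuous (fun x => v x 0 j).
  move=> cv x.
  exact: (@continuous_comp _ _ _ v (fun y : 'rV[R]_3 => y 0 j) x (cv x) (cj (v x))).
elim: n u => [|n IH] u Cu; first exact: cc.
have [cu du'] := Cu.
split=> [|i]; first exact: cc.
have [du Cui] := du' i.
split=> [x|]; first by have /derivable_mxP := du x; exact.
rewrite (_ : partial i _ = fun x => partial i u x 0 j); first exact: IH.
by apply/funext => x; rewrite /partial derive_mx// mxE.
Qed.

Lemma smooth_comp_mx (u : 'rV[R]_3 -> 'rV[R]_3) j : smooth u -> smooth (fun x => u x 0 j).
Proof. by move=> su n; exact: Cn_comp_mx. Qed.

Lemma partial_mx (u : 'rV[R]_3 -> 'rV[R]_3) i x j : smooth u ->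
  partial i u x 0 j = partial i (fun x => u x 0 j) x.
Proof.
move=> su; have [_ /(_ i)[du _]] := su 1%N.
by rewrite /partial derive_mx// mxE.
Qed.

Lemma navier_stokes_components (u : 'rV[R]_3 -> 'rV[R]_3) (p : 'rV[R]_3 -> R)
    (U : 'I_3 -> sfun R) (P : sfun R) :
  smooth u -> smooth p -> (forall i x, U i x = u x 0 i) -> (forall x, P x = p x) ->
  steady_navier_stokes u p ->
  (forall j, U o0 * d o0 (U j) + U o1 * d o1 (U j) + U o2 * d o2 (U j) + d j P =
    d o0 (d o0 (U j)) + d o1 (d o1 (U j)) + d o2 (d o2 (U j))) /\
  d o0 (U o0) + d o1 (U o1) + d o2 (U o2) = 0.
Proof.
move=> su sp Uu Pp ns.
have UE j : (U j : _ -> _) = (fun x => u x 0 j) by apply/funext => x; exact: Uu.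
have dU i j x : d i (U j) x = partial i u x 0 j by rewrite dE UE partial_mx.
have ddU i j x : d i (d i (U j)) x = partial i (partial i u) x 0 j.
  rewrite dE (_ : (d i (U j) : _ -> _) = fun x => partial i u x 0 j); last by apply/funext => y.
  by rewrite partial_mx//; exact: smooth_partial.
split=> [j|]; apply: sfun_eq => x; have [e1 e2] := ns x.
  have PE : (P : _ -> _) = p by apply/funext => y; rewrite Pp.
  have : gradient p x 0 j = d j P x by rewrite mxE dE PE.
  rewrite !sfD !sfM.
  rewrite (dU o0 j x) (dU o1 j x) (dU o2 j x).
  rewrite (ddU o0 j x) (ddU o1 j x) (ddU o2 j x).
  rewrite (Uu o0 x) (Uu o1 x) (Uu o2 x).
  move=> <-.
  move: e1; rewrite /convection /laplacian !sum3.
  move: (gradient p x) (partial o0 u x) (partial o1 u x) (partial o2 u x) (u x)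
    (partial o0 (partial o0 u) x) (partial o1 (partial o1 u) x) (partial o2 (partial o2 u) x).
  move=> g a0 a1 a2 v b0 b1 b2 /(congr1 (fun v : 'rV[R]_3 => v 0 j)).
  by rewrite !mxE.
rewrite !sfE (dU o0 o0 x) (dU o1 o1 x) (dU o2 o2 x).
by move: e2; rewrite /divergence sum3.
Qed.

End ReflectionComponents.

(** * Bump functions *)

Section Bump.
Context {R : realType}.

(* Up to a shift of n the family is closed under d/dt and under multiplication by t, so every
   cut-off used below is a polynomial in functions [beta n \o f]. *)
Definition beta (n : nat) (t : R) : R :=
  if 0 < t then t^-1 ^+ n * expR (- t^-1) else 0.

Lemma beta_pos n t : 0 < t -> beta n t = t^-1 ^+ n * expR (- t^-1).
Proof. by rewrite /beta => ->. Qed.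

Lemma beta_npos n t : t <= 0 -> beta n t = 0.
Proof. by rewrite /beta ltNge => ->. Qed.

Lemma beta_ge0 n t : 0 <= beta n t.
Proof.
rewrite /beta; case: ifPn => // t0.
by rewrite mulr_ge0 ?expR_ge0// exprn_ge0// invr_ge0 ltW.
Qed.

Lemma beta_gt0 n t : 0 < t -> 0 < beta n t.
Proof. by move=> t0; rewrite beta_pos// mulr_gt0 ?expR_gt0// exprn_gt0 ?invr_gt0. Qed.

(** For n > 0, e^x is the n-th power of e^{x/n}, which is at least x/n. This is the source of the
    explicit bounds n^n on [beta n]. *)
Lemma expR_ge_pow n (x : R) : 0 <= x -> x ^+ n <= n%:R ^+ n * expR x.
Proof.
case: n => [|n] x0; first by rewrite !expr0 mul1r -expR0 ler_expR.
have -> : expR x = expR (x / n.+1%:R) ^+ n.+1.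
  by rewrite -expRM_natl mulrC divfK.
rewrite -exprMn; apply: lerXn2r; rewrite ?nnegrE ?mulr_ge0 ?expR_ge0//.
rewrite mulrC -ler_pdivrMr ?ltr0n//.
by apply: le_trans (expR_ge1Dx _); rewrite lerDr.
Qed.

Lemma beta_le n t : beta n t <= n%:R ^+ n.
Proof.
have [t0|t0] := ltP 0 t; last by rewrite beta_npos// exprn_ge0.
rewrite beta_pos// expRN ler_pdivrMr ?expR_gt0//.
by apply: expR_ge_pow; rewrite invr_ge0 ltW.
Qed.

Lemma beta_mul n t : t * beta n.+1 t = beta n t.
Proof.
rewrite /beta; case: ifPn => t0; last by rewrite mulr0.
by rewrite exprS !mulrA divff ?mul1r// gt_eqF.
Qed.

Lemma beta0_le1 t : beta 0 t <= 1.
Proof. by have := beta_le 0 t; rewrite expr0. Qed.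

(** Decay at infinity: it makes the error in the transition layer tend to 0 pointwise when the level
    goes to infinity. *)
Lemma beta_leX n k t : 0 < t -> beta (n + k) t <= n%:R ^+ n * t^-1 ^+ k.
Proof.
move=> t0; rewrite beta_pos// exprD mulrAC -beta_pos//.
by apply: ler_wpM2r (beta_le n t); rewrite exprn_ge0// invr_ge0 ltW.
Qed.

Lemma is_derive_beta n t : is_derive t (1 : R) (beta n) (beta n.+2 t - n%:R * beta n.+1 t).
Proof.
have [t0|t0|t0] := ltgtP 0 t.
- have tn0 : t != 0 by rewrite gt_eqF.
  have D1 : is_derive t (1 : R) (fun s : R => s^-1) (- t ^- 2).
    have := @is_deriveV _ id t 1 1 tn0 (is_derive_id _ _).
    by rewrite /GRing.scale /= mulr1.
  have D2 : is_derive t (1 : R) (fun s : R => expR (- s^-1)) (expR (- t^-1) * t ^- 2).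
    apply: (@is_derive1_comp _ expR (fun s => - s^-1)).
    by apply: is_derive_eq; rewrite opprK.
  have D3 := is_deriveX n D1.
  have D4 := is_deriveM D3 D2.
  apply: (@near_eq_is_derive _ _ _ ((fun s : R => s^-1) ^+ n * (fun s : R => expR (- s^-1)))).
    near=> s; rewrite beta_pos; last by near: s; exact: lt_nbhsr.
    by rewrite -[LHS]/(((fun s : R => s^-1) ^+ n) s * _) fctE.
  apply: (is_derive_eq D4); rewrite !beta_pos// /GRing.scale /= fctE.
  case: (n) => [|m]; rewrite ?expr0 !exprS ?expr0 ?mulr1 /=; first by field.
  by field.
- apply: (@near_eq_is_derive _ _ _ (cst 0)).
    near=> s; rewrite beta_npos//; apply: ltW; near: s; exact: lt_nbhsl.
  by rewrite !beta_npos ?ltW// mulr0 subr0; exact: is_derive_cst.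
- subst t; rewrite !beta_npos// mulr0 subr0.
  apply/is_derive1_caratheodory.
  (* By [beta_mul] the difference quotient at 0 is [beta n.+1], which in turn is t times the bounded
     function [beta n.+2], hence tends to 0. *)
  exists (beta n.+1); split.
  + by move=> z; rewrite (beta_npos _ (lexx 0)) !subr0 mulrC beta_mul.
  + apply/cvgrPdist_le => e e0; rewrite beta_npos//.
    pose C : R := n.+2%:R ^+ n.+2.
    have C0 : 0 < C by rewrite exprn_gt0 ?ltr0n.
    near=> z; rewrite sub0r normrN ger0_norm ?beta_ge0// -beta_mul.
    have [z0|z0] := ltP 0 z; last by rewrite beta_npos// mulr0 ltW.
    rewrite (@le_trans _ _ (z * C))//; first by rewrite ler_wpM2l ?beta_le// ltW.
    rewrite -ler_pdivlMr//; apply: ltW; near: z; apply: lt_nbhsl; exact: divr_gt0.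
  + by rewrite beta_npos.
Unshelve. all: by end_near. Qed.

Lemma Cn_beta n m (f : 'rV[R]_3 -> R) : Cn n f -> Cn n (beta m \o f).
Proof.
have cb k : continuous (beta k) by exact: continuous_derive1 (is_derive_beta k).
have cc k (g : 'rV[R]_3 -> R) : continuous g -> continuous (beta k \o g).
  by move=> cg x; apply: continuous_comp; [exact: cg|exact: cb].
elim: n m f => [|n IH] m f Cf; first exact: cc.
have [cf df'] := Cf.
split=> [|i]; first exact: cc.
have [df Cfi] := df' i.
have D x := is_derive_comp1 (dphi := fun t => beta m.+2 t - m%:R * beta m.+1 t)
  (df x) (is_derive_beta m (f x)).
split=> [x|]; first by case: (D x).
rewrite (_ : partial i _ =
  ((beta m.+2 \o f) + cst (- m%:R) * (beta m.+1 \o f)) * partial i f).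
  have Cf' := CnW Cf.
  by apply: CnM => //; apply: CnD; [exact: IH|apply: CnM; [exact: Cn_cst|exact: IH]].
apply/funext => x; rewrite /partial; case: (D x) => _ ->.
by rewrite -[RHS]/((beta m.+2 (f x) + (- m%:R) * beta m.+1 (f x)) * _) mulNr.
Qed.

Definition sfbeta m (f : sfun R) : sfun R := mksf (fun n => Cn_beta m (sfun_smooth f n)).
Lemma sfbetaE m f x : sfbeta m f x = beta m (f x). Proof. by []. Qed.

Lemma d_beta i m f :
  d i (sfbeta m f) = (sfbeta m.+2 f - sfbeta m.+1 f *+ m) * d i f.
Proof.
apply: sfun_eq => x; rewrite sfM sfD sfN sfMn !sfbetaE !dE.
have [_ h] := is_derive_comp1 (dphi := fun t => beta m.+2 t - m%:R * beta m.+1 t)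
  (@sfun_derivable _ i f x) (is_derive_beta m (f x)).
by rewrite -[LHS]/('D_(delta_mx 0 i) (beta m \o f) x) h mulr_natl.
Qed.

End Bump.
Global Opaque sfbeta.

(** * Integration over R^3 *)

Section Measurability.
Context {R : realType}.

(* f is the limit of the functions obtained by rounding y down to a multiple of 1/(n+1). *)
Lemma measurable_fun_caratheodory dT (T : measurableType dT) (f : T * measurableTypeR R -> R) :
  (forall y, measurable_fun setT (fun x => f (x, y))) ->
  (forall x, continuous (fun y : R => f (x, y))) ->
  measurable_fun setT f.
Proof.
move=> mf cf.
pose s (n : nat) (y : R) : R := (Num.floor (y * n.+1%:R))%:~R / n.+1%:R.
apply: (@measurable_fun_cvg _ _ _ setT (fun n q => f (q.1, s n q.2))).
- move=> n _ B mB; rewrite setTI.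
  have -> : (fun q : T * measurableTypeR R => f (q.1, s n q.2)) @^-1` B =
      \bigcup_(k : int) (((fun x => f (x, k%:~R / n.+1%:R)) @^-1` B) `*`
        [set y : measurableTypeR R | k%:~R <= y * n.+1%:R < (k + 1)%:~R]).
    apply/seteqP; split => [[x y] /= h|[x y] [k _] /= [h]].
      by exists (Num.floor (y * n.+1%:R)) => //=; split=> //; exact: floor_itv.
    by rewrite -floor_eq => /eqP e; rewrite /s e.
  apply: countable_bigcupT_measurable => [|k]; first exact: countableP.
  apply: measurableX; first by rewrite -[X in measurable X]setTI; exact: mf.
  have -> : [set y : measurableTypeR R | k%:~R <= y * n.+1%:R < (k + 1)%:~R] =
      [set` `[k%:~R / n.+1%:R, (k + 1)%:~R / n.+1%:R[ ].
    by apply/seteqP; split=> y /=; rewrite in_itv /= ler_pdivrMr ?ltr0n// ltr_pdivlMr ?ltr0n.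
  exact: measurable_itv.
- move=> [x y] _ /=.
  apply: (@cvg_comp _ _ _ (fun n => s n y) (fun y => f (x, y)) _ (nbhs y)); last exact: cf.
  apply/cvgrPdist_lt => e e0.
  near=> n.
  rewrite /s ger0_norm; last first.
    by rewrite subr_ge0 ler_pdivrMr ?ltr0n// floor_le.
  have h := floorD1_gt (y * n.+1%:R).
  rewrite -(ltr_pM2r (_ : 0 < n.+1%:R)) ?ltr0n// mulrBl divfK ?pnatr_eq0//.
  rewrite (@lt_trans _ _ 1)//.
    by move: h; rewrite intrD; lra.
  rewrite -ltr_pdivrMl// mulr1 -invf_plt ?posrE//.
  near: n; exact: (near_infty_natSinv_lt (PosNum e0)).
Unshelve. all: by end_near. Qed.

Lemma continuous_line (k : 'I_3) (x : 'rV[R]_3) (f : 'rV[R]_3 -> R) :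
  continuous f -> continuous (fun t : R => f (t *: be k + x)).
Proof.
move=> cf t; apply: (@continuous_comp _ _ _ (fun t : R => t *: be k + x)); last exact: cf.
have h : (fun t : R => t *: be k + x) s @[s --> t] --> t *: be k + x.
  by apply: cvgD; [apply: cvgZr_tmp; exact: cvg_id|exact: cvg_cst].
exact: h.
Qed.

Lemma pt3_x (x y z : R) : pt3 (x, y, z) = x *: be o0 + (y *: be o1 + z *: be o2).
Proof. by rewrite /pt3 vec3_be. Qed.
Lemma pt3_y (x y z : R) : pt3 (x, y, z) = y *: be o1 + (x *: be o0 + z *: be o2).
Proof. by rewrite pt3_x addrCA. Qed.
Lemma pt3_z (x y z : R) : pt3 (x, y, z) = z *: be o2 + (x *: be o0 + y *: be o1).
Proof. by rewrite pt3_x addrA addrC. Qed.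

(** Continuity lives on row vectors and integration on triples: measurability for the product
    structure is obtained by freeing one coordinate after the other, with continuity along lines in
    the last one. *)
Lemma measurable_pt3 (f : 'rV[R]_3 -> R) : continuous f ->
  measurable_fun setT (fun q : measurableTypeR R * measurableTypeR R * measurableTypeR R => f (pt3 q)).
Proof.
move=> cf; apply: measurable_fun_caratheodory => [z|[x y]].
  apply: measurable_fun_caratheodory => [y|x].
    under eq_fun do rewrite pt3_x.
    by apply: continuous_measurable_fun; exact: continuous_line.
  by under eq_fun do rewrite pt3_y; exact: continuous_line.
by under eq_fun do rewrite pt3_z; exact: continuous_line.
Qed.

Lemma integrable_bounded_supp dT (T : measurableType dT) (mu : {measure set T -> \bar R})
    (A : set T) (f : T -> R) (C : R) :
  measurable A -> (mu A < +oo)%E -> measurable_fun setT f ->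
  (forall x, `|f x| <= C) -> (forall x, ~ A x -> f x = 0) ->
  mu.-integrable setT (EFin \o f).
Proof.
move=> mA Afin mf fC f0.
have -> : EFin \o f = (EFin \o f) \_ A.
  apply/funext => x; rewrite patchE; case: ifPn => //= /negP xA.
  by rewrite f0// => Ax; apply: xA; rewrite inE.
apply/(integrable_mkcond _ mA); apply: measurable_bounded_integrable => //.
  exact: measurable_funS mf.
exists C; split; first exact: num_real.
by move=> M CM x _ /=; rewrite (le_trans (fC x))// ltW.
Qed.

(** Support in a cube rather than a compact closure: the cube restricts directly to the lines and
    planes met in iterated integrals. *)
Definition csupp (f : 'rV[R]_3 -> R) : Prop :=
  exists M : R, forall x : 'rV[R]_3, f x != 0 -> forall i, `|x 0 i| <= M.

Lemma csupp_bounded (f : 'rV[R]_3 -> R) : continuous f -> csupp f -> exists C : R, forall x, `|f x| <= C.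
Proof.
move=> cf [M fM].
pose A := [set v : 'rV[R]_3 | forall i, `[- M, M]%classic (v 0 i)].
have cA : compact A by apply: (@rV_compact _ _ (fun=> `[- M, M]%classic)) => i; exact: segment_compact.
have [A0|A0] := pselect (A !=set0); last first.
  exists 0 => x; have [->|/fM xM] := eqVneq (f x) 0; first by rewrite normr0.
  by exfalso; apply: A0; exists x => i; rewrite /= in_itv /= -ler_norml.
have [c _ cmax] := @EVT_max_rV R 3 (fun x => `|f x|) A A0 cA
  (continuous_subspaceT (fun x => continuous_comp (cf x) (@norm_continuous _ _ _))).
exists `|f c| => x; have [->|/fM xM] := eqVneq (f x) 0; first by rewrite normr0.
by apply: cmax; rewrite inE => i; rewrite /= in_itv /= -ler_norml.
Qed.

Definition itvM (M : R) : set (measurableTypeR R) := `[- M, M]%classic.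

Lemma measurable_itvM M : measurable (itvM M).
Proof. exact: measurable_itv. Qed.

Lemma itvM_fin M : (@lebesgue_measure R (itvM M) < +oo)%E.
Proof. by rewrite /itvM lebesgue_measure_itv; case: ifP => _; rewrite ltry. Qed.

Lemma itvMX_fin M :
  ((@lebesgue_measure R \x @lebesgue_measure R) (itvM M `*` itvM M) < +oo)%E.
Proof.
have E := @product_measure1E _ _ _ _ _ (@lebesgue_measure R) (@lebesgue_measure R)
  _ _ (measurable_itvM M) (measurable_itvM M).
apply: (@le_lt_trans _ _ (lebesgue_measure (itvM M) * lebesgue_measure (itvM M))%E).
  by rewrite -E.
by apply: lte_mul_pinfty (itvM_fin M) => //; rewrite ge0_fin_numE ?itvM_fin.
Qed.

Lemma itvMX3_fin M : (@leb3 R (itvM M `*` itvM M `*` itvM M) < +oo)%E.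
Proof.
have E := @product_measure1E _ _ _ _ _ (@lebesgue_measure R \x @lebesgue_measure R)%E
  (@lebesgue_measure R) _ _ (measurableX (measurable_itvM M) (measurable_itvM M)) (measurable_itvM M).
apply: (@le_lt_trans _ _ ((lebesgue_measure \x lebesgue_measure)%E (itvM M `*` itvM M) *
  lebesgue_measure (itvM M))%E).
  by rewrite -E.
by apply: lte_mul_pinfty (itvM_fin M) => //; rewrite ge0_fin_numE ?itvMX_fin.
Qed.

Lemma csupp_out (f : 'rV[R]_3 -> R) M q : (forall x : 'rV[R]_3, f x != 0 -> forall i, `|x 0 i| <= M) ->
  ~ (itvM M `*` itvM M `*` itvM M) q -> f (pt3 q) = 0.
Proof.
move=> fM nq; apply/eqP/negPn/negP => /fM h; apply: nq.
by rewrite /itvM /= !in_itv /= -!ler_norml; have := (h o0, h o1, h o2); rewrite /pt3 !vec3E => -[[]].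
Qed.

Definition integrable3 (f : 'rV[R]_3 -> R) : Prop :=
  (@leb3 R).-integrable setT (EFin \o (f \o pt3)).

Lemma csupp_integrable (f : 'rV[R]_3 -> R) : continuous f -> csupp f -> integrable3 f.
Proof.
move=> cf /[dup] /(csupp_bounded cf)[C fC] [M fM].
apply: (@integrable_bounded_supp _ _ _ (itvM M `*` itvM M `*` itvM M) _ C).
- by apply: measurableX; [apply: measurableX|]; exact: measurable_itvM.
- exact: itvMX3_fin.
- exact: measurable_pt3.
- by move=> q; exact: fC.
- by move=> q; exact: csupp_out.
Qed.

Lemma integral_derive1_csupp (g dg : R -> R) (M : R) :
  (forall t, is_derive t (1 : R) g (dg t)) -> continuous dg ->
  (forall t, M < `|t| -> g t = 0) ->
  (\int[@lebesgue_measure R]_t (dg t)%:E = 0)%E.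
Proof.
move=> Dg cdg gM.
have cg : continuous g by exact: continuous_derive1 Dg.
have dg0 t : M < `|t| -> dg t = 0.
  move=> Mt; have [_ <-] := Dg t.
  have -> : 'D_1 g t = 'D_1 (cst 0 : R -> R) t.
    apply: near_eq_derive; near=> s; apply: gM; near: s.
    have : {for t, continuous (fun s : R => `|s|)} by exact: norm_continuous.
    by move/(_ _ (lt_nbhsr Mt)).
  exact: derive_cst.
(* Strictly beyond [M], so that [g] vanishes at both ends of the interval. *)
pose N : R := `|M| + 1.
have N0 : 0 < N by rewrite ltr_wpDl.
have MN : M < N by rewrite (le_lt_trans (ler_norm _))// ltrDl.
have -> : (\int[lebesgue_measure]_t (dg t)%:E = \int[lebesgue_measure]_(t in `[(- N)%R, N]) (dg t)%:E)%E.
  rewrite [RHS]integral_mkcond; apply: eq_integral => t _; rewrite patchE.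
  case: ifPn => // /negP tN; rewrite dg0// (lt_le_trans MN)// leNgt; apply/negP => tN'.
  by apply: tN; rewrite inE /= in_itv /= -ler_norml ltW.
rewrite (@continuous_FTC2 _ _ g).
- by rewrite !gM ?normrN ?ger0_norm ?ltW// subee.
- by rewrite gtrN.
- exact: continuous_subspaceT.
- split.
  + by move=> t _; case: (Dg t).
  + by apply: cvg_at_right_filter; exact: cg.
  + by apply: cvg_at_left_filter; exact: cg.
- by move=> t _; rewrite derive1E; case: (Dg t).
Unshelve. all: by end_near. Qed.

Lemma csupp_d i (f : sfun R) : csupp f -> csupp (d i f).
Proof.
move=> [M fM]; exists M => x dfx j; rewrite leNgt; apply/negP => xM.
case/negP: dfx; apply/eqP; rewrite dE /partial.
have -> : 'D_(delta_mx 0 i) f x = 'D_(delta_mx 0 i) (cst 0 : 'rV[R]_3 -> R) x.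
  apply: near_eq_derive.
  have cj : {for x, continuous (fun y : 'rV[R]_3 => `|y 0 j|)}.
    have c1 : {for x, continuous (fun y : 'rV[R]_3 => y 0 j)} by exact: coord_continuous.
    exact: (continuous_comp c1 (@norm_continuous _ _ (x 0 j))).
  near=> y; apply/eqP/negPn/negP => /fM /(_ j); rewrite leNgt.
  by apply/negP/negPn; near: y; exact: (cj _ (lt_nbhsr xM)).
exact: derive_cst.
Unshelve. all: by end_near. Qed.

(** The plane measure gets a name of its own so that the sigma-finiteness required by Fubini for its
    product with the line can be attached to it. *)
Definition L1 : {sigma_finite_measure set (measurableTypeR R) -> \bar R} :=
  @lebesgue_measure R.
Definition L2 : set (measurableTypeR R * measurableTypeR R) -> \bar R := (L1 \x L1)%E.
HB.instance Definition _ := Measure.on L2.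

Lemma L2_sigma_finite : sigma_finite setT L2.
Proof.
have /sigma_finiteP[F [TF ndF Foo]] := sigma_finiteT L1.
exists (fun n => F n `*` F n).
  apply/seteqP; split=> // -[x y] _.
  have [n _ Fnx] : (\bigcup_i F i) x by rewrite -TF.
  have [k _ Fky] : (\bigcup_i F i) y by rewrite -TF.
  exists (maxn n k) => //; split.
  - by move: x Fnx; exact/subsetPset/ndF/leq_maxl.
  - by move: y Fky; exact/subsetPset/ndF/leq_maxr.
move=> k; have [mF Ffin] := Foo k.
split; first exact: measurableX.
have E := @product_measure1E _ _ _ _ _ L1 L1 _ _ mF mF.
apply: (@le_lt_trans _ _ (L1 (F k) * L1 (F k))%E); first by rewrite -E.
by rewrite lte_mul_pinfty// ge0_fin_numE.
Qed.
HB.instance Definition _ := Measure_isSigmaFinite.Build _ _ _ L2 L2_sigma_finite.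

Local Notation R3 := (measurableTypeR R * measurableTypeR R * measurableTypeR R)%type.
Local Notation R2 := (measurableTypeR R * measurableTypeR R)%type.

Lemma leb3_fubini_z (F : R3 -> \bar R) : (@leb3 R).-integrable setT F ->
  (\int[@leb3 R]_q F q = \int[L2]_p \int[L1]_z F (p, z))%E.
Proof. by move=> iF; have := @integral12_prod_meas1 _ _ _ _ R L2 L1 F iF. Qed.

Lemma leb3_fubini_xy (F : R3 -> \bar R) : (@leb3 R).-integrable setT F ->
  (\int[@leb3 R]_q F q = \int[L1]_z \int[L2]_p F (p, z))%E.
Proof. by move=> iF; have := @integral21_prod_meas1 _ _ _ _ R L2 L1 F iF. Qed.

Lemma L2_fubini_y (F : R2 -> \bar R) : L2.-integrable setT F ->
  (\int[L2]_q F q = \int[L1]_x \int[L1]_y F (x, y))%E.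
Proof. by move=> iF; have := @integral12_prod_meas1 _ _ _ _ R L1 L1 F iF. Qed.

Lemma L2_fubini_x (F : R2 -> \bar R) : L2.-integrable setT F ->
  (\int[L2]_q F q = \int[L1]_y \int[L1]_x F (x, y))%E.
Proof. by move=> iF; have := @integral21_prod_meas1 _ _ _ _ R L1 L1 F iF. Qed.

Lemma leb3_tonelli_z (F : R3 -> \bar R) : measurable_fun setT F -> (forall q, 0 <= F q)%E ->
  (\int[@leb3 R]_q F q = \int[L2]_p \int[L1]_z F (p, z))%E.
Proof. by move=> mF F0; have := @fubini_tonelli1 _ _ _ _ R L2 L1 F mF F0. Qed.

Lemma leb3_tonelli_xy (F : R3 -> \bar R) : measurable_fun setT F -> (forall q, 0 <= F q)%E ->
  (\int[@leb3 R]_q F q = \int[L1]_z \int[L2]_p F (p, z))%E.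
Proof. by move=> mF F0; have := @fubini_tonelli2 _ _ _ _ R L2 L1 F mF F0. Qed.

Lemma L2_tonelli_y (F : R2 -> \bar R) : measurable_fun setT F -> (forall q, 0 <= F q)%E ->
  (\int[L2]_q F q = \int[L1]_x \int[L1]_y F (x, y))%E.
Proof. by move=> mF F0; have := @fubini_tonelli1 _ _ _ _ R L1 L1 F mF F0. Qed.

Lemma L2_tonelli_x (F : R2 -> \bar R) : measurable_fun setT F -> (forall q, 0 <= F q)%E ->
  (\int[L2]_q F q = \int[L1]_y \int[L1]_x F (x, y))%E.
Proof. by move=> mF F0; have := @fubini_tonelli2 _ _ _ _ R L1 L1 F mF F0. Qed.

Lemma integral_d i (f : sfun R) : csupp f -> (\int[@leb3 R]_q (d i f (pt3 q))%:E = 0)%E.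
Proof.
move=> cf; have id := csupp_integrable (sfun_continuous (f := d i f)) (csupp_d i cf).
have [M fM] := cf.
have line k (x : 'rV[R]_3) : (forall t : R, (t *: be k + x) 0 k = t) ->
    (\int[@lebesgue_measure R]_t (d k f (t *: be k + x))%:E = 0)%E.
  move=> xk; apply: (@integral_derive1_csupp (fun t => f (t *: be k + x)) _ M).
  - by move=> t; exact: sf_line.
  - exact: continuous_line (sfun_continuous (f := d k f)).
  - by move=> t Mt; apply/eqP/negPn/negP => /fM /(_ k); rewrite xk leNgt Mt.
have [C dfC] := csupp_bounded (sfun_continuous (f := d i f)) (csupp_d i cf).
have [N dN] := csupp_d i cf.
have slice z : L2.-integrable setT
    (EFin \o (fun q : measurableTypeR R * measurableTypeR R => d i f (pt3 (q, z)))).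
  apply: (@integrable_bounded_supp _ _ _ (itvM N `*` itvM N) _ C).
  - by apply: measurableX; exact: measurable_itvM.
  - exact: itvMX_fin.
  - apply: (measurableT_comp (measurable_pt3 (sfun_continuous (f := d i f)))).
    exact: measurable_fun_pair.
  - by move=> q; exact: dfC.
  - by move=> q nq; apply: (csupp_out dN) => -[].
(* In each case the order of integration puts the differentiated variable innermost, where the
   fundamental theorem of calculus gives 0. *)
move: i id {dfC dN C N} slice; apply: ord3P => id slice.

- rewrite leb3_fubini_xy//; apply: integral0_eq => z _.
  rewrite L2_fubini_x; last exact: slice.
  apply: integral0_eq => y _ /=; under eq_integral do rewrite pt3_x.
  by apply: line => t; rewrite !mxE /=; ring.
- rewrite leb3_fubini_xy//; apply: integral0_eq => z _.
  rewrite L2_fubini_y; last exact: slice.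
  apply: integral0_eq => x _ /=; under eq_integral do rewrite pt3_y.
  by apply: line => t; rewrite !mxE /=; ring.
- rewrite leb3_fubini_z//; apply: integral0_eq => -[x y] _ /=.
  under eq_integral do rewrite pt3_z.
  by apply: line => t; rewrite !mxE /=; ring.
Qed.

End Measurability.

(** * Cauchy-Schwarz and integrals along lines and planes *)

Section SobolevExistence.
Context {R : realType}.
Local Notation R3 := (measurableTypeR R * measurableTypeR R * measurableTypeR R)%type.
Local Notation R2 := (measurableTypeR R * measurableTypeR R)%type.

Lemma cauchy_schwarz_le dT (T : measurableType dT) (mu : {measure set T -> \bar R})
    (a b : T -> R) (P Q : R) :
  measurable_fun setT a -> measurable_fun setT b ->
  (forall x, 0 <= a x) -> (forall x, 0 <= b x) -> 0 <= P -> 0 <= Q ->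
  (\int[mu]_x (a x ^+ 2)%:E <= P%:E)%E -> (\int[mu]_x (b x ^+ 2)%:E <= Q%:E)%E ->
  (\int[mu]_x (a x * b x)%:E <= (Num.sqrt (P * Q))%:E)%E.
Proof.
move=> ma mb a0 b0 P0 Q0 aP bQ.
have h2 : (2^-1 + 2^-1 = 1 :> R)%R by lra.
have := @hoelder _ _ _ mu a b 2 2 ma mb (ltr0Sn _ 1) (ltr0Sn _ 1) h2.
rewrite Lnorm1; under eq_integral => x _ do rewrite /= ger0_norm ?mulr_ge0//.
move=> /le_trans; apply.
have N2 (c : T -> R) (K : R) : (forall x, 0 <= c x) -> 0 <= K ->
    (\int[mu]_x (c x ^+ 2)%:E <= K%:E)%E -> ('N[mu]_2%:E[(EFin \o c)] <= (Num.sqrt K)%:E)%E.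
  move=> c0 K0 cK; rewrite unlock /=.
  under eq_integral => x _ do rewrite /= ger0_norm// powR_mulrn//.
  rewrite -powR12_sqrt// -poweR_EFin; apply: gt0_ler_poweR => //.
  - by rewrite in_itv /= leey andbT integral_ge0// => x _; rewrite lee_fin sqr_ge0.
  - by rewrite in_itv /= leey andbT lee_fin.
by rewrite sqrtrM// EFinM; apply: lee_pmul; rewrite ?Lnorm_ge0//; exact: N2.
Qed.

Lemma line_integrable (g : 'rV[R]_3 -> R) k x : continuous g -> csupp g ->
  (forall t : R, (t *: be k + x) 0 k = t) ->
  (@L1 R).-integrable setT (EFin \o (fun t => g (t *: be k + x))).
Proof.
move=> cg /[dup] /(csupp_bounded cg)[C gC] [M gM] xk.
apply: (@integrable_bounded_supp _ _ _ _ (itvM M) _ C).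
- exact: measurable_itvM.
- exact: itvM_fin.
- by apply: continuous_measurable_fun; exact: continuous_line.
- by move=> t.
- move=> t nt; apply/eqP/negPn/negP => /gM /(_ k); rewrite xk => tM; apply: nt.
  by rewrite /itvM /= in_itv /= -ler_norml.
Qed.

Lemma slice_integrable (g : 'rV[R]_3 -> R) (e : R2 -> R3) i j : continuous g -> csupp g ->
  measurable_fun setT e ->
  (forall q, (pt3 (e q) 0 i = q.1) * (pt3 (e q) 0 j = q.2)) ->
  (@L2 R).-integrable setT (EFin \o (fun q => g (pt3 (e q)))).
Proof.
move=> cg /[dup] /(csupp_bounded cg)[C gC] [M gM] me eq.
apply: (@integrable_bounded_supp _ _ _ _ (itvM M `*` itvM M) _ C).
- by apply: measurableX; exact: measurable_itvM.
- exact: itvMX_fin.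
- exact: (measurableT_comp (measurable_pt3 cg) me).
- by move=> q.
- move=> q nq; apply/eqP/negPn/negP => /gM h; apply: nq.
  have [e1 e2] := eq q.
  by rewrite /itvM /=; have := h i; have := h j; rewrite e1 e2 !in_itv /= -!ler_norml.
Qed.

Lemma integrable_fineK dT (T : measurableType dT) (mu : {measure set T -> \bar R}) (f : T -> R) :
  mu.-integrable setT (EFin \o f) ->
  ((fine (\int[mu]_x (f x)%:E))%:E = \int[mu]_x (f x)%:E)%E.
Proof. by move=> /(integrable_fin_num measurableT) h; rewrite fineK. Qed.

(** * The Loomis-Whitney inequality *)

Section LoomisWhitney.
Variables (g0 g1 g2 phi : 'rV[R]_3 -> R).
Hypotheses (cg0 : continuous g0) (cg1 : continuous g1) (cg2 : continuous g2) (cphi : continuous phi).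
Hypotheses (sg0 : csupp g0) (sg1 : csupp g1) (sg2 : csupp g2).
Hypotheses (pg0 : forall x, 0 <= g0 x) (pg1 : forall x, 0 <= g1 x) (pg2 : forall x, 0 <= g2 x)
  (pphi : forall x, 0 <= phi x).

Let A (q : R2) := (\int[@L1 R]_x (g0 (pt3 (x, q.1, q.2)))%:E)%E.
Let B (q : R2) := (\int[@L1 R]_y (g1 (pt3 (q.1, y, q.2)))%:E)%E.
Let C (q : R2) := (\int[@L1 R]_z (g2 (pt3 (q, z)))%:E)%E.
(** Applied with phi = f^6 and g_i = |d_i f^4|: every line integral dominates f^4, and f^12 is the
    product of three copies of it. *)
Hypothesis phi_le : forall x y z : R,
  ((phi (pt3 (x, y, z)) ^+ 2)%:E <= A (y, z) * B (x, z) * C (x, y))%E.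

Let rA q := fine (A q).
Let rB q := fine (B q).
Let rC q := fine (C q).

Let AE q : (rA q)%:E = A q.
Proof.
apply: integrable_fineK; rewrite (_ : _ \o _ = EFin \o (fun x => g0 (x *: be o0 + (q.1 *: be o1 + q.2 *: be o2)))).
  by apply: line_integrable => // t; rewrite !mxE /=; ring.
by apply/funext => x /=; rewrite pt3_x.
Qed.
Let BE q : (rB q)%:E = B q.
Proof.
apply: integrable_fineK; rewrite (_ : _ \o _ = EFin \o (fun y => g1 (y *: be o1 + (q.1 *: be o0 + q.2 *: be o2)))).
  by apply: line_integrable => // t; rewrite !mxE /=; ring.
by apply/funext => x /=; rewrite pt3_y.
Qed.
Let CE q : (rC q)%:E = C q.
Proof.
apply: integrable_fineK; rewrite (_ : _ \o _ = EFin \o (fun z => g2 (z *: be o2 + (q.1 *: be o0 + q.2 *: be o1)))).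
  by apply: line_integrable => // t; rewrite !mxE /=; ring.
by apply/funext => x /=; case: q => a b; rewrite pt3_z.
Qed.

Let A0 q : 0 <= rA q. Proof. by apply/fine_ge0/integral_ge0 => x _; rewrite lee_fin. Qed.
Let B0 q : 0 <= rB q. Proof. by apply/fine_ge0/integral_ge0 => x _; rewrite lee_fin. Qed.
Let C0 q : 0 <= rC q. Proof. by apply/fine_ge0/integral_ge0 => x _; rewrite lee_fin. Qed.

Let meas_fine_tonelli dT (T : measurableType dT) (g : 'rV[R]_3 -> R) (e : T * measurableTypeR R -> R3) :
  continuous g -> (forall x, 0 <= g x) -> measurable_fun setT e ->
  measurable_fun setT (fun p => fine (\int[@L1 R]_t (g (pt3 (e (p, t))))%:E)%E).
Proof.
move=> cg pg me.
apply: (measurableT_comp (fine_measurable measurableT)).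
apply: (@measurable_fun_fubini_tonelli_F _ _ _ _ _ (@L1 R) (fun q => (g (pt3 (e q)))%:E)).
  by apply/measurable_EFinP; exact: (measurableT_comp (measurable_pt3 cg) me).
by move=> q; rewrite lee_fin.
Qed.

Let mA : measurable_fun setT rA.
Proof.
apply: (@meas_fine_tonelli _ _ g0 (fun q : R2 * measurableTypeR R => (q.2, q.1.1, q.1.2))) => //.
have m1 := measurableT_comp (@measurable_fst _ _ (measurableTypeR R) (measurableTypeR R))
  (@measurable_fst _ _ R2 (measurableTypeR R)).
have m2 := measurableT_comp (@measurable_snd _ _ (measurableTypeR R) (measurableTypeR R))
  (@measurable_fst _ _ R2 (measurableTypeR R)).
exact: (measurable_fun_pair (measurable_fun_pair (@measurable_snd _ _ _ _) m1) m2).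
Qed.
Let mB : measurable_fun setT rB.
Proof.
apply: (@meas_fine_tonelli _ _ g1 (fun q : R2 * measurableTypeR R => (q.1.1, q.2, q.1.2))) => //.
have m1 := measurableT_comp (@measurable_fst _ _ (measurableTypeR R) (measurableTypeR R))
  (@measurable_fst _ _ R2 (measurableTypeR R)).
have m2 := measurableT_comp (@measurable_snd _ _ (measurableTypeR R) (measurableTypeR R))
  (@measurable_fst _ _ R2 (measurableTypeR R)).
exact: (measurable_fun_pair (measurable_fun_pair m1 (@measurable_snd _ _ _ _)) m2).
Qed.
Let mC : measurable_fun setT rC.
Proof.
apply: (@meas_fine_tonelli _ _ g2 (fun q : R2 * measurableTypeR R => q)) => //.
Qed.

Let al y := (\int[@L1 R]_z (rA (y, z))%:E)%E.
Let bt x := (\int[@L1 R]_z (rB (x, z))%:E)%E.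
Let ral y := fine (al y).
Let rbt x := fine (bt x).

Let alE y : (ral y)%:E = al y.
Proof.
have me : measurable_fun setT (fun q : R2 => (q.1, y, q.2) : R3).
  apply: measurable_fun_pair; last exact: measurable_snd.
  by apply: measurable_fun_pair; [exact: measurable_fst|exact: measurable_cst].
have i : (@L2 R).-integrable setT (EFin \o (fun q => g0 (pt3 (q.1, y, q.2)))).
  by apply: (@slice_integrable g0 (fun q => (q.1, y, q.2)) o0 o2) => // q; rewrite /pt3 !vec3E.
rewrite /ral fineK// (_ : al y = \int[@L2 R]_q (g0 (pt3 (q.1, y, q.2)))%:E)%E.
  exact: (integrable_fin_num measurableT i).
rewrite L2_fubini_x; last exact: i.
by apply: eq_integral => z _; rewrite AE.
Qed.

Let btE x : (rbt x)%:E = bt x.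
Proof.
have me : measurable_fun setT (fun q : R2 => (x, q.1, q.2) : R3).
  apply: measurable_fun_pair; last exact: measurable_snd.
  by apply: measurable_fun_pair; [exact: measurable_cst|exact: measurable_fst].
have i : (@L2 R).-integrable setT (EFin \o (fun q => g1 (pt3 (x, q.1, q.2)))).
  by apply: (@slice_integrable g1 (fun q => (x, q.1, q.2)) o1 o2) => // q; rewrite /pt3 !vec3E.
rewrite /rbt fineK// (_ : bt x = \int[@L2 R]_q (g1 (pt3 (x, q.1, q.2)))%:E)%E.
  exact: (integrable_fin_num measurableT i).
rewrite L2_fubini_x; last exact: i.
by apply: eq_integral => z _; rewrite BE.
Qed.

Let al0 y : 0 <= ral y. Proof. by apply/fine_ge0/integral_ge0 => x _; rewrite lee_fin. Qed.
Let bt0 x : 0 <= rbt x. Proof. by apply/fine_ge0/integral_ge0 => y _; rewrite lee_fin. Qed.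

Let mal : measurable_fun setT ral.
Proof.
apply: (measurableT_comp (fine_measurable measurableT)).
apply: (@measurable_fun_fubini_tonelli_F _ _ _ _ _ (@L1 R) (fun q => (rA q)%:E)).
  exact/measurable_EFinP.
by move=> q; rewrite lee_fin.
Qed.
Let mbt : measurable_fun setT rbt.
Proof.
apply: (measurableT_comp (fine_measurable measurableT)).
apply: (@measurable_fun_fubini_tonelli_F _ _ _ _ _ (@L1 R) (fun q => (rB q)%:E)).
  exact/measurable_EFinP.
by move=> q; rewrite lee_fin.
Qed.

Let msqrt dT (T : measurableType dT) (h : T -> R) :
  measurable_fun setT h -> measurable_fun setT (fun x => Num.sqrt (h x)).
Proof.
move=> mh; apply: (measurableT_comp _ mh); apply: continuous_measurable_fun.
exact: sqrt_continuous.
Qed.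

Let mslice (h : R2 -> R) x : measurable_fun setT h -> measurable_fun setT (fun z => h (x, z)).
Proof. by move=> mh; apply: (measurableT_comp mh); exact: measurable_pair1. Qed.

(** The factor C(x,y) is constant in z and leaves the integral; Cauchy-Schwarz in z then separates
    A(y,z) from B(x,z). *)
Let inner (p : R2) :
  (\int[@L1 R]_z (phi (pt3 (p, z)))%:E <= (Num.sqrt (rC p) * Num.sqrt (ral p.2 * rbt p.1))%:E)%E.
Proof.
case: p => x y /=.
have mphi : measurable_fun setT (fun z : measurableTypeR R => phi (pt3 (x, y, z))).
  apply: continuous_measurable_fun; under eq_fun do rewrite pt3_z; exact: continuous_line.
have h z : phi (pt3 (x, y, z)) <= Num.sqrt (rC (x, y)) * (Num.sqrt (rA (y, z)) * Num.sqrt (rB (x, z))).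
  have := phi_le x y z; rewrite -AE -BE -CE -!EFinM lee_fin => h.
  rewrite -!sqrtrM ?mulr_ge0// -[leLHS]ger0_norm// -sqrtr_sqr.
  by apply: ler_wsqrtr; rewrite (le_trans h)// mulrC.
apply: (@le_trans _ _ (\int[@L1 R]_z (Num.sqrt (rC (x, y)) * (Num.sqrt (rA (y, z)) * Num.sqrt (rB (x, z))))%:E)%E).
  apply: ge0_le_integral => //.
  - by move=> z _; rewrite lee_fin.
  - exact/measurable_EFinP.
  - apply/measurable_EFinP; apply: measurable_funM; first exact: measurable_cst.
    by apply: measurable_funM; apply: msqrt; exact: mslice.
  - by move=> z _; rewrite lee_fin.
under eq_integral do rewrite EFinM.
have mab : measurable_fun setT
    (fun z : measurableTypeR R => (Num.sqrt (rA (y, z)) * Num.sqrt (rB (x, z)))%:E).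
  by apply/measurable_EFinP; apply: measurable_funM; apply: msqrt; exact: mslice.
have nab (z : measurableTypeR R) : setT z -> (0 <= (Num.sqrt (rA (y, z)) * Num.sqrt (rB (x, z)))%:E)%E.
  by move=> _; rewrite lee_fin mulr_ge0 ?sqrtr_ge0.
rewrite (@ge0_integralZl _ _ _ (@L1 R) setT measurableT _ mab _ nab); last by rewrite lee_fin sqrtr_ge0.
rewrite EFinM lee_wpmul2l// ?lee_fin ?sqrtr_ge0//.
apply: cauchy_schwarz_le => //.
- by apply: msqrt; exact: mslice.
- by apply: msqrt; exact: mslice.
- by under eq_integral do rewrite sqr_sqrtr//; rewrite alE.
- by under eq_integral do rewrite sqr_sqrtr//; rewrite btE.
Qed.

Let cast_ge0 (g : 'rV[R]_3 -> R) : (forall x, 0 <= g x) ->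
  forall q : R3, (0 <= (g (pt3 q))%:E)%E.
Proof. by move=> pg q; rewrite lee_fin. Qed.

Let mE (g : 'rV[R]_3 -> R) : continuous g -> measurable_fun setT (fun q : R3 => (g (pt3 q))%:E).
Proof. by move=> cg; apply/measurable_EFinP; exact: measurable_pt3. Qed.

Let mEz (g : 'rV[R]_3 -> R) (z : R) : continuous g ->
  measurable_fun setT (fun p : R2 => (g (pt3 (p, z)))%:E).
Proof.
move=> cg; apply/measurable_EFinP.
exact: (measurableT_comp (measurable_pt3 cg) (@measurable_pair2 _ _ _ _ z)).
Qed.

Let intA : (\int[@leb3 R]_q (g0 (pt3 q))%:E = \int[@L1 R]_y (ral y)%:E)%E.
Proof.
rewrite leb3_tonelli_xy; [|exact: mE|exact: cast_ge0].
transitivity (\int[@L1 R]_z \int[@L1 R]_y (rA (y, z))%:E)%E.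
  apply: eq_integral => z _.
  rewrite (L2_tonelli_x (mEz z cg0)); last by move=> q; rewrite lee_fin.
  by apply: eq_integral => y _; rewrite AE.
have mA' : measurable_fun setT (fun q => (rA q)%:E) by exact/measurable_EFinP.
have nA' q : (0 <= (rA q)%:E)%E by rewrite lee_fin.
apply: etrans (esym (@fubini_tonelli _ _ _ _ _ (@L1 R) (@L1 R) _ mA' nA')) _.
by apply: eq_integral => y _; rewrite alE.
Qed.

Let intB : (\int[@leb3 R]_q (g1 (pt3 q))%:E = \int[@L1 R]_y (rbt y)%:E)%E.
Proof.
rewrite leb3_tonelli_xy; [|exact: mE|exact: cast_ge0].
transitivity (\int[@L1 R]_z \int[@L1 R]_y (rB (y, z))%:E)%E.
  apply: eq_integral => z _.
  rewrite (L2_tonelli_y (mEz z cg1)); last by move=> q; rewrite lee_fin.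
  by apply: eq_integral => y _; rewrite BE.
have mB' : measurable_fun setT (fun q => (rB q)%:E) by exact/measurable_EFinP.
have nB' q : (0 <= (rB q)%:E)%E by rewrite lee_fin.
apply: etrans (esym (@fubini_tonelli _ _ _ _ _ (@L1 R) (@L1 R) _ mB' nB')) _.
by apply: eq_integral => y _; rewrite btE.
Qed.

(** A second Cauchy-Schwarz, now in (x,y), separates C from the product of [ral y] and [rbt x],
    whose factors depend on different variables, so that its integral is a product. *)
Lemma loomis_whitney (G0 G1 G2 : R) :
  (\int[@leb3 R]_q (g0 (pt3 q))%:E = G0%:E)%E ->
  (\int[@leb3 R]_q (g1 (pt3 q))%:E = G1%:E)%E ->
  (\int[@leb3 R]_q (g2 (pt3 q))%:E = G2%:E)%E ->
  (\int[@leb3 R]_q (phi (pt3 q))%:E <= (Num.sqrt (G2 * (G1 * G0)))%:E)%E.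
Proof.
move=> e0 e1 e2.
have pos (g : 'rV[R]_3 -> R) (G : R) : (forall x, 0 <= g x) ->
    (\int[@leb3 R]_q (g (pt3 q))%:E = G%:E)%E -> 0 <= G.
  by move=> g_ge0 e; rewrite -lee_fin -e integral_ge0// => x _; rewrite lee_fin.
have mab : measurable_fun setT (fun p : R2 => ral p.2 * rbt p.1).
  apply: measurable_funM.
    exact: (measurableT_comp mal (@measurable_snd _ _ _ _)).
  exact: (measurableT_comp mbt (@measurable_fst _ _ _ _)).
rewrite leb3_tonelli_z; [|exact: mE|exact: cast_ge0].
apply: (@le_trans _ _ (\int[@L2 R]_p (Num.sqrt (rC p) * Num.sqrt (ral p.2 * rbt p.1))%:E)%E).
  apply: ge0_le_integral => //.
  - by move=> p _; apply: integral_ge0 => z _; rewrite lee_fin.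
  - apply: (@measurable_fun_fubini_tonelli_F _ _ _ _ _ (@L1 R) (fun q => (phi (pt3 q))%:E)).
      exact: mE.
    exact: cast_ge0.
  - by apply/measurable_EFinP; apply: measurable_funM; apply: msqrt.
apply: cauchy_schwarz_le.
- exact: msqrt.
- exact: msqrt.
- by move=> p; exact: sqrtr_ge0.
- by move=> p; exact: sqrtr_ge0.
- exact: pos e2.
- by apply: mulr_ge0; [exact: pos e1|exact: pos e0].
- under eq_integral do rewrite sqr_sqrtr// CE.
  by rewrite -e2 leb3_tonelli_z; [|exact: mE|exact: cast_ge0].
- under eq_integral do rewrite sqr_sqrtr ?mulr_ge0//.
  rewrite L2_tonelli_y; [|exact/measurable_EFinP|by move=> q; rewrite lee_fin mulr_ge0].
  have -> : (\int[L1]_x \int[L1]_y (ral (x, y).2 * rbt (x, y).1)%:E =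
      \int[L1]_x ((rbt x)%:E * G0%:E))%E.
    apply: eq_integral => x _; rewrite -e0 intA.
    have mral : measurable_fun setT (EFin \o ral) by apply/measurable_EFinP; exact: mal.
    have nral (y : measurableTypeR R) : setT y -> (0 <= (EFin \o ral) y)%E.
      by move=> _; rewrite lee_fin.
    have := @ge0_integralZl _ _ _ (@L1 R) setT measurableT _ mral (rbt x)%:E nral.
    rewrite lee_fin => /(_ (bt0 x)) <-.
    by apply: eq_integral => y _; rewrite /= -EFinM mulrC.
  have mrbt : measurable_fun setT (EFin \o rbt) by exact/measurable_EFinP.
  have nrbt (y : measurableTypeR R) : setT y -> (0 <= (EFin \o rbt) y)%E.
    by move=> _; rewrite lee_fin.
  have := @ge0_integralZl _ _ _ (@L1 R) setT measurableT _ mrbt G0%:E nrbt.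
  rewrite lee_fin => /(_ (pos _ _ pg0 e0)).
  rewrite /= -intB e1 -EFinM mulrC => <-.
  by under eq_integral do rewrite muleC.
Qed.

End LoomisWhitney.
End SobolevExistence.

(** * Real-valued integrals over R^3 *)

Section RealIntegral.
Context {R : realType}.
Local Notation R3 := (measurableTypeR R * measurableTypeR R * measurableTypeR R)%type.
Implicit Types f g : 'rV[R]_3 -> R.

Definition meas3 f : Prop := measurable_fun setT (fun q : R3 => f (pt3 q)).
(** [fine] sends an infinite integral to 0; this is why additivity and monotonicity below carry
    [integrable3] premises. *)
Definition I3 f : R := fine (\int[@leb3 R]_q (f (pt3 q))%:E)%E.

Lemma continuous_meas3 f : continuous f -> meas3 f.
Proof. exact: measurable_pt3. Qed.

Lemma integrable3_meas f : integrable3 f -> meas3 f.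
Proof. by move=> /integrableP[/measurable_EFinP]. Qed.

Lemma I3E f : integrable3 f -> ((I3 f)%:E = \int[@leb3 R]_q (f (pt3 q))%:E)%E.
Proof. exact: integrable_fineK. Qed.

Lemma integrable3D f g : integrable3 f -> integrable3 g -> integrable3 (f + g).
Proof.
move=> i j; have h := integrableD measurableT i j.
rewrite /integrable3 (_ : EFin \o _ = (EFin \o (f \o @pt3 R)) \+ (EFin \o (g \o @pt3 R))) //.
Qed.

Lemma integrable3Z c f : integrable3 f -> integrable3 (fun x => c * f x).
Proof.
move=> i; exact: (integrableZl measurableT c i).
Qed.

Lemma I3D f g : integrable3 f -> integrable3 g -> I3 (f + g) = I3 f + I3 g.
Proof. by move=> i j; exact: (RintegralD measurableT i j). Qed.

Lemma I3Z c f : integrable3 f -> I3 (fun x => c * f x) = c * I3 f.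
Proof. by move=> i; exact: (RintegralZl c measurableT i). Qed.

Lemma I3_le f g : integrable3 f -> integrable3 g -> (forall x, f x <= g x) -> I3 f <= I3 g.
Proof. by move=> i j fg; apply: (le_Rintegral measurableT i j) => q _; exact: fg. Qed.

Lemma I3_ge0 f : (forall x, 0 <= f x) -> 0 <= I3 f.
Proof. by move=> f0; apply/fine_ge0/integral_ge0 => q _; rewrite lee_fin. Qed.

Lemma I3_d i (f : sfun R) : csupp f -> I3 (d i f) = 0.
Proof. by move=> cf; rewrite /I3 integral_d. Qed.

Lemma integrable3_le f g : meas3 f -> integrable3 g -> (forall x, `|f x| <= g x) -> integrable3 f.
Proof.
move=> mf ig fg; apply: (le_integrable measurableT _ _ ig) => [|q _].
  by apply/measurable_EFinP.
by rewrite lee_fin (le_trans (fg _))// ler_norm.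
Qed.

Lemma integrable3_fin f : meas3 f -> (forall x, 0 <= f x) ->
  (\int[@leb3 R]_q (f (pt3 q))%:E < +oo)%E -> integrable3 f.
Proof.
move=> mf f0 fin; apply/integrableP; split; first exact/measurable_EFinP.
rewrite [X in (X < _)%E](_ : _ = \int[@leb3 R]_q (f (pt3 q))%:E)%E //.
by apply: eq_integral => q _ /=; rewrite ger0_norm.
Qed.

Lemma I3_dct (F : nat -> 'rV[R]_3 -> R) g : (forall n, meas3 (F n)) -> integrable3 g ->
  (forall n x, `|F n x| <= g x) -> (forall x, F n x @[n --> \oo] --> (0 : R)) ->
  I3 (F n) @[n --> \oo] --> (0 : R).
Proof.
move=> mF ig Fg F0.
have mF' n : measurable_fun setT (fun q : R3 => (F n (pt3 q))%:E).
  by apply/measurable_EFinP; exact: mF.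
have cF (q : R3) : setT q -> (F n (pt3 q))%:E @[n --> \oo] --> (cst 0%E : R3 -> \bar R) q.
  by move=> _; apply: cvg_EFin; [exact: nearW|exact: F0].
have gF n (q : R3) : setT q -> (`|(F n (pt3 q))%:E| <= (g (pt3 q))%:E)%E.
  by move=> _; rewrite lee_fin.
have gfin (q : R3) : setT q -> (g (pt3 q))%:E \is a fin_num by [].
have := @dominated_cvg _ _ _ (@leb3 R) setT measurableT _ _ _ mF' cF gfin ig gF.
rewrite integral0 => h.
by apply: (@fine_cvg _ _ _ _ (fun n => \int[@leb3 R]_q (F n (pt3 q))%:E)%E 0); exact: h.
Qed.

(** If f x > 0 then f >= f x / 2 on a cube of half-side s around x, and its volume (2 s)^3 is
    positive. The premise is an inequality because it will come from passing to the limit in an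
    upper bound. *)
Lemma I3_eq0 f : continuous f -> integrable3 f -> (forall x, 0 <= f x) -> I3 f <= 0 ->
  forall x, f x = 0.
Proof.
move=> cf i f0 If x; apply/eqP/negPn/negP => fx.
have fxp : 0 < f x by rewrite lt_neqAle eq_sym fx f0.
have := cf x; move/cvgrPdist_lt => /(_ (f x / 2)).
rewrite divr_gt0// => /(_ isT) /nbhs_normP [r /= r0 rf].
pose s := r / 2; have s0 : 0 < s by rewrite divr_gt0.
pose J k : set (measurableTypeR R) := `[x 0 k - s, x 0 k + s]%classic.
have mJ k : measurable (J k) by exact: measurable_itv.
have lJ k : (@L1 R (J k) = (s *+ 2)%:E)%E.
  rewrite -[LHS]/(lebesgue_measure `[x 0 k - s, x 0 k + s]%classic).
  rewrite lebesgue_measure_itv /= lte_fin ltrD2l gtrN// -EFinB; congr (_%:E); ring.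
pose Q := J o0 `*` J o1 `*` J o2.
have mQ : measurable Q by apply: measurableX => //; exact: measurableX.
have vQ : (@leb3 R Q = ((s *+ 2) * (s *+ 2) * (s *+ 2))%:E)%E.
  have E := @product_measure1E _ _ _ _ _ (@L2 R) (@L1 R) _ _ (measurableX (mJ o0) (mJ o1)) (mJ o2).
  have E' := @product_measure1E _ _ _ _ _ (@L1 R) (@L1 R) _ _ (mJ o0) (mJ o1).
  apply: etrans E _; transitivity (@L1 R (J o0) * @L1 R (J o1) * @L1 R (J o2))%E.
    by congr (_ * _)%E; exact: E'.
  by rewrite !lJ -!EFinM.
have fQ q : Q q -> f x / 2 <= f (pt3 q).
  move=> [[]]; rewrite /J /= !in_itv /= => h0 h1 h2.
  have : `|f x - f (pt3 q)| < f x / 2.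
    apply: rf => /=; rewrite [ltLHS]/Num.Def.normr /= mx_normrE.
    apply: (@le_lt_trans _ _ s); last by rewrite /s ltr_pdivrMr// ltr_pMr// ltr1n.
    apply: bigmax_le; first exact: ltW.
    move=> -[a b] _ /=; rewrite (ord1 a) !mxE ler_norml.
    move: b; apply: ord3P; rewrite /= -?lerBlDr; lra.
  rewrite ltr_norml; lra.
suff : 0 < I3 f by rewrite ltNge If.
rewrite -lte_fin I3E//; apply: (@lt_le_trans _ _ (\int[@leb3 R]_(q in Q) (f x / 2)%:E)%E).
  rewrite integral_cst// [X in (_ * X)%E]vQ -EFinM lte_fin.
  by rewrite !mulr_gt0// mulr2n addr_gt0.
apply: (@le_trans _ _ (\int[@leb3 R]_(q in Q) (f (pt3 q))%:E)%E).
  apply: ge0_le_integral => //.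
  - by move=> q _; rewrite lee_fin divr_ge0// ltW.
  - by apply/measurable_EFinP; apply: measurable_funS (integrable3_meas i).
apply: ge0_subset_integral => //.
- by apply/measurable_EFinP; exact: integrable3_meas.
- by move=> q _; rewrite lee_fin.
Qed.

End RealIntegral.

(** * The Sobolev inequality and its constant *)

Section SobolevInequality.
Context {R : realType}.
Local Notation R3 := (measurableTypeR R * measurableTypeR R * measurableTypeR R)%type.
Implicit Types f g : sfun R.

(** Integrate [dg] from a point [a] to the left of both the support and [t0]. *)
Lemma norm_le_integral_derive1 (g dg : R -> R) (M t0 : R) :
  (forall t, is_derive t (1 : R) g (dg t)) -> continuous dg ->
  (forall t, M < `|t| -> g t = 0) ->
  ((`|g t0|)%:E <= \int[@L1 R]_t (`|dg t|)%:E)%E.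
Proof.
move=> Dg cdg gM.
have cg : continuous g by exact: continuous_derive1 Dg.
pose a : R := - (`|M| + 1 + `|t0|).
have at0 : a < t0.
  have := ler_norm (- t0); have := normr_ge0 M; rewrite normrN /a; lra.
have ga : g a = 0.
  apply: gM; rewrite /a normrN ger0_norm; last by rewrite !addr_ge0.
  have := ler_norm M; have := normr_ge0 t0; lra.
have cabs : continuous (fun t => `|dg t|).
  by move=> t; apply: (continuous_comp (cdg t)); exact: norm_continuous.
have mabs : measurable_fun setT (fun t : measurableTypeR R => (`|dg t|)%:E).
  by apply/measurable_EFinP; exact: continuous_measurable_fun.
have E : (\int[@L1 R]_(t in `[a, t0]) (dg t)%:E = (g t0)%:E - (g a)%:E)%E.
  apply: continuous_FTC2 => //.
  - exact: continuous_subspaceT.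
  - split.
    + by move=> t _; case: (Dg t).
    + by apply: cvg_at_right_filter; exact: cg.
    + by apply: cvg_at_left_filter; exact: cg.
  - by move=> t _; rewrite derive1E; case: (Dg t).
rewrite (_ : (`|g t0|)%:E = `|\int[@L1 R]_(t in `[a, t0]) (dg t)%:E|%E); last first.
  by rewrite E ga sube0.
apply: (le_trans (le_abse_integral _ _ _)) => //.
  apply/measurable_EFinP; apply: measurable_funTS.
  exact: continuous_measurable_fun.
exact: ge0_subset_integral.
Qed.

Definition gradsq f : sfun R := d o0 f ^+ 2 + d o1 f ^+ 2 + d o2 f ^+ 2.

Lemma gradsqE f x : gradsq f x = d o0 f x ^+ 2 + d o1 f x ^+ 2 + d o2 f x ^+ 2.
Proof. by rewrite /gradsq !sfD !sfX. Qed.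

Lemma gradsq_ge0 f x : 0 <= gradsq f x.
Proof. by rewrite gradsqE !addr_ge0 ?sqr_ge0. Qed.

Lemma csuppM f g : csupp f -> csupp (f * g : sfun R).
Proof.
move=> [M fM]; exists M => x; rewrite sfM => h; apply: fM.
by apply: contraNneq h => ->; rewrite mul0r.
Qed.

Lemma csuppMr f g : csupp f -> csupp (g * f : sfun R).
Proof. by rewrite mulrC; exact: csuppM. Qed.

Lemma csuppD f g : csupp f -> csupp g -> csupp (f + g : sfun R).
Proof.
move=> [M fM] [N gN]; exists (Num.max M N) => x; rewrite sfD => h i.
have [fx0|fx0] := eqVneq (f x) 0.
  have [gx0|gx0] := eqVneq (g x) 0; first by rewrite fx0 gx0 addr0 eqxx in h.
  by rewrite le_max gN ?orbT.
by rewrite le_max fM.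
Qed.

Lemma csuppX f n : csupp f -> csupp (f ^+ n.+1 : sfun R).
Proof. by rewrite exprS; exact: csuppM. Qed.

Lemma csupp_gradsq f : csupp f -> csupp (gradsq f).
Proof.
by move=> cf; apply: csuppD; [apply: csuppD|]; apply: csuppX; exact: csupp_d.
Qed.

Lemma csupp_sfun_integrable f : csupp f -> integrable3 f.
Proof. by apply: csupp_integrable; exact: sfun_continuous. Qed.

Lemma sq_le_sum (a b c : R) : [/\ a ^+ 2 <= a ^+ 2 + b ^+ 2 + c ^+ 2,
  b ^+ 2 <= a ^+ 2 + b ^+ 2 + c ^+ 2 & c ^+ 2 <= a ^+ 2 + b ^+ 2 + c ^+ 2].
Proof. by have := sqr_ge0 a; have := sqr_ge0 b; have := sqr_ge0 c; split; lra. Qed.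

(** I^2 <= (4 S)^3 with S^2 = I D, so I^4 <= 64^2 (I D)^3 = 8^4 I^3 D^3, and I^3 cancels unless I =
    0. *)
Lemma sobolev_arith (I D G0 G1 G2 : R) : I <= Num.sqrt (G2 * (G1 * G0)) ->
  0 <= I -> 0 <= D -> 0 <= G0 -> 0 <= G1 -> 0 <= G2 ->
  G0 <= 4 * Num.sqrt (I * D) -> G1 <= 4 * Num.sqrt (I * D) -> G2 <= 4 * Num.sqrt (I * D) ->
  I <= 8 ^+ 4 * D ^+ 3.
Proof.
move=> IG I0 D0 G0_0 G1_0 G2_0; set S := Num.sqrt (I * D) => b0 b1 b2.
have S0 : 0 <= S by rewrite sqrtr_ge0.
have S2 : S ^+ 2 = I * D by rewrite sqr_sqrtr// mulr_ge0.
have I2 : I ^+ 2 <= 64 * S ^+ 3.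
  have : I ^+ 2 <= G2 * (G1 * G0).
    rewrite -[leRHS]sqr_sqrtr ?mulr_ge0//.
    by apply: lerXn2r => //; rewrite nnegrE ?sqrtr_ge0.
  move=> /le_trans; apply.
  rewrite (_ : 64 * S ^+ 3 = (4 * S) * ((4 * S) * (4 * S))); last by ring.
  by apply: ler_pM; rewrite ?mulr_ge0//; apply: ler_pM.
have I4 : I ^+ 4 <= 8 ^+ 4 * (I * D) ^+ 3.
  rewrite -S2 (_ : 8 ^+ 4 * (S ^+ 2) ^+ 3 = (64 * S ^+ 3) ^+ 2); last by ring.
  rewrite (_ : I ^+ 4 = (I ^+ 2) ^+ 2); last by ring.
  by apply: lerXn2r => //; rewrite nnegrE ?mulr_ge0 ?exprn_ge0.
have [->|In0] := eqVneq I 0; first by rewrite mulr_ge0 ?exprn_ge0.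
have Ip : 0 < I by rewrite lt_neqAle eq_sym In0.
rewrite -(ler_pM2l (exprn_gt0 3 Ip)) -exprSr (le_trans I4)// exprMn.
by rewrite mulrCA.
Qed.

(** Gagliardo's argument for f^4. The fourth power is the one that closes: |d_i f^4| = 4 |f|^3 |d_i
    f|, and Cauchy-Schwarz bounds its integral by 4 sqrt(I D), with the same I on both sides. *)
Lemma sobolev_gagliardo_nirenberg f : csupp f ->
  I3 (f ^+ 6 : sfun R) <= 8 ^+ 4 * I3 (gradsq f) ^+ 3.
Proof.
move=> cf.
pose g i : 'rV[R]_3 -> R := fun x => `|d i (f ^+ 4) x|.
have cg i : continuous (g i).
  have c : continuous (d i (f ^+ 4)) by exact: sfun_continuous.
  move=> x; have h := continuous_comp (c x) (@norm_continuous _ R (d i (f ^+ 4) x)).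
  exact: h.
have sg i : csupp (g i).
  have [M fM] := csupp_d i (csuppX 3 cf).
  by exists M => x; rewrite /g normr_eq0; exact: fM.
have pg i x : 0 <= g i x by rewrite /g.
have ig i : integrable3 (g i) by exact: csupp_integrable.
have line k (x : 'rV[R]_3) t : (forall t : R, (t *: be k + x) 0 k = t) ->
    ((f (t *: be k + x) ^+ 4)%:E <= \int[@L1 R]_t (g k (t *: be k + x))%:E)%E.
  move=> xk; have [M fM] := cf.
  have := @norm_le_integral_derive1 (fun t => (f ^+ 4 : sfun R) (t *: be k + x)) _ M t
    (fun t => sf_line (f ^+ 4) k x t).
  rewrite sfX ger0_norm; last by rewrite exprn_even_ge0.
  apply.
    exact: continuous_line (sfun_continuous (f := d k (f ^+ 4))).
  move=> s Ms; rewrite sfX; have [->//|/fM /(_ k)] := eqVneq (f (s *: be k + x)) 0; first by rewrite expr0n.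
  by rewrite xk leNgt Ms.
pose I := I3 (f ^+ 6 : sfun R); pose D := I3 (gradsq f).
have I0 : 0 <= I by apply: I3_ge0 => x; rewrite sfX exprn_even_ge0.
have D0 : 0 <= D by apply: I3_ge0 => x; exact: gradsq_ge0.
have i6 : integrable3 (f ^+ 6 : sfun R) by apply: csupp_sfun_integrable; exact: csuppX.
have LW := @loomis_whitney R (g o0) (g o1) (g o2) (f ^+ 6 : sfun R)
  (cg o0) (cg o1) (cg o2) (sfun_continuous (f := f ^+ 6)) (sg o0) (sg o1) (sg o2)
  (pg o0) (pg o1) (pg o2).
have {LW} : I <= Num.sqrt (I3 (g o2) * (I3 (g o1) * I3 (g o0))).
  rewrite -lee_fin I3E//; apply: LW; rewrite ?I3E//.
  - by move=> x; rewrite sfX exprn_even_ge0.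
  - move=> x y z.
    have f4 : 0 <= f (pt3 (x, y, z)) ^+ 4 by rewrite exprn_even_ge0.
    have -> : ((f ^+ 6 : sfun R) (pt3 (x, y, z)) ^+ 2)%:E =
        ((f (pt3 (x, y, z)) ^+ 4)%:E * (f (pt3 (x, y, z)) ^+ 4)%:E * (f (pt3 (x, y, z)) ^+ 4)%:E)%E.
      by rewrite sfX -!EFinM -!exprM -!exprD.
    apply: lee_pmul; [by rewrite mule_ge0 ?lee_fin|by rewrite lee_fin|apply: lee_pmul; rewrite ?lee_fin//=|].
    + rewrite {1}pt3_x; under eq_integral do rewrite pt3_x.
      by apply: line => t; rewrite !mxE /=; ring.
    + rewrite {1}pt3_y; under eq_integral do rewrite pt3_y.
      by apply: line => t; rewrite !mxE /=; ring.
    + rewrite {1}pt3_z; under eq_integral do rewrite pt3_z.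
      by apply: line => t; rewrite !mxE /=; ring.
have bound i : I3 (g i) <= 4 * Num.sqrt (I * D).
  rewrite -lee_fin I3E// EFinM.
  have e x : g i x = 4 * (`|f x| ^+ 3 * `|d i f x|).
    have e0 : d i (f ^+ 4) x = 4 * (f x ^+ 3 * d i f x).
      rewrite (_ : d i (f ^+ 4) = (f ^+ 3 * d i f) *+ 4); last first.
        by rewrite !exprS expr0 !dM d1; ring.
      by rewrite sfMn sfM sfX mulr_natl.
    by rewrite /g e0 normrM ger0_norm// normrM normrX.
  have mf3 : measurable_fun setT (fun q : R3 => `|f (pt3 q)| ^+ 3).
    apply: measurable_funX; apply: (measurableT_comp (@normr_measurable R setT)).
    exact: measurable_pt3 (sfun_continuous (f := f)).
  have mdf : measurable_fun setT (fun q : R3 => `|d i f (pt3 q)|).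
    apply: (measurableT_comp (@normr_measurable R setT)).
    exact: measurable_pt3 (sfun_continuous (f := d i f)).
  have mm : measurable_fun setT (fun q : R3 => (`|f (pt3 q)| ^+ 3 * `|d i f (pt3 q)|)%:E).
    by apply/measurable_EFinP; exact: measurable_funM.
  have nn (q : R3) : setT q -> (0 <= (`|f (pt3 q)| ^+ 3 * `|d i f (pt3 q)|)%:E)%E.
    by move=> _; rewrite lee_fin mulr_ge0.
  have Z := @ge0_integralZl _ _ _ (@leb3 R) setT measurableT _ mm 4%:E nn.
  rewrite (_ : \int[@leb3 R]_q (g i (pt3 q))%:E = 4%:E * \int[@leb3 R]_q (`|f (pt3 q)| ^+ 3 * `|d i f (pt3 q)|)%:E)%E; last first.
    by rewrite -Z ?lee_fin//; apply: eq_integral => q _; rewrite e EFinM.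
  apply: lee_wpmul2l; first by rewrite lee_fin.
  apply: cauchy_schwarz_le => //.
  - rewrite I3E//; under eq_integral do rewrite -exprM -normrX ger0_norm ?exprn_even_ge0//.
    by under [leRHS]eq_integral do rewrite sfX.
  - rewrite I3E; last exact/csupp_sfun_integrable/csupp_gradsq.
    apply: ge0_le_integral => //.
    + by apply/measurable_EFinP; exact: measurable_funX.
    + by apply/measurable_EFinP; exact: measurable_pt3 (sfun_continuous (f := gradsq f)).
    + move=> q _; rewrite lee_fin real_normK ?num_real// gradsqE.
      have [k0 k1 k2] := sq_le_sum (d o0 f (pt3 q)) (d o1 f (pt3 q)) (d o2 f (pt3 q)).
      exact: (@ord3P (fun j => d j f (pt3 q) ^+ 2 <= _) k0 k1 k2 i).
by move/sobolev_arith; apply => //; apply: I3_ge0.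
Qed.

End SobolevInequality.

(** * The optimal Sobolev constant and the absorption of the inflow *)

Section SobolevConstant.
Context {R : realType}.
Local Notation R3 := (measurableTypeR R * measurableTypeR R * measurableTypeR R)%type.
Implicit Types f g : sfun R.

Lemma csupp_test_function f : csupp f -> test_function f.
Proof.
move=> [M fM]; split; first exact: sfun_smooth.
pose A := [set v : 'rV[R]_3 | forall i, `[- M, M]%classic (v 0 i)].
have cA : compact A by apply: (@rV_compact _ _ (fun=> `[- M, M]%classic)) => i; exact: segment_compact.
have clA : closed A by apply: compact_closed => //; exact: norm_hausdorff.
apply: (subclosed_compact _ cA); first exact: closed_closure.
have sA : [set x | f x != 0] `<=` A.
  by move=> x /= /fM h i; rewrite /= in_itv /= -ler_norml.
by have := closureS sA; rewrite -(proj1 (closure_id A) clA).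
Qed.

Lemma test_function_csupp (h : 'rV[R]_3 -> R) : test_function h ->
  exists2 f : sfun R, (f : _ -> _) = h & csupp f.
Proof.
move=> [sh ch]; exists (mksf sh) => //.
have [M [_ hM]] := compact_bounded ch.
exists (M + 1) => x hx i.
have Mx : `|x| <= M + 1.
  by apply: hM; [rewrite ltrDl|apply: subset_closure].
apply: le_trans Mx; rewrite [leRHS]/Num.Def.normr /= mx_normrE.
exact: (le_bigmax _ (fun ij : 'I_1 * 'I_3 => `|x ij.1 ij.2|) (ord0, i)).
Qed.

Lemma LpNorm_powR (h g : 'rV[R]_3 -> R) (n : nat) : (0 < n)%N -> integrable3 g ->
  (forall x, `|h x| ^+ n = g x) -> LpNorm n%:R h = (I3 g `^ n%:R^-1)%:E.
Proof.
move=> n0 ig hg; rewrite /LpNorm unlock /= -poweR_EFin I3E//; congr (poweR _ _).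
by apply: eq_integral => q _; rewrite powR_mulrn// hg.
Qed.

Lemma LpNorm6E f : csupp f -> LpNorm 6 f = (I3 (f ^+ 6 : sfun R) `^ 6^-1)%:E.
Proof.
move=> cf; apply: (@LpNorm_powR _ _ 6) => //.
  by apply: csupp_sfun_integrable; exact: csuppX.
by move=> x; rewrite sfX -normrX ger0_norm// exprn_even_ge0.
Qed.

Lemma LpNorm2E f : csupp f -> LpNorm 2 (grad_norm f) = (Num.sqrt (I3 (gradsq f)))%:E.
Proof.
move=> cf; rewrite -powR12_sqrt; last by apply: I3_ge0 => x; exact: gradsq_ge0.
apply: (@LpNorm_powR _ _ 2) => //.
  by apply: csupp_sfun_integrable; exact: csupp_gradsq.
move=> x; rewrite real_normK ?num_real// /grad_norm sqr_sqrtr.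
  by rewrite sum3 gradsqE !dE.
by apply: sumr_ge0 => i _; rewrite sqr_ge0.
Qed.

Lemma powR_root n (y : R) : (0 < n)%N -> 0 <= y -> (y ^+ n) `^ n%:R^-1 = y.
Proof.
move=> n0 y0; rewrite -powR_mulrn// -powRrM mulfV ?powRr1// pnatr_eq0 -lt0n //.
Qed.

Lemma sobolev_admissible_le (C : R) f : 0 <= C -> sobolev_admissible C -> csupp f ->
  I3 (f ^+ 6 : sfun R) `^ 6^-1 <= C * Num.sqrt (I3 (gradsq f)).
Proof.
move=> C0 aC cf; have := aC f (csupp_test_function cf).
by rewrite LpNorm6E// LpNorm2E// -EFinM lee_fin.
Qed.

Lemma I6_ge0 f : 0 <= I3 (f ^+ 6 : sfun R).
Proof. by apply: I3_ge0 => x; rewrite sfX exprn_even_ge0. Qed.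

(** 4^6 = 8^4. So the infimum defining [sobolev_const] is taken over a nonempty set. *)
Lemma sobolev_admissible_4 : (@sobolev_admissible R) 4.
Proof.
move=> h /test_function_csupp[f <- cf].
rewrite LpNorm6E// LpNorm2E// -EFinM lee_fin.
rewrite -[leRHS](@powR_root 6)// ?mulr_ge0 ?sqrtr_ge0//.
apply: ge0_ler_powR; rewrite ?nnegrE ?invr_ge0 ?I6_ge0 ?exprn_ge0 ?mulr_ge0 ?sqrtr_ge0//.
apply: (le_trans (sobolev_gagliardo_nirenberg cf)).
have D0 : 0 <= I3 (gradsq f) by apply: I3_ge0 => x; exact: gradsq_ge0.
rewrite exprMn (_ : 6 = 2 * 3)%N// [(Num.sqrt _) ^+ _]exprM sqr_sqrtr//.
rewrite ler_wpM2r ?exprn_ge0//.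
by rewrite -!natrX ler_nat.
Qed.

Definition sqnorm : sfun R := X o0 ^+ 2 + X o1 ^+ 2 + X o2 ^+ 2.
Lemma sqnormE x : sqnorm x = x 0 o0 ^+ 2 + x 0 o1 ^+ 2 + x 0 o2 ^+ 2.
Proof. by rewrite /sqnorm !sfD !sfX !XE. Qed.

Lemma coord_le_sqnorm (x : 'rV[R]_3) i (r : R) : 0 <= r -> sqnorm x <= r ^+ 2 -> `|x 0 i| <= r.
Proof.
move=> r0; rewrite sqnormE => h.
have [k0 k1 k2] := sq_le_sum (x 0 o0) (x 0 o1) (x 0 o2).
rewrite -(@ler_pXn2r _ 2)// ?nnegrE// real_normK ?num_real//.
by move: i; apply: ord3P; apply: le_trans h.
Qed.

(** The usual bump exp(-1 / (1 - |x|^2 / r^2)) of the ball of radius r. *)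
Definition cutoff (r : R) : sfun R := sfbeta 0 (1 - sfc (r ^- 2) * sqnorm).

Lemma cutoffE r x : cutoff r x = beta 0 (1 - r ^- 2 * sqnorm x).
Proof. by rewrite /cutoff sfbetaE sfD sfN sfM sf1 sfcE. Qed.

Lemma cutoff_arg_gt0 (r : R) x : 0 < r -> 0 < 1 - r ^- 2 * sqnorm x -> sqnorm x < r ^+ 2.
Proof. by move=> r0; rewrite subr_gt0 mulrC ltr_pdivrMr ?exprn_gt0// mul1r. Qed.

Lemma csupp_cutoff r : 0 < r -> csupp (cutoff r).
Proof.
move=> r0; exists r => x; rewrite cutoffE => h i.
apply: coord_le_sqnorm; first exact: ltW.
apply/ltW/cutoff_arg_gt0 => //; rewrite ltNge; apply/negP => /beta_npos e.
by rewrite e eqxx in h.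
Qed.

Lemma cutoff_gt0 (r : R) x : 0 < r -> sqnorm x < r ^+ 2 -> 0 < cutoff r x.
Proof.
move=> r0 xr; rewrite cutoffE beta_gt0// subr_gt0 mulrC ltr_pdivrMr ?exprn_gt0//.
by rewrite mul1r.
Qed.

(** One nonzero test function bounds every admissible constant below by the quotient of its norms.
    Its gradient norm is not 0, for otherwise the admissible constant 4 would make its L^6 norm
    0. *)
Lemma sobolev_admissible_lb : exists2 c : R, 0 < c & lbound (@sobolev_admissible R) c.
Proof.
have cf := csupp_cutoff (@ltr01 R); set f := cutoff 1 in cf.
have i6 : integrable3 (f ^+ 6 : sfun R) by apply: csupp_sfun_integrable; exact: csuppX.
have I6 : 0 < I3 (f ^+ 6 : sfun R).
  rewrite ltNge; apply/negP => h.
  have p x : 0 <= (f ^+ 6 : sfun R) x by rewrite sfX exprn_even_ge0.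
  have := I3_eq0 (sfun_continuous (f := f ^+ 6)) i6 p h 0.
  rewrite sfX => /eqP; rewrite expf_eq0 /= gt_eqF//.
  by apply: cutoff_gt0 => //; rewrite sqnormE !mxE !expr0n /= !addr0 expr1n.
pose a := I3 (f ^+ 6 : sfun R) `^ 6^-1.
have a0 : 0 < a by rewrite powR_gt0.
pose D := Num.sqrt (I3 (gradsq f)).
have Dge : 0 <= D by rewrite sqrtr_ge0.
have aCD C : sobolev_admissible C -> a <= C * D.
  move=> /(_ f (csupp_test_function cf)).
  by rewrite LpNorm6E// LpNorm2E// -EFinM lee_fin.
have D0 : 0 < D.
  rewrite lt_neqAle Dge andbT eq_sym; apply/eqP => e.
  by have := aCD 4 sobolev_admissible_4; rewrite e mulr0 leNgt a0.
exists (a / D); first by rewrite divr_gt0.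
by move=> C /aCD; rewrite ler_pdivrMr.
Qed.

Lemma sobolev_const_gt0 : 0 < @sobolev_const R.
Proof.
have [c c0 cl] := sobolev_admissible_lb; apply: (lt_le_trans c0).
by apply: lb_le_inf => //; exists 4; exact: sobolev_admissible_4.
Qed.

(** An admissible constant close to the infimum stands in for the infimum itself; the factor 9/8 is
    the margin available. *)
Lemma sobolev_const_approx : exists2 C : R, 0 < C /\ sobolev_admissible C &
  8 * C ^+ 2 < 9 * sobolev_const R ^+ 2.
Proof.
have S0 := sobolev_const_gt0; set S := sobolev_const R in S0 *.
have hi : has_inf (@sobolev_admissible R).
  split; first by exists 4; exact: sobolev_admissible_4.
  by have [c _ h] := sobolev_admissible_lb; exists c.
(* (21/20)^2 = 1.1025 is below 9/8 = 1.125. *)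
have e0 : 0 < S / 20 by rewrite divr_gt0.
have [C aC CS] := inf_adherent e0 hi.
have [c c0 cl] := sobolev_admissible_lb.
have C0 : 0 < C := lt_le_trans c0 (cl _ aC).
exists C => //; rewrite -/S.
have {}CS : C < S * (21 / 20) by move: CS; rewrite -/(sobolev_const R) -/S; lra.
have : C ^+ 2 < (S * (21 / 20)) ^+ 2 by rewrite ltrXn2r// ?nnegrE ltW.
have : 0 < S ^+ 2 by rewrite exprn_gt0.
rewrite exprMn; lra.
Qed.

(** Hoelder with exponents 3/2 and 3, since the L^3 norm of f^2 is the square of the L^6 norm of
    f. *)
Lemma sobolev_hoelder (F : 'rV[R]_3 -> R) : meas3 F ->
  (LpNorm (3 / 2) F < (8 / (9 * sobolev_const R ^+ 2))%:E)%E ->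
  exists2 th : R, 0 <= th < 1 & forall f, csupp f ->
    integrable3 (fun x => `|F x| * f x ^+ 2) /\
    I3 (fun x => `|F x| * f x ^+ 2) <= th * I3 (gradsq f).
Proof.
move=> mF Flt.
have [C [C0 aC] CS] := sobolev_const_approx.
have S0 := sobolev_const_gt0; set S := sobolev_const R in S0 CS Flt.
have N0 : (0 <= LpNorm (3 / 2) F)%E by exact: Lnorm_ge0.
have [N NE] : exists N, LpNorm (3 / 2) F = N%:E.
  exists (fine (LpNorm (3 / 2) F)); rewrite fineK// ge0_fin_numE//.
  by apply: (lt_trans Flt); rewrite ltry.
move: N0 Flt; rewrite NE lee_fin lte_fin => N0.
rewrite ltr_pdivlMr ?mulr_gt0 ?exprn_gt0// => NS.
(* It is below 1 because 9 N S^2 < 8 and 8 C^2 < 9 S^2. *)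
exists (N * C ^+ 2).
  apply/andP; split; first by apply: mulr_ge0 => //; apply: exprn_ge0; exact: ltW.
  have := ler_wpM2l N0 (ltW CS); lra.
move=> f cf.
have D0 : 0 <= I3 (gradsq f) by apply: I3_ge0 => x; exact: gradsq_ge0.
pose f2 : sfun R := f ^+ 2.
have mf2 : meas3 f2 by apply: continuous_meas3; exact: sfun_continuous.
have h32 : 0 < (3 / 2 : R) by lra.
have h3 : 0 < (3 : R) by lra.
have hpq : (3 / 2)^-1 + 3^-1 = 1 :> R by field.
have := hoelder (@leb3 R) mF mf2 h32 h3 hpq.
rewrite Lnorm1.
have N3 : ('N[@leb3 R]_3%:E[(EFin \o (fun q : R3 => f2 (pt3 q)))] <=
    (C ^+ 2 * I3 (gradsq f))%:E)%E.
  have -> : ('N[@leb3 R]_3%:E[(EFin \o (fun q : R3 => f2 (pt3 q)))] =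
      LpNorm 3 f2)%E by [].
  rewrite (@LpNorm_powR _ (f ^+ 6 : sfun R) 3)//; last 2 first.
  - by apply: csupp_sfun_integrable; exact: csuppX.
  - by move=> x; rewrite /f2 !sfX -normrX -exprM ger0_norm// exprn_even_ge0.
  rewrite lee_fin.
  have h := sobolev_admissible_le (ltW C0) aC cf.
  rewrite (_ : I3 (f ^+ 6 : sfun R) `^ 3^-1 = (I3 (f ^+ 6 : sfun R) `^ 6^-1) ^+ 2); last first.
    rewrite -powR_mulrn ?powR_ge0// -powRrM; congr (_ `^ _); by field.
  rewrite -[I3 (gradsq f)]sqr_sqrtr// -exprMn lerXn2r// ?nnegrE ?powR_ge0//.
  by rewrite mulr_ge0 ?sqrtr_ge0// ltW.
move=> H.
have {}H : (\int[@leb3 R]_q (`|F (pt3 q)| * f (pt3 q) ^+ 2)%:E <= (N * (C ^+ 2 * I3 (gradsq f)))%:E)%E.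
  apply: (@le_trans _ _ (\int[@leb3 R]_q `|((fun q : R3 => F (pt3 q)) \* (fun q : R3 => f2 (pt3 q)))%R q|%:E)%E).
    rewrite le_eqVlt; apply/orP; left; apply/eqP; apply: eq_integral => q _ /=.
    by rewrite normrM /f2 sfX [`|f _ ^+ 2|]ger0_norm// sqr_ge0.
  apply: (le_trans H); rewrite [leRHS]EFinM; apply: lee_pmul; rewrite ?Lnorm_ge0//.
  by rewrite -NE.
have mFf : meas3 (fun x => `|F x| * f x ^+ 2).
  apply: measurable_funM; first exact: (measurableT_comp (@normr_measurable R setT)).
  by apply: measurable_funX; apply: continuous_meas3; exact: sfun_continuous.
have iFf : integrable3 (fun x => `|F x| * f x ^+ 2).
  apply: integrable3_fin => //; first by move=> x; rewrite mulr_ge0 ?sqr_ge0.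
  by apply: (le_lt_trans H); rewrite ltry.
split=> //; rewrite -lee_fin I3E// -mulrA; exact: H.
Qed.

End SobolevConstant.

(** * Identities in differential rings *)

Section DifferentialAlgebra.
Variables (K : comNzRingType) (d0 d1 d2 : K -> K) (X0 X1 : K).
Hypotheses (d0D : forall f g, d0 (f + g) = d0 f + d0 g)
  (d1D : forall f g, d1 (f + g) = d1 f + d1 g)
  (d2D : forall f g, d2 (f + g) = d2 f + d2 g)
  (d0M : forall f g, d0 (f * g) = d0 f * g + f * d0 g)
  (d1M : forall f g, d1 (f * g) = d1 f * g + f * d1 g)
  (d2M : forall f g, d2 (f * g) = d2 f * g + f * d2 g).
Hypotheses (d01 : forall f, d0 (d1 f) = d1 (d0 f)) (d02 : forall f, d0 (d2 f) = d2 (d0 f))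
  (d12 : forall f, d1 (d2 f) = d2 (d1 f)).
Hypotheses (d0X0 : d0 X0 = 1) (d1X0 : d1 X0 = 0) (d2X0 : d2 X0 = 0)
  (d0X1 : d0 X1 = 0) (d1X1 : d1 X1 = 1) (d2X1 : d2 X1 = 0).

Lemma d0_0 : d0 0 = 0. Proof. by apply: (addrI (d0 0)); rewrite -d0D !addr0. Qed.
Lemma d1_0 : d1 0 = 0. Proof. by apply: (addrI (d1 0)); rewrite -d1D !addr0. Qed.
Lemma d2_0 : d2 0 = 0. Proof. by apply: (addrI (d2 0)); rewrite -d2D !addr0. Qed.
Lemma d0N f : d0 (- f) = - d0 f. Proof. by apply: (addIr (d0 f)); rewrite -d0D !addNr d0_0. Qed.
Lemma d1N f : d1 (- f) = - d1 f. Proof. by apply: (addIr (d1 f)); rewrite -d1D !addNr d1_0. Qed.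
Lemma d2N f : d2 (- f) = - d2 f. Proof. by apply: (addIr (d2 f)); rewrite -d2D !addNr d2_0. Qed.

Lemma d0_1 : d0 1 = 0.
Proof. by have /eqP := d0M 1 1; rewrite !mulr1 mul1r -subr_eq0 opprD addrA subrr sub0r oppr_eq0 => /eqP. Qed.
Lemma d1_1 : d1 1 = 0.
Proof. by have /eqP := d1M 1 1; rewrite !mulr1 mul1r -subr_eq0 opprD addrA subrr sub0r oppr_eq0 => /eqP. Qed.
Lemma d2_1 : d2 1 = 0.
Proof. by have /eqP := d2M 1 1; rewrite !mulr1 mul1r -subr_eq0 opprD addrA subrr sub0r oppr_eq0 => /eqP. Qed.

Definition dsimp := (d0D, d1D, d2D, d0M, d1M, d2M, d0N, d1N, d2N, d0_0, d1_0, d2_0, d0_1, d1_1, d2_1,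
  d0X0, d1X0, d2X0, d0X1, d1X1, d2X1).

(** The angular derivative d/dtheta; [eulE] is r d/dr. Both have smooth coefficients on the axis,
    and they stand for the polar derivatives throughout. *)
Definition rotD f := X0 * d1 f - X1 * d0 f.
Definition eulE f := X0 * d0 f + X1 * d1 f.
Definition lap f := d0 (d0 f) + d1 (d1 f) + d2 (d2 f).
Definition r2 := X0 * X0 + X1 * X1.

Lemma rotD_d0 f : rotD (d0 f) = d0 (rotD f) - d1 f.
Proof. rewrite /rotD !dsimp !d01; ring. Qed.
Lemma rotD_d1 f : rotD (d1 f) = d1 (rotD f) + d0 f.
Proof. rewrite /rotD !dsimp !d01; ring. Qed.
Lemma rotD_d2 f : rotD (d2 f) = d2 (rotD f).
Proof. rewrite /rotD !dsimp !d02 !d12; ring. Qed.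
Lemma rotDD f g : rotD (f + g) = rotD f + rotD g.
Proof. rewrite /rotD !dsimp; ring. Qed.
Lemma rotDN f : rotD (- f) = - rotD f.
Proof. rewrite /rotD !dsimp; ring. Qed.
Lemma rotDM f g : rotD (f * g) = rotD f * g + f * rotD g.
Proof. rewrite /rotD !dsimp; ring. Qed.
Lemma rotD_X0 : rotD X0 = - X1. Proof. rewrite /rotD !dsimp; ring. Qed.
Lemma rotD_X1 : rotD X1 = X0. Proof. rewrite /rotD !dsimp; ring. Qed.

Lemma rotD_lap f : rotD (lap f) = lap (rotD f).
Proof.
rewrite /lap !rotDD !(rotD_d0, rotD_d1, rotD_d2) !dsimp d01; ring.
Qed.

Lemma rotD_eulE f : eulE f * eulE f + rotD f * rotD f = r2 * (d0 f * d0 f + d1 f * d1 f).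
Proof. rewrite /eulE /rotD /r2; ring. Qed.

Section Flow.
Variables (U0 U1 U2 P : K).
Hypotheses (rU0 : rotD U0 = - U1) (rU1 : rotD U1 = U0) (rU2 : rotD U2 = 0).

Definition adv f := U0 * d0 f + U1 * d1 f + U2 * d2 f.
(** This is r u_r, smooth across the axis, whereas u_r and u_r / r are only available off the
    axis. *)
Definition radial := X0 * U0 + X1 * U1.

Lemma rotD_adv f : rotD (adv f) = adv (rotD f).
Proof. rewrite /adv !rotDD !rotDM rU0 rU1 rU2 rotD_d0 rotD_d1 rotD_d2; ring. Qed.

Hypotheses (ns0 : adv U0 + d0 P = lap U0) (ns1 : adv U1 + d1 P = lap U1)
  (ns2 : adv U2 + d2 P = lap U2) (divU : d0 U0 + d1 U1 + d2 U2 = 0).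

Lemma lap_N f : lap (- f) = - lap f. Proof. rewrite /lap !dsimp; ring. Qed.
Lemma adv_N f : adv (- f) = - adv f. Proof. rewrite /adv !dsimp; ring. Qed.

(** By the equations the horizontal gradient of P turns with the frame as u does, so its torque
    [rotD P] is rotation invariant. That the torque itself is 0 is not algebraic: it needs the
    periodicity in [rot_rot_eq0]. *)
Lemma rotD_rotD_pressure : rotD (rotD P) = 0.
Proof.
have e0 : d0 P = lap U0 - adv U0 by rewrite -ns0; ring.
have e1 : d1 P = lap U1 - adv U1 by rewrite -ns1; ring.
have a0 : rotD (lap U0 - adv U0) = - (lap U1 - adv U1).
  by rewrite rotDD rotDN rotD_lap rotD_adv rU0 lap_N adv_N; ring.
have a1 : rotD (lap U1 - adv U1) = lap U0 - adv U0.
  by rewrite rotDD rotDN rotD_lap rotD_adv rU1.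
rewrite {2}/rotD e0 e1; move: (lap U0 - adv U0) (lap U1 - adv U1) a0 a1 => A0 A1 a0 a1.
by rewrite rotDD rotDN !rotDM rotD_X0 rotD_X1 a0 a1; ring.
Qed.

(** For smooth functions this is the density of the complement of the axis. *)
Hypothesis cancel_r2 : forall f, r2 * f = 0 -> f = 0.

(** A field w(r,z) e_r has no vertical vorticity. Times r^2, that vorticity is a combination of the
    two symmetry relations [A], [B] and the two horizontal derivatives [C], [G] of the third
    premise. *)
Lemma curl_radial W0 W1 : rotD W0 = - W1 -> rotD W1 = W0 -> X0 * W1 - X1 * W0 = 0 ->
  d0 W1 - d1 W0 = 0.
Proof.
move=> e0 e1 e; apply: cancel_r2.
have e0' : rotD W0 + W1 = 0 by rewrite e0; ring.
have e1' : rotD W1 - W0 = 0 by rewrite e1; ring.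
have f0 : d0 (X0 * W1 - X1 * W0) = 0 by rewrite e d0_0.
have f1 : d1 (X0 * W1 - X1 * W0) = 0 by rewrite e d1_0.
move: e0' e1' f0 f1; rewrite /rotD !dsimp => e0' e1' f0 f1.
pose A := X0 * d1 W0 - X1 * d0 W0 + W1; pose B := X0 * d1 W1 - X1 * d0 W1 - W0.
pose C := 1 * W1 + X0 * d0 W1 + - (0 * W0 + X1 * d0 W0).
pose G := 0 * W1 + X0 * d1 W1 + - (1 * W0 + X1 * d1 W0).
have -> : r2 * (d0 W1 - d1 W0) = X0 * C - X0 * A + X1 * G - X1 * B.
  rewrite /A /B /C /G /r2; ring.
by rewrite /A /B /C /G e0' e1' f0 f1; ring.
Qed.

(* Multiplied by r^2 so as to be an identity between smooth functions, on the axis too. *)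
Lemma swirl_equation V0 V1 : rotD P = 0 ->
  rotD V0 = - V1 -> rotD V1 = V0 -> X0 * V0 + X1 * V1 = 0 ->
  X0 * (U1 - V1) - X1 * (U0 - V0) = 0 ->
  r2 * (V0 * (lap V0 - adv V0) + V1 * (lap V1 - adv V1)) = radial * (V0 * V0 + V1 * V1).
Proof.
move=> rP rV0 rV1 tV tW.
(* [G] is the circulation r u_theta. As V is tangential, r^2 V = G (-y, x). *)
pose G := X0 * V1 - X1 * V0.
have GU : G = X0 * U1 - X1 * U0 by apply/eqP; rewrite -subr_eq0 -[X in _ == X]oppr0 -tW; apply/eqP; rewrite /G; ring.
have h0 : r2 * V0 = - X1 * G.
  by apply: (@etrans _ _ (- X1 * G + X0 * (X0 * V0 + X1 * V1))); [rewrite /G /r2; ring|rewrite tV; ring].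
have h1 : r2 * V1 = X0 * G.
  by apply: (@etrans _ _ (X0 * G + X1 * (X0 * V0 + X1 * V1))); [rewrite /G /r2; ring|rewrite tV; ring].
(* U - V is radial, hence all the vertical vorticity of U comes from V. *)
have cW : d0 (U1 - V1) - d1 (U0 - V0) = 0.
  by apply: curl_radial; rewrite ?rotDD ?rotDN ?rU0 ?rU1 ?rV0 ?rV1//; ring.
(* Torque of the momentum equation: the pressure drops out by [rotD P] = 0, and the commutator of
   the Laplacian with the coordinates leaves twice the vertical vorticity. *)
have sw : lap G - adv G = (d0 U1 - d1 U0) * 2%:R.
  have e0 : d0 P = lap U0 - adv U0 by rewrite -ns0; ring.
  have e1 : d1 P = lap U1 - adv U1 by rewrite -ns1; ring.
  have := rP; rewrite /rotD e0 e1.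
  move=> e; apply: (@etrans _ _ ((X0 * (lap U1 - adv U1) - X1 * (lap U0 - adv U0)) + (d0 U1 - d1 U0) * 2%:R)).
    by rewrite GU /lap /adv !dsimp; ring.
  by rewrite e; ring.
have Y : X0 * (lap V1 - adv V1) - X1 * (lap V0 - adv V0) = U0 * V1 - U1 * V0.
  apply: (@etrans _ _ (lap G - adv G - (d0 V1 - d1 V0) * 2%:R + (U0 * V1 - U1 * V0))).
    by rewrite /G /lap /adv !dsimp; ring.
  rewrite sw; apply: (@etrans _ _ ((d0 (U1 - V1) - d1 (U0 - V0)) * 2%:R + (U0 * V1 - U1 * V0))).
    by rewrite !dsimp; ring.
  by rewrite cW; ring.
have L : r2 * (V0 * (lap V0 - adv V0) + V1 * (lap V1 - adv V1)) = G * (U0 * V1 - U1 * V0).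
  rewrite mulrDr !mulrA h0 h1 -Y; ring.
rewrite L; apply/eqP; rewrite -subr_eq0; apply/eqP/cancel_r2.
apply: (@etrans _ _ (G * (U0 * (r2 * V1) - U1 * (r2 * V0)) - radial * (r2 * V0 * V0 + r2 * V1 * V1))); first ring.
rewrite h0 h1 /radial /G; ring.
Qed.

Definition om0 := d1 U2 - d2 U1.
Definition om1 := d2 U0 - d0 U2.

Hypothesis no_swirl : X0 * U1 - X1 * U0 = 0.

Lemma om2_0 : d0 U1 - d1 U0 = 0. Proof. exact: curl_radial. Qed.

(** The radial vorticity is d_theta u_z / r minus d_z u_theta, and both terms vanish. *)
Lemma om_tangent : X0 * om0 + X1 * om1 = 0.
Proof.
have e : d2 (X0 * U1 - X1 * U0) = 0 by rewrite no_swirl d2_0.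
apply: (@etrans _ _ (rotD U2 - d2 (X0 * U1 - X1 * U0))); last by rewrite e rU2; ring.
rewrite /om0 /om1 /rotD !dsimp; ring.
Qed.

Lemma rotD_om0 : rotD om0 = - om1.
Proof. by rewrite /om0 /om1 rotDD rotDN rotD_d1 rotD_d2 rU1 rU2 d1_0; ring. Qed.
Lemma rotD_om1 : rotD om1 = om0.
Proof. by rewrite /om0 /om1 rotDD rotDN rotD_d0 rotD_d2 rU0 rU2 d0_0 d2N; ring. Qed.

Definition stretch f := om0 * d0 f + om1 * d1 f.

(** Curl of the momentum equation: the pressure disappears by symmetry of mixed derivatives, and the
    remaining terms are multiples of the divergence and of the vertical vorticity [c], both 0. *)
Lemma vorticity0 : lap om0 - adv om0 = - stretch U0.
Proof.
have e1 : d2 (adv U1 + d1 P) = d2 (lap U1) by rewrite ns1.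
have e2 : d1 (adv U2 + d2 P) = d1 (lap U2) by rewrite ns2.
have c : d0 U1 - d1 U0 = 0 by exact: om2_0.
have z : d1 (lap U2) - d1 (adv U2) - d1 (d2 P) = 0 by rewrite -e2 d1D; ring.
have z' : d2 (lap U1) - d2 (adv U1) - d2 (d1 P) = 0 by rewrite -e1 d2D; ring.
apply: (@etrans _ _ ((d1 (lap U2) - d1 (adv U2) - d1 (d2 P)) - (d2 (lap U1) - d2 (adv U1) - d2 (d1 P))
   + om0 * (d0 U0 + d1 U1 + d2 U2) - stretch U0 - d2 U0 * (d0 U1 - d1 U0))).
  by rewrite /stretch /lap /adv /om0 /om1 !dsimp !(d01, d02, d12); ring.
by rewrite z z' divU c; ring.
Qed.

Lemma vorticity1 : lap om1 - adv om1 = - stretch U1.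
Proof.
have e1 : d2 (adv U0 + d0 P) = d2 (lap U0) by rewrite ns0.
have e2 : d0 (adv U2 + d2 P) = d0 (lap U2) by rewrite ns2.
have c : d0 U1 - d1 U0 = 0 by exact: om2_0.
have z : d0 (lap U2) - d0 (adv U2) - d0 (d2 P) = 0 by rewrite -e2 d0D; ring.
have z' : d2 (lap U0) - d2 (adv U0) - d2 (d0 P) = 0 by rewrite -e1 d2D; ring.
apply: (@etrans _ _ ((d2 (lap U0) - d2 (adv U0) - d2 (d0 P)) - (d0 (lap U2) - d0 (adv U2) - d0 (d2 P))
   + om1 * (d0 U0 + d1 U1 + d2 U2) - stretch U1 - d2 U1 * (d0 U1 - d1 U0))).
  by rewrite /stretch /lap /adv /om0 /om1 !dsimp !(d01, d02, d12); ring.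
by rewrite z z' divU c; ring.
Qed.

(** Tangential vorticity turns stretching into an angular derivative: r^2 [stretch f] = G [rotD f].
    Since d_theta U is U turned by a quarter, only u_r / r remains of it. *)
Lemma vorticity_equation :
  r2 * (om0 * (lap om0 - adv om0) + om1 * (lap om1 - adv om1)) =
  - radial * (om0 * om0 + om1 * om1).
Proof.
rewrite vorticity0 vorticity1.
pose G := X0 * om1 - X1 * om0.
have h0 : r2 * om0 = - X1 * G.
  by apply: (@etrans _ _ (- X1 * G + X0 * (X0 * om0 + X1 * om1))); [rewrite /G /r2; ring|rewrite om_tangent; ring].
have h1 : r2 * om1 = X0 * G.
  by apply: (@etrans _ _ (X0 * G + X1 * (X0 * om0 + X1 * om1))); [rewrite /G /r2; ring|rewrite om_tangent; ring].
have st f : r2 * stretch f = G * rotD f.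
  by rewrite /stretch mulrDr !mulrA h0 h1 /rotD; ring.
apply/eqP; rewrite -subr_eq0; apply/eqP/cancel_r2.
apply: (@etrans _ _ (- (r2 * om0 * (r2 * stretch U0) + r2 * om1 * (r2 * stretch U1)) +
  radial * (r2 * om0 * om0 + r2 * om1 * om1))); first ring.
rewrite !st h0 h1 rU0 rU1 /radial /G; ring.
Qed.

(** lap = grad div - curl curl, written out. *)
Lemma harmonic_of_curl_free : om0 = 0 -> om1 = 0 -> [/\ lap U0 = 0, lap U1 = 0 & lap U2 = 0].
Proof.
move=> e0 e1; have e2 := om2_0.
have dd f (df : K -> K) : df 0 = 0 -> f = 0 -> df f = 0 by move=> h ->.
have v0 := dd _ d0 d0_0 divU; have v1 := dd _ d1 d1_0 divU; have v2 := dd _ d2 d2_0 divU.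
have a1 := dd _ d1 d1_0 e0; have a2 := dd _ d2 d2_0 e0.
have b0 := dd _ d0 d0_0 e1; have b2 := dd _ d2 d2_0 e1.
have c0 := dd _ d0 d0_0 e2; have c1 := dd _ d1 d1_0 e2.
move: v0 v1 v2 a1 a2 b0 b2 c0 c1; rewrite /om0 /om1 !dsimp => v0 v1 v2 a1 a2 b0 b2 c0 c1.
split.
- apply: (@etrans _ _ ((d0 (d0 U0) + d0 (d1 U1) + d0 (d2 U2)) - (d1 (d0 U1) - d1 (d1 U0)) + (d2 (d2 U0) - d2 (d0 U2)))).
    by rewrite /lap !(d01, d02, d12); ring.
  by rewrite v0 c1 b2; ring.
- apply: (@etrans _ _ ((d1 (d0 U0) + d1 (d1 U1) + d1 (d2 U2)) + (d0 (d0 U1) - d0 (d1 U0)) - (d2 (d1 U2) - d2 (d2 U1)))).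
    by rewrite /lap !(d01, d02, d12); ring.
  by rewrite v1 c0 a2; ring.
- apply: (@etrans _ _ ((d2 (d0 U0) + d2 (d1 U1) + d2 (d2 U2)) + (d1 (d1 U2) - d1 (d2 U1)) - (d0 (d2 U0) - d0 (d0 U2)))).
    by rewrite /lap !(d01, d02, d12); ring.
  by rewrite v2 a1 b0; ring.
Qed.

End Flow.

Section SquaredLength.
Variables a b : K.
Hypotheses (ra : rotD a = - b) (rb : rotD b = a).

Definition sq := a * a + b * b.
Definition hgrad := d0 a * d0 a + d1 a * d1 a + (d0 b * d0 b + d1 b * d1 b).
Definition vgrad := d2 a * d2 a + d2 b * d2 b.

Lemma lap_sq : lap sq = (a * lap a + b * lap b + hgrad + vgrad) *+ 2.
Proof. rewrite /sq /lap /hgrad /vgrad !dsimp; ring. Qed.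

Lemma eulE_sq : eulE sq = (a * eulE a + b * eulE b) *+ 2.
Proof. rewrite /sq /eulE !dsimp; ring. Qed.

(** The last term is the squared angular derivative of a vector that turns with the frame. Divided
    by r^2 it is the Hardy term that both the swirl and the vorticity estimate rest on. *)
Lemma hgrad_polar : r2 * hgrad = eulE a * eulE a + eulE b * eulE b + sq.
Proof.
rewrite /hgrad mulrDr -!rotD_eulE ra rb /sq; ring.
Qed.

End SquaredLength.

Section Orthogonality.
Hypothesis cancel_r2 : forall f, r2 * f = 0 -> f = 0.
Variables V0 V1 W0 W1 : K.
Hypotheses (rV0 : rotD V0 = - V1) (rV1 : rotD V1 = V0) (rW0 : rotD W0 = - W1)
  (rW1 : rotD W1 = W0) (tV : X0 * V0 + X1 * V1 = 0) (tW : X0 * W1 - X1 * W0 = 0).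

Let lagrange a0 a1 b0 b1 : X0 * a0 + X1 * a1 = 0 -> X0 * b1 - X1 * b0 = 0 -> a0 * b0 + a1 * b1 = 0.
Proof.
move=> ha hb; apply: cancel_r2.
apply: (@etrans _ _ ((X0 * a0 + X1 * a1) * (X0 * b0 + X1 * b1) +
  (X0 * a1 - X1 * a0) * (X0 * b1 - X1 * b0))); first by rewrite /r2; ring.
by rewrite ha hb; ring.
Qed.

(** d_z and r d_r keep V tangential and W radial, and d_theta turns both by a quarter, so the
    derivatives are orthogonal in each polar direction (for r d_r and d_z by [lagrange]). *)
Lemma grad_orthogonal :
  (d0 V0 * d0 W0 + d1 V0 * d1 W0 + d2 V0 * d2 W0) + (d0 V1 * d0 W1 + d1 V1 * d1 W1 + d2 V1 * d2 W1) = 0.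
Proof.
have dd f (df : K -> K) : df 0 = 0 -> f = 0 -> df f = 0 by move=> h ->.
have a0 := dd _ d0 d0_0 tV; have a1 := dd _ d1 d1_0 tV; have a2 := dd _ d2 d2_0 tV.
have b0 := dd _ d0 d0_0 tW; have b1 := dd _ d1 d1_0 tW; have b2 := dd _ d2 d2_0 tW.
move: a0 a1 a2 b0 b1 b2; rewrite !dsimp => a0 a1 a2 b0 b1 b2.
have e2 : d2 V0 * d2 W0 + d2 V1 * d2 W1 = 0.
  by apply: lagrange; [rewrite -[RHS]a2|rewrite -[RHS]b2]; ring.
have eE : eulE V0 * eulE W0 + eulE V1 * eulE W1 = 0.
  apply: lagrange.
    apply: (@etrans _ _ (X0 * (1 * V0 + X0 * d0 V0 + (0 * V1 + X1 * d0 V1)) +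
      X1 * (0 * V0 + X0 * d1 V0 + (1 * V1 + X1 * d1 V1)) - (X0 * V0 + X1 * V1))).
      by rewrite /eulE; ring.
    by rewrite a0 a1 tV; ring.
  apply: (@etrans _ _ (X0 * (1 * W1 + X0 * d0 W1 - (0 * W0 + X1 * d0 W0)) +
    X1 * (0 * W1 + X0 * d1 W1 - (1 * W0 + X1 * d1 W0)) - (X0 * W1 - X1 * W0))).
    by rewrite /eulE; ring.
  by rewrite b0 b1 tW; ring.
have eD : V0 * W0 + V1 * W1 = 0 by exact: lagrange.
apply: cancel_r2.
apply: (@etrans _ _ ((eulE V0 * eulE W0 + eulE V1 * eulE W1) +
  (rotD V0 * rotD W0 + rotD V1 * rotD W1) + r2 * (d2 V0 * d2 W0 + d2 V1 * d2 W1))).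
  by rewrite /eulE /rotD /r2; ring.
rewrite eE e2 rV0 rV1 rW0 rW1.
by apply: (@etrans _ _ (V0 * W0 + V1 * W1)); [ring|exact: eD].
Qed.

End Orthogonality.
End DifferentialAlgebra.

(** * Divergence identities *)

Section Flux.
Variables (K : comNzRingType) (d0 d1 d2 : K -> K).
Hypotheses (d0D : forall f g, d0 (f + g) = d0 f + d0 g)
  (d1D : forall f g, d1 (f + g) = d1 f + d1 g)
  (d2D : forall f g, d2 (f + g) = d2 f + d2 g)
  (d0M : forall f g, d0 (f * g) = d0 f * g + f * d0 g)
  (d1M : forall f g, d1 (f * g) = d1 f * g + f * d1 g)
  (d2M : forall f g, d2 (f * g) = d2 f * g + f * d2 g).
Let d0N f : d0 (- f) = - d0 f. Proof. exact: d0N. Qed.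
Let d1N f : d1 (- f) = - d1 f. Proof. exact: d1N. Qed.
Let d2N f : d2 (- f) = - d2 f. Proof. exact: d2N. Qed.
Let simp := (d0D, d1D, d2D, d0M, d1M, d2M, d0N, d1N, d2N).

Definition dot f g := d0 f * d0 g + d1 f * d1 g + d2 f * d2 g.

Variables U0 U1 U2 : K.
Hypothesis divU : d0 U0 + d1 U1 + d2 U2 = 0.

(** For rho a function of s with derivative [drho] and primitive [Pi], the transport term is itself
    a divergence: div (Pi u) = rho u . grad s. *)
Lemma flux_potential s rho Pi drho :
  d0 rho = drho * d0 s -> d1 rho = drho * d1 s -> d2 rho = drho * d2 s ->
  d0 Pi = rho * d0 s -> d1 Pi = rho * d1 s -> d2 Pi = rho * d2 s ->
  d0 (rho * d0 s - Pi * U0) + d1 (rho * d1 s - Pi * U1) + d2 (rho * d2 s - Pi * U2) =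
  drho * dot s s + rho * (lap d0 d1 d2 s - adv d0 d1 d2 U0 U1 U2 s).
Proof.
move=> r0 r1 r2 p0 p1 p2; rewrite !simp r0 r1 r2 p0 p1 p2 /lap /adv /dot.
apply: (@etrans _ _ (drho * (d0 s * d0 s + d1 s * d1 s + d2 s * d2 s) +
  rho * (d0 (d0 s) + d1 (d1 s) + d2 (d2 s) - (U0 * d0 s + U1 * d1 s + U2 * d2 s))
  - Pi * (d0 U0 + d1 U1 + d2 U2))); first ring.
by rewrite divU; ring.
Qed.

(** All derivatives are moved onto the weight, so that integrability of s and boundedness of u
    control the last term. *)
Lemma flux_green s rho :
  d0 (rho * d0 s - s * d0 rho - s * rho * U0) + d1 (rho * d1 s - s * d1 rho - s * rho * U1) +
  d2 (rho * d2 s - s * d2 rho - s * rho * U2) =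
  rho * (lap d0 d1 d2 s - adv d0 d1 d2 U0 U1 U2 s) -
  s * (lap d0 d1 d2 rho + adv d0 d1 d2 U0 U1 U2 rho).
Proof.
rewrite !simp /lap /adv.
apply: (@etrans _ _ (rho * (d0 (d0 s) + d1 (d1 s) + d2 (d2 s) - (U0 * d0 s + U1 * d1 s + U2 * d2 s)) -
 s * (d0 (d0 rho) + d1 (d1 rho) + d2 (d2 rho) + (U0 * d0 rho + U1 * d1 rho + U2 * d2 rho))
 - s * rho * (d0 U0 + d1 U1 + d2 U2))); first ring.
by rewrite divU; ring.
Qed.

(* The correction by the horizontal field c^2 X cancels the Laplacian of c = 1/(r^2+e). *)
Lemma flux_weighted s chi c X0 X1 :
  d0 X0 = 1 -> d1 X0 = 0 -> d0 X1 = 0 -> d1 X1 = 1 ->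
  d0 c = - (c * c * X0 *+ 2) -> d1 c = - (c * c * X1 *+ 2) -> d2 c = 0 ->
  d0 (chi * c * d0 s - s * d0 (chi * c) - s * (chi * c) * U0 - chi * (c * c) * X0 * s *+ 2) +
  d1 (chi * c * d1 s - s * d1 (chi * c) - s * (chi * c) * U1 - chi * (c * c) * X1 * s *+ 2) +
  d2 (chi * c * d2 s - s * d2 (chi * c) - s * (chi * c) * U2) =
  chi * c * (lap d0 d1 d2 s - adv d0 d1 d2 U0 U1 U2 s) -
  s * c * (lap d0 d1 d2 chi + adv d0 d1 d2 U0 U1 U2 chi) +
  c * c * s * eulE d0 d1 X0 X1 chi *+ 2 + chi * (c * c) * (X0 * U0 + X1 * U1) * s *+ 2 -
  chi * (c * c) * eulE d0 d1 X0 X1 s *+ 2.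
Proof.
move=> x00 x10 x01 x11 c0 c1 c2.
have d20 : d2 0 = 0 by apply: (addrI (d2 0)); rewrite -d2D !addr0.
rewrite /lap /adv /eulE !mulr2n; rewrite !mulr2n in c0 c1.
rewrite !(simp, c0, c1, c2, x00, x10, x01, x11, d20).
apply: (@etrans _ _ (chi * c * (d0 (d0 s) + d1 (d1 s) + d2 (d2 s) - (U0 * d0 s + U1 * d1 s + U2 * d2 s)) -
  s * c * (d0 (d0 chi) + d1 (d1 chi) + d2 (d2 chi) + (U0 * d0 chi + U1 * d1 chi + U2 * d2 chi)) +
  (c * c * s * (X0 * d0 chi + X1 * d1 chi) + c * c * s * (X0 * d0 chi + X1 * d1 chi)) +
  (chi * (c * c) * (X0 * U0 + X1 * U1) * s + chi * (c * c) * (X0 * U0 + X1 * U1) * s) -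
  (chi * (c * c) * (X0 * d0 s + X1 * d1 s) + chi * (c * c) * (X0 * d0 s + X1 * d1 s)) -
  s * chi * c * (d0 U0 + d1 U1 + d2 U2))); first ring.
by rewrite divU; ring.
Qed.

End Flux.

(** With b_n = [beta n] at L, b0' = b2 and c = 1/2: (L + 1/2) b0^2 is a primitive of (b0 + b1)^2.
    Having this primitive in closed form is what singles out [bump] and [prim] below. *)
Lemma square_primitive (K : comNzRingType) (b0 b1 b2 L c D : K) :
  L * b2 = b1 -> b2 * b0 = b1 ^+ 2 -> c + c = 1 ->
  D * (b0 * b0) + (L + c) * (b2 * D * b0 + b0 * (b2 * D)) = (b0 + b1) ^+ 2 * D.
Proof.
move=> <- h hc.
apply: (@etrans _ _ (D * (b0 * b0 + (L * b2) * b0 *+ 2 + (c + c) * (b2 * b0)))); first by ring.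
by rewrite hc h; ring.
Qed.

Lemma square_derivative (K : comNzRingType) (b b' k D : K) :
  k * (b' * (k * D) * b + b * (b' * (k * D))) = k * (b * b' *+ 2) * k * D.
Proof. by ring. Qed.

(** * Axisymmetric fields *)

Section Axisymmetry.
Context {R : realType}.
Implicit Types f g : sfun R.

Definition Rot (f : sfun R) : sfun R := rotD (d o0) (d o1) (X o0) (X o1) f.
Definition RR : sfun R := r2 (X o0) (X o1).

Definition sqr_r (x : 'rV[R]_3) : R := x 0 o0 ^+ 2 + x 0 o1 ^+ 2.

Lemma sqr_r_ge0 x : 0 <= sqr_r x.
Proof. by rewrite addr_ge0 ?sqr_ge0. Qed.

Lemma sqr_rE x : RR x = sqr_r x.
Proof. by rewrite /RR /r2 sfD !sfM !XE -!expr2. Qed.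

(** A point of the axis is approached along the first coordinate direction, which leaves the axis at
    once. *)
Lemma sfun_eq_off_axis f g : (forall x, 0 < sqr_r x -> f x = g x) -> f = g.
Proof.
move=> fg; apply: sfun_eq => x.
have [xr|] := ltP 0 (sqr_r x); first exact: fg.
move=> xr; have [x0 x1] : x 0 o0 = 0 /\ x 0 o1 = 0.
  have := sqr_ge0 (x 0 o0); have := sqr_ge0 (x 0 o1); rewrite /sqr_r in xr => h1 h0.
  by split; apply/eqP; rewrite -sqrf_eq0; apply/eqP; lra.
pose h : sfun R := f - g.
suff : h x = 0 by rewrite /h sfD sfN => /eqP; rewrite subr_eq0 => /eqP.
apply/eqP/negPn/negP => hx.
have ch : continuous (fun t : R => h (t *: be o0 + x)) by exact: continuous_line (sfun_continuous (f := h)).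
have /cvgrPdist_lt /(_ `|h x|) := ch 0.
rewrite normr_gt0 => /(_ hx) /nbhs_normP [e /= e0 he].
have : `|h (0 *: be o0 + x) - h ((e / 2) *: be o0 + x)| < `|h x|.
  by apply: he => /=; rewrite sub0r normrN ger0_norm ?divr_ge0 ?ltW// ltr_pdivrMr// ltr_pMr// ltr1n.
rewrite scale0r add0r (_ : h ((e / 2) *: be o0 + x) = 0) ?subr0 ?ltxx//.
rewrite /h sfD sfN fg ?subrr// /sqr_r !mxE /= x0 x1 !addr0 mulr1 mulr0 expr0n /= addr0.
by rewrite exprn_gt0// divr_gt0.
Qed.

Lemma cancel_r2_sfun f : RR * f = 0 -> f = 0.
Proof.
move=> h; apply: sfun_eq_off_axis => x xr.
have := congr1 (fun g : sfun R => g x) h; rewrite sfM sqr_rE => /eqP.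
by rewrite mulf_eq0 gt_eqF//= => /eqP.
Qed.

Lemma unit_circle (a b : R) : a ^+ 2 + b ^+ 2 = 1 -> exists t, a = cos t /\ b = sin t.
Proof.
move=> ab.
have a2 : a ^+ 2 <= 1 by have := sqr_ge0 b; lra.
have a1 : -1 <= a <= 1 by rewrite -ler_norml -(@ler_pXn2r _ 2)// ?nnegrE// real_normK ?num_real// expr1n.
have ca : cos (acos a) = a by rewrite acosK// in_itv.
have sa : sin (acos a) = `|b|.
  rewrite sin_acos// (_ : 1 - a ^+ 2 = b ^+ 2) ?sqrtr_sqr//; lra.
have [b0|b0] := leP 0 b; first by exists (acos a); rewrite ca sa ger0_norm.
by exists (- acos a); rewrite cosN sinN ca sa ltr0_norm// opprK.
Qed.

Lemma polar x : 0 < sqr_r x -> exists r t, [/\ 0 < r, r ^+ 2 = sqr_r x,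
  x 0 o0 = r * cos t & x 0 o1 = r * sin t].
Proof.
move=> xr; pose r := Num.sqrt (sqr_r x).
have r0 : 0 < r by rewrite sqrtr_gt0.
have rr : r ^+ 2 = sqr_r x by rewrite sqr_sqrtr// ltW.
have [t [c s]] : exists t, x 0 o0 / r = cos t /\ x 0 o1 / r = sin t.
  by apply: unit_circle; rewrite !exprMn -mulrDl -/(sqr_r x) -rr exprVn divff// expf_neq0// gt_eqF.
exists r, t; rewrite -c -s; split=> //; by rewrite mulrC divfK// gt_eqF.
Qed.

Definition orbit (r z t : R) : 'rV[R]_3 := vec3 (r * cos t) (r * sin t) z.

Lemma orbitE r z t : orbit r z t = (r * cos t) *: be o0 + ((r * sin t) *: be o1 + z *: be o2).
Proof. exact: vec3_be. Qed.

Lemma is_derive_orbit f r z t :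
  is_derive t (1 : R) (fun t => f (orbit r z t)) (Rot f (orbit r z t)).
Proof.
have Dc : is_derive t (1 : R) (fun t => r * cos t) (- (r * sin t)).
  have := @is_deriveZ R R R cos r t 1 _ (is_derive_cos t).
  by rewrite /GRing.scale /= mulrN.
have Ds : is_derive t (1 : R) (fun t => r * sin t) (r * cos t).
  exact: (@is_deriveZ R R R sin r t 1 _ (is_derive_sin t)).
have := sf_curve f (z *: be o2) Dc Ds.
rewrite -orbitE (_ : (fun t => f _) = (fun t => f (orbit r z t))); last first.
  by apply/funext => s; rewrite orbitE.
move=> h; apply: (is_derive_eq h).
rewrite /Rot /rotD sfD sfN !sfM !XE /orbit !vec3E -/(orbit r z t).
by move: (d o0 f _) (d o1 f _) => A B; ring.
Qed.

Lemma eq_off_axis_orbit f g : (forall r z t, 0 < r -> f (orbit r z t) = g (orbit r z t)) -> f = g.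
Proof.
move=> fg; apply: sfun_eq_off_axis => x /polar[r [t [r0 _ e0 e1]]].
by rewrite (vec3_eta x) e0 e1; exact: fg.
Qed.

Lemma rot_eq_orbit f g : (forall r z t, 0 < r ->
  is_derive t (1 : R) (fun t => f (orbit r z t)) (g (orbit r z t))) -> Rot f = g.
Proof.
move=> fg; apply: eq_off_axis_orbit => r z t r0.
have [_ <-] := is_derive_orbit f r z t.
by have [_ ->] := fg r z t r0.
Qed.

(* f is affine and 2 pi-periodic along each orbit. *)
Lemma rot_rot_eq0 f : Rot (Rot f) = 0 -> Rot f = 0.
Proof.
move=> ff; apply: eq_off_axis_orbit => r z t r0; rewrite sf0.
pose c := Rot f (orbit r z 0).
have cst s : Rot f (orbit r z s) = c.
  apply: (@is_derive_0_is_cst R (fun s => Rot f (orbit r z s))) => s'.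
  by have := is_derive_orbit (Rot f) r z s'; rewrite ff sf0.
pose h s := f (orbit r z s) - c * s.
have Dh s : is_derive s (1 : R) h 0.
  have D1 := is_derive_orbit f r z s.
  have D2 : is_derive s (1 : R) (fun s => c * s) (c * 1).
    exact: (@is_deriveZ R R R id c s 1 1 (is_derive_id _ _)).
  have := is_deriveB D1 D2; rewrite cst mulr1 subrr; exact.
have : h (2 * pi) = h 0 by apply: is_derive_0_is_cst.
have -> : h (2 * pi) = f (orbit r z 0) - c * (2 * pi).
  have c2 : cos (2 * pi) = 1 :> R by rewrite mulr_natl cos2pi.
  have s2 : sin (2 * pi) = 0 :> R by rewrite mulr_natl sin2pi.
  by rewrite /h /orbit c2 s2 cos0 sin0.
rewrite /h mulr0 subr0 => /eqP; rewrite -subr_eq0 addrAC subrr sub0r oppr_eq0 mulf_eq0.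
rewrite (_ : (2 * pi == 0 :> R) = false) ?orbF; last by rewrite mulf_eq0 pnatr_eq0 /= gt_eqF ?pi_gt0.
by rewrite cst => /eqP.
Qed.

Section Field.
Variables (u : 'rV[R]_3 -> 'rV[R]_3) (ur ut uz : R -> R -> R) (U : 'I_3 -> sfun R).
Hypotheses (u_axi : axisymmetric_with ur ut uz u) (Uu : forall i x, U i x = u x 0 i).

Lemma field_orbit r z t : 0 < r ->
  [/\ U o0 (orbit r z t) = ur r z * cos t - ut r z * sin t,
      U o1 (orbit r z t) = ur r z * sin t + ut r z * cos t &
      U o2 (orbit r z t) = uz r z].
Proof.
move=> r0; rewrite !Uu /orbit u_axi// /e_r /e_theta /e_z; split; rewrite !(vec3E, mxE) /=; ring.
Qed.

(** Infinitesimal form of axial symmetry, in which it enters the algebraic identities; its proof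
    differentiates along the circles about the axis. *)
Lemma rot_field : [/\ Rot (U o0) = - U o1, Rot (U o1) = U o0 & Rot (U o2) = 0].
Proof.
have Dcs (a b t : R) : is_derive t (1 : R) (fun t => a * cos t + b * sin t) (- (a * sin t) + b * cos t).
  have D1 := @is_deriveZ R R R cos a t 1 _ (is_derive_cos t).
  have D2 := @is_deriveZ R R R sin b t 1 _ (is_derive_sin t).
  by have := is_deriveD D1 D2; rewrite /GRing.scale /= mulrN.
split; apply: rot_eq_orbit => r z t r0.
- rewrite (_ : (fun t => _) = fun t => ur r z * cos t + (- ut r z) * sin t); last first.
    by apply/funext => s; have [-> _ _] := field_orbit z s r0; rewrite mulNr.
  apply: (is_derive_eq (Dcs _ _ _)); rewrite sfN; have [_ -> _] := field_orbit z t r0; ring.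
- rewrite (_ : (fun t => _) = fun t => ut r z * cos t + ur r z * sin t); last first.
    by apply/funext => s; have [_ -> _] := field_orbit z s r0; rewrite addrC.
  apply: (is_derive_eq (Dcs _ _ _)); have [-> _ _] := field_orbit z t r0; ring.
- rewrite (_ : (fun t => _) = cst (uz r z)); last first.
    by apply/funext => s; have [_ _ ->] := field_orbit z s r0.
  by rewrite sf0; exact: is_derive_cst.
Qed.

(* (u - S u S) / 2 with S the reflection y -> - y: this is u_theta e_theta, written so that it is
   visibly smooth on the axis. *)
Definition swirl0 : sfun R := sfc 2^-1 * (U o0 - sfrefl (U o0)).
Definition swirl1 : sfun R := sfc 2^-1 * (U o1 + sfrefl (U o1)).

Lemma reflect_orbit r z t : reflect_y (orbit r z t) = orbit r z (- t).
Proof. by rewrite /reflect_y /orbit !vec3E cosN sinN mulrN. Qed.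

Lemma swirl_orbit r z t : 0 < r ->
  swirl0 (orbit r z t) = - (ut r z * sin t) /\ swirl1 (orbit r z t) = ut r z * cos t.
Proof.
move=> r0; have [a0 a1 _] := field_orbit z t r0; have [b0 b1 _] := field_orbit z (- t) r0.
rewrite /swirl0 /swirl1 !sfM !sfcE !sfD sfN !sfreflE reflect_orbit a0 a1 b0 b1 cosN sinN.
by split; field.
Qed.

Lemma rot_swirl : Rot swirl0 = - swirl1 /\ Rot swirl1 = swirl0.
Proof.
split; apply: rot_eq_orbit => r z t r0.
- rewrite (_ : (fun t => _) = fun t => (- ut r z) * sin t); last first.
    by apply/funext => s; have [-> _] := swirl_orbit z s r0; rewrite mulNr.
  apply: (is_derive_eq (@is_deriveZ R R R sin _ t 1 _ (is_derive_sin t))).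
  by rewrite sfN; have [_ ->] := swirl_orbit z t r0; rewrite /GRing.scale /= mulNr.
- rewrite (_ : (fun t => _) = fun t => ut r z * cos t); last first.
    by apply/funext => s; have [_ ->] := swirl_orbit z s r0.
  apply: (is_derive_eq (@is_deriveZ R R R cos _ t 1 _ (is_derive_cos t))).
  by have [-> _] := swirl_orbit z t r0; rewrite /GRing.scale /= mulrN.
Qed.

Lemma swirl_tangent : X o0 * swirl0 + X o1 * swirl1 = 0.
Proof.
apply: eq_off_axis_orbit => r z t r0; have [e0 e1] := swirl_orbit z t r0.
move: swirl0 swirl1 e0 e1 => V0 V1 e0 e1.
by rewrite sfD !sfM !XE e0 e1 /orbit !vec3E sf0; ring.
Qed.

Lemma swirl_radial : X o0 * (U o1 - swirl1) - X o1 * (U o0 - swirl0) = 0.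
Proof.
apply: eq_off_axis_orbit => r z t r0; have [e0 e1] := swirl_orbit z t r0.
have [a0 a1 _] := field_orbit z t r0.
move: swirl0 swirl1 e0 e1 => V0 V1 e0 e1.
by rewrite !(sfD, sfN, sfM) !XE e0 e1 a0 a1 /orbit !vec3E sf0; ring.
Qed.

Lemma cyl_rE x : cyl_r x = Num.sqrt (sqr_r x).
Proof. by rewrite /cyl_r inord0 inord1. Qed.

(** The bridge from [ur], in which the hypothesis is stated, to the smooth function r u_r. *)
Lemma ur_radial x : 0 < sqr_r x ->
  ur (cyl_r x) (cyl_z x) / cyl_r x = (x 0 o0 * U o0 x + x 0 o1 * U o1 x) / sqr_r x.
Proof.
move=> xr; have [r [t [r0 rr e0 e1]]] := polar xr.
have xE : x = orbit r (x 0 o2) t by rewrite {1}(vec3_eta x) e0 e1.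
have cr : cyl_r x = r by rewrite cyl_rE -rr sqrtr_sqr gtr0_norm.
have cz : cyl_z x = x 0 o2 by rewrite /cyl_z inord2.
have [a0 a1 _] := field_orbit (x 0 o2) t r0.
rewrite -xE in a0 a1; rewrite cr cz a0 a1 e0 e1 -rr.
have rn0 : r != 0 by rewrite gt_eqF.
apply: (@mulIf _ (r ^+ 2)); first by rewrite expf_neq0.
rewrite divfK ?expf_neq0//.
have cs : cos t ^+ 2 = 1 - sin t ^+ 2 by rewrite cos2sin2.
rewrite (_ : _ / r * r ^+ 2 = ur r (x 0 o2) * r); last by field.
rewrite (_ : r * cos t * _ + _ = ur r (x 0 o2) * r * (cos t ^+ 2 + sin t ^+ 2)); last by ring.
by rewrite cs subrK mulr1.
Qed.

End Field.
End Axisymmetry.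

(** * Swirl and vorticity equations *)

Section VectorCalculus.
Context {R : realType}.
Implicit Types f g a b s : sfun R.

Definition Lap (f : sfun R) : sfun R := d o0 (d o0 f) + d o1 (d o1 f) + d o2 (d o2 f).
Definition Adv (U : 'I_3 -> sfun R) (f : sfun R) : sfun R :=
  U o0 * d o0 f + U o1 * d o1 f + U o2 * d o2 f.
Definition Dot (f g : sfun R) : sfun R := d o0 f * d o0 g + d o1 f * d o1 g + d o2 f * d o2 g.
Definition Div (f0 f1 f2 : sfun R) : sfun R := d o0 f0 + d o1 f1 + d o2 f2.
Definition Rad (U : 'I_3 -> sfun R) : sfun R := X o0 * U o0 + X o1 * U o1.
Definition Eul (f : sfun R) : sfun R := X o0 * d o0 f + X o1 * d o1 f.
Definition Hsq (a b : sfun R) : sfun R := a * a + b * b.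
Definition Hgrad (a b : sfun R) : sfun R :=
  d o0 a * d o0 a + d o1 a * d o1 a + (d o0 b * d o0 b + d o1 b * d o1 b).
Definition Vgrad (a b : sfun R) : sfun R := d o2 a * d o2 a + d o2 b * d o2 b.
Definition GradU (U : 'I_3 -> sfun R) : sfun R := gradsq (U o0) + gradsq (U o1) + gradsq (U o2).

Lemma d00X : d o0 (@X R o0) = 1. Proof. by rewrite dX. Qed.
Lemma d10X : d o1 (@X R o0) = 0. Proof. by rewrite dX. Qed.
Lemma d20X : d o2 (@X R o0) = 0. Proof. by rewrite dX. Qed.
Lemma d01X : d o0 (@X R o1) = 0. Proof. by rewrite dX. Qed.
Lemma d11X : d o1 (@X R o1) = 1. Proof. by rewrite dX. Qed.
Lemma d21X : d o2 (@X R o1) = 0. Proof. by rewrite dX. Qed.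
Lemma d22X : d o2 (@X R o2) = 1. Proof. by rewrite dX. Qed.

Lemma sfun_eq_at f g : f = g -> forall x, f x = g x. Proof. by move=> ->. Qed.

Section Horizontal.
Variables a b : sfun R.
Hypotheses (ra : Rot a = - b) (rb : Rot b = a).
Let s := Hsq a b.

Lemma hsqE x : s x = a x ^+ 2 + b x ^+ 2.
Proof. by rewrite /s /Hsq sfD !sfM -!expr2. Qed.

Lemma hsq_ge0 x : 0 <= s x. Proof. by rewrite hsqE addr_ge0 ?sqr_ge0. Qed.

Lemma hgrad_ge0 x : 0 <= Hgrad a b x.
Proof.
rewrite -[Hgrad a b x]/(d o0 a x ^+ 2 + d o1 a x ^+ 2 + (d o0 b x ^+ 2 + d o1 b x ^+ 2)).
by rewrite !addr_ge0 ?sqr_ge0.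
Qed.
Lemma vgrad_ge0 x : 0 <= Vgrad a b x.
Proof. by rewrite -[Vgrad a b x]/(d o2 a x ^+ 2 + d o2 b x ^+ 2) addr_ge0 ?sqr_ge0. Qed.

Lemma sqr_r_coord0 (x : 'rV[R]_3) : sqr_r x = 0 -> x 0 o0 = 0 /\ x 0 o1 = 0.
Proof.
rewrite /sqr_r => xr; have := sqr_ge0 (x 0 o0); have := sqr_ge0 (x 0 o1) => h1 h0.
by split; apply/eqP; rewrite -sqrf_eq0; apply/eqP; lra.
Qed.

(** On the axis the operator [Rot] vanishes, so the two symmetry relations leave 0 = -b and 0 = a.
    This makes the default value of a quotient by r^2 = 0 harmless. *)
Lemma horizontal_axis x : sqr_r x = 0 -> a x = 0 /\ b x = 0.
Proof.
move=> /sqr_r_coord0[x0 x1].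
have := sfun_eq_at ra x; have := sfun_eq_at rb x.
rewrite -[Rot b x]/(x 0 o0 * d o1 b x - x 0 o1 * d o0 b x).
rewrite -[Rot a x]/(x 0 o0 * d o1 a x - x 0 o1 * d o0 a x).
rewrite sfN.
rewrite x0 x1 !mul0r subr0 => <- /esym/eqP.
by rewrite oppr_eq0 => /eqP ->.
Qed.

Lemma lap_hsq : Lap s = (a * Lap a + b * Lap b + Hgrad a b + Vgrad a b) *+ 2.
Proof. by apply: (@lap_sq (sfun R) (d o0) (d o1) (d o2)); move=> *; rewrite ?dD ?dM. Qed.

Lemma adv_hsq U : Adv U s = (a * Adv U a + b * Adv U b) *+ 2.
Proof. by rewrite /Adv /s /Hsq !(dD, dM); ring. Qed.

Lemma hgrad_polar_sfun : RR * Hgrad a b = Eul a * Eul a + Eul b * Eul b + s.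
Proof. exact: (@hgrad_polar (sfun R) (d o0) (d o1) (X o0) (X o1) a b ra rb). Qed.

Lemma hgrad_polar_at x :
  sqr_r x * Hgrad a b x = Eul a x ^+ 2 + Eul b x ^+ 2 + (a x ^+ 2 + b x ^+ 2).
Proof. by rewrite -sqr_rE; exact: sfun_eq_at hgrad_polar_sfun x. Qed.

Lemma eulE_hsq_at x : Eul s x = 2 * (a x * Eul a x + b x * Eul b x).
Proof.
have := sfun_eq_at (@eulE_sq (sfun R) (d o0) (d o1) (X o0) (X o1) (dD o0) (dD o1) (dM o0) (dM o1) a b) x.
by move=> e; rewrite mulr_natl; exact: e.
Qed.

(** The difference is the sum of the squares of [Eul a] - c r^2 a and [Eul b] - c r^2 b. With c = 0
    it is the Hardy inequality; with c = 1/(r^2 + e) it matches the derivative term of the weighted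
    flux. *)
Lemma hgrad_lower x (c : R) :
  sqr_r x * Hgrad a b x >= c * sqr_r x * Eul s x + (1 - c ^+ 2 * sqr_r x ^+ 2) * s x.
Proof.
rewrite hgrad_polar_at eulE_hsq_at hsqE.
move: (a x) (b x) (Eul a x) (Eul b x) (sqr_r x) => A B EA EB r.
rewrite -subr_ge0 (_ : _ - _ = (EA - c * r * A) ^+ 2 + (EB - c * r * B) ^+ 2); last by ring.
by rewrite addr_ge0 ?sqr_ge0.
Qed.

Lemma d_hsq_at i x : d i s x = 2 * (a x * d i a x + b x * d i b x).
Proof.
have e : d i s = (a * d i a + b * d i b) *+ 2 by rewrite /s /Hsq !(dD, dM); ring.
by rewrite e sfMn mulr_natl.
Qed.

Lemma vgrad_at x : Vgrad a b x = d o2 a x ^+ 2 + d o2 b x ^+ 2.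
Proof. by []. Qed.

Lemma d2_hsq_le x : d o2 s x ^+ 2 <= 4 * s x * Vgrad a b x.
Proof.
rewrite hsqE d_hsq_at vgrad_at.
move: (a x) (b x) (d o2 a x) (d o2 b x) => A B DA DB.
rewrite -subr_ge0 (_ : _ - _ = 4 * (A * DB - B * DA) ^+ 2); last by ring.
by rewrite mulr_ge0 ?sqr_ge0.
Qed.

Lemma rot_at f x : Rot f x = x 0 o0 * d o1 f x - x 0 o1 * d o0 f x.
Proof. by []. Qed.
Lemma eul_at f x : Eul f x = x 0 o0 * d o0 f x + x 0 o1 * d o1 f x.
Proof. by []. Qed.

(** s is rotation invariant, so only [Eul] and d_z act on it, and Cauchy-Schwarz applies to these
    two. The angular derivative of the vector is seen by the right side only and accounts for 4
    s^2. *)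
Lemma grad_hsq_le x :
  sqr_r x * gradsq s x + 4 * s x ^+ 2 <= 4 * s x * (sqr_r x * (Hgrad a b x + Vgrad a b x)).
Proof.
have h2 := d2_hsq_le x.
have e : sqr_r x * (d o0 s x ^+ 2 + d o1 s x ^+ 2) = (2 * (a x * Eul a x + b x * Eul b x)) ^+ 2.
  rewrite /sqr_r (d_hsq_at o0 x) (d_hsq_at o1 x) (eul_at a x) (eul_at b x).
  have := sfun_eq_at ra x; have := sfun_eq_at rb x; rewrite sfN !rot_at.
  move: (a x) (b x) (d o0 a x) (d o0 b x) (d o1 a x) (d o1 b x) (x 0 o0) (x 0 o1).
  move=> A B A0 B0 A1 B1 x0 x1 eB eA.
  have e0 : x0 * (2 * (A * A1 + B * B1)) - x1 * (2 * (A * A0 + B * B0)) = 0.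
    rewrite (_ : _ - _ = 2 * (A * (x0 * A1 - x1 * A0) + B * (x0 * B1 - x1 * B0))); last by ring.
    by rewrite eA eB; ring.
  apply: (@etrans _ _ ((2 * (A * (x0 * A0 + x1 * A1) + B * (x0 * B0 + x1 * B1))) ^+ 2 +
    (x0 * (2 * (A * A1 + B * B1)) - x1 * (2 * (A * A0 + B * B0))) ^+ 2)); first by ring.
  by rewrite e0; ring.
rewrite gradsqE mulrDr e (mulrDr (sqr_r x)) hgrad_polar_at.
have r0 := sqr_r_ge0 x; have := ler_wpM2l r0 h2; rewrite (hsqE x).
move: (a x) (b x) (Eul a x) (Eul b x) (sqr_r x) (d o2 s x) (Vgrad a b x) => A B EA EB r D2 VG h3.
rewrite -subr_ge0 (_ : _ - _ = 4 * (A * EB - B * EA) ^+ 2 +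
  (r * (4 * (A ^+ 2 + B ^+ 2) * VG) - r * D2 ^+ 2)); last by ring.
apply: addr_ge0; first by rewrite mulr_ge0 ?sqr_ge0.
by rewrite subr_ge0.
Qed.

Lemma horizontal_identity (U : 'I_3 -> sfun R) (K : sfun R) :
  RR * (a * (Lap a - Adv U a) + b * (Lap b - Adv U b)) = K * s ->
  forall x, Lap s x - Adv U s x = 2 * (K x / sqr_r x * s x + Hgrad a b x + Vgrad a b x).
Proof.
move=> e x; have ex := sfun_eq_at e x; rewrite sfM sqr_rE sfM in ex.
pose Z : sfun R := a * (Lap a - Adv U a) + b * (Lap b - Adv U b).
rewrite -/Z in ex.
have -> : Lap s x - Adv U s x = (Z *+ 2 + (Hgrad a b + Vgrad a b) *+ 2 : sfun R) x.
  rewrite -sfN -sfD; apply: sfun_eq_at; rewrite lap_hsq adv_hsq /Z.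
  by move: (Lap a) (Lap b) (Adv U a) (Adv U b) (Hgrad a b) (Vgrad a b) => *; ring.
have -> : (Z *+ 2 + (Hgrad a b + Vgrad a b) *+ 2 : sfun R) x =
    2 * (Z x + Hgrad a b x + Vgrad a b x).
  by rewrite sfD !sfMn sfD -mulrnDl mulr_natl addrA.
congr (2 * (_ + _ + _)).
(* On the axis [K x / 0] is 0, and [Z] vanishes together with [a] and [b]. *)
have [r0|r0] := eqVneq (sqr_r x) 0.
  have [ax bx] := horizontal_axis r0.
  rewrite r0 invr0 mulr0 mul0r /Z sfD (sfM a) (sfM b) ax bx !mul0r addr0 //.
by apply: (mulfI r0); rewrite ex mulrA [in RHS]mulrCA mulfV ?mulr1.
Qed.

End Horizontal.

Lemma rotB f g : Rot (f - g) = Rot f - Rot g.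
Proof.
by rewrite /Rot -(@rotDN (sfun R) _ _ _ _ (dD o0) (dD o1)) (@rotDD (sfun R) _ _ _ _ (dD o0) (dD o1)).
Qed.

Section Solution.
Variables (U : 'I_3 -> sfun R) (P : sfun R).
Hypotheses (rU0 : Rot (U o0) = - U o1) (rU1 : Rot (U o1) = U o0) (rU2 : Rot (U o2) = 0).
Hypotheses (ns : forall j, Adv U (U j) + d j P = Lap (U j))
  (divU : Div (U o0) (U o1) (U o2) = 0).

Lemma rot_pressure : Rot P = 0.
Proof.
apply: rot_rot_eq0.
exact: (@rotD_rotD_pressure (sfun R) (d o0) (d o1) (d o2) (X o0) (X o1) (dD o0) (dD o1) (dD o2)
  (dM o0) (dM o1) (dM o2) (d_sym _ _) (d_sym _ _) (d_sym _ _) d00X d10X d20X d01X d11X d21X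
  (U o0) (U o1) (U o2) P rU0 rU1 rU2 (ns o0) (ns o1)).
Qed.

Section Swirl.
Variables V0 V1 : sfun R.
Hypotheses (rV0 : Rot V0 = - V1) (rV1 : Rot V1 = V0) (tV : X o0 * V0 + X o1 * V1 = 0)
  (tW : X o0 * (U o1 - V1) - X o1 * (U o0 - V0) = 0).

Lemma swirl_identity x : Lap (Hsq V0 V1) x - Adv U (Hsq V0 V1) x =
  2 * (Rad U x / sqr_r x * Hsq V0 V1 x + Hgrad V0 V1 x + Vgrad V0 V1 x).
Proof.
apply: horizontal_identity => //.
exact: (@swirl_equation (sfun R) (d o0) (d o1) (d o2) (X o0) (X o1) (dD o0) (dD o1) (dD o2)
  (dM o0) (dM o1) (dM o2) d00X d10X d20X d01X d11X d21X (U o0) (U o1) (U o2) P rU0 rU1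
  (ns o0) (ns o1) cancel_r2_sfun V0 V1 rot_pressure rV0 rV1 tV tW).
Qed.

(** Pythagoras for U = V + (U - V): the swirl inherits the finite Dirichlet integral. *)
Lemma swirl_grad_le x : Hgrad V0 V1 x + Vgrad V0 V1 x <= GradU U x.
Proof.
have rW0 : Rot (U o0 - V0) = - (U o1 - V1).
  by rewrite rotB rU0 rV0 opprD.
have rW1 : Rot (U o1 - V1) = U o0 - V0.
  by rewrite rotB rU1 rV1.
have o : Dot V0 (U o0 - V0) + Dot V1 (U o1 - V1) = 0.
  exact: (@grad_orthogonal (sfun R) (d o0) (d o1) (d o2) (X o0) (X o1) (dD o0) (dD o1) (dD o2)
    (dM o0) (dM o1) (dM o2) d00X d10X d20X d01X d11X d21X cancel_r2_sfun V0 V1 (U o0 - V0) (U o1 - V1) rV0 rV1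
    rW0 rW1 tV tW).
have ox : (d o0 V0 x * d o0 (U o0 - V0) x + d o1 V0 x * d o1 (U o0 - V0) x + d o2 V0 x * d o2 (U o0 - V0) x)
  + (d o0 V1 x * d o0 (U o1 - V1) x + d o1 V1 x * d o1 (U o1 - V1) x + d o2 V1 x * d o2 (U o1 - V1) x) = 0.
  exact: sfun_eq_at o x.
have dB' i (f g : sfun R) : d i (f - g) x = d i f x - d i g x.
  exact: sfun_eq_at (dB i f g) x.
rewrite (dB' o0 (U o0) V0) (dB' o1 (U o0) V0) (dB' o2 (U o0) V0) in ox.
rewrite (dB' o0 (U o1) V1) (dB' o1 (U o1) V1) (dB' o2 (U o1) V1) in ox.
rewrite -[GradU U x]/(gradsq (U o0) x + gradsq (U o1) x + gradsq (U o2) x).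
have g2 := gradsq_ge0 (U o2) x; rewrite -[leLHS]addr0; apply: lerD => //.
rewrite (gradsqE (U o0) x) (gradsqE (U o1) x).
rewrite -[Hgrad V0 V1 x]/(d o0 V0 x ^+ 2 + d o1 V0 x ^+ 2 + (d o0 V1 x ^+ 2 + d o1 V1 x ^+ 2)).
rewrite -[Vgrad V0 V1 x]/(d o2 V0 x ^+ 2 + d o2 V1 x ^+ 2).
move: (d o0 V0 x) (d o1 V0 x) (d o2 V0 x) (d o0 V1 x) (d o1 V1 x) (d o2 V1 x) ox => a0 a1 a2 b0 b1 b2.
move: (d o0 (U o0) x) (d o1 (U o0) x) (d o2 (U o0) x) (d o0 (U o1) x) (d o1 (U o1) x) (d o2 (U o1) x).
move=> u0 u1 u2 v0 v1 v2 ox; rewrite -subr_ge0.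
rewrite (_ : _ - _ = ((u0 - a0) ^+ 2 + (u1 - a1) ^+ 2 + (u2 - a2) ^+ 2) +
  ((v0 - b0) ^+ 2 + (v1 - b1) ^+ 2 + (v2 - b2) ^+ 2) + 2 * (a0 * (u0 - a0) + a1 * (u1 - a1) + a2 * (u2 - a2) +
      (b0 * (v0 - b0) + b1 * (v1 - b1) + b2 * (v2 - b2)))); last by ring.
by rewrite ox mulr0 addr0 !addr_ge0 ?sqr_ge0.
Qed.

End Swirl.

Section Vorticity.
Hypothesis no_swirl : X o0 * U o1 - X o1 * U o0 = 0.

Definition Om0 : sfun R := d o1 (U o2) - d o2 (U o1).
Definition Om1 : sfun R := d o2 (U o0) - d o0 (U o2).

Lemma rot_Om0 : Rot Om0 = - Om1.
Proof.
exact: (@rotD_om0 (sfun R) (d o0) (d o1) (d o2) (X o0) (X o1) (dD o0) (dD o1) (dD o2) (dM o1) (dM o2)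
  (d_sym _ _) (d_sym _ _) (d_sym _ _) d10X d20X d11X d21X (U o0) _ _ rU1 rU2).
 Qed.

Lemma rot_Om1 : Rot Om1 = Om0.
Proof.
exact: (@rotD_om1 (sfun R) (d o0) (d o1) (d o2) (X o0) (X o1) (dD o0) (dD o1) (dD o2) (dM o0) (dM o2)
  (d_sym _ _) (d_sym _ _) (d_sym _ _) d00X d20X d01X d21X _ (U o1) _ rU0 rU2).
 Qed.

Lemma vorticity_identity x : Lap (Hsq Om0 Om1) x - Adv U (Hsq Om0 Om1) x =
  2 * (- Rad U x / sqr_r x * Hsq Om0 Om1 x + Hgrad Om0 Om1 x + Vgrad Om0 Om1 x).
Proof.
apply: (@horizontal_identity Om0 Om1 rot_Om0 rot_Om1 U (- Rad U)).
exact: (@vorticity_equation (sfun R) (d o0) (d o1) (d o2) (X o0) (X o1) (dD o0) (dD o1) (dD o2)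
  (dM o0) (dM o1) (dM o2) (d_sym _ _) (d_sym _ _) (d_sym _ _) d00X d10X d20X d01X d11X d21X (U o0) (U o1) (U o2) P
  rU0 rU1 rU2 (ns o0) (ns o1) (ns o2) divU cancel_r2_sfun no_swirl).
Qed.

Lemma vorticity_le x : Hsq Om0 Om1 x <= 2 * GradU U x.
Proof.
rewrite -[Hsq _ _ x]/((d o1 (U o2) x - d o2 (U o1) x) ^+ 2 + (d o2 (U o0) x - d o0 (U o2) x) ^+ 2).
rewrite -[GradU U x]/(gradsq (U o0) x + gradsq (U o1) x + gradsq (U o2) x) (gradsqE (U o0) x) (gradsqE (U o1) x) (gradsqE (U o2) x).
move: (d o0 (U o0) x) (d o1 (U o0) x) (d o2 (U o0) x) (d o0 (U o1) x) (d o1 (U o1) x) (d o2 (U o1) x)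
  (d o0 (U o2) x) (d o1 (U o2) x) (d o2 (U o2) x) => a0 a1 a2 b0 b1 b2 c0 c1 c2.
rewrite -subr_ge0 (_ : _ - _ = (c1 + b2) ^+ 2 + (a2 + c0) ^+ 2 + 2 * (a0 ^+ 2 + a1 ^+ 2 + b0 ^+ 2 + b1 ^+ 2 + c2 ^+ 2)); last by ring.
apply: addr_ge0; first by rewrite addr_ge0 ?sqr_ge0.
by apply: mulr_ge0 => //; rewrite !addr_ge0 ?sqr_ge0.
Qed.

Lemma irrotational_harmonic : Om0 = 0 -> Om1 = 0 -> forall i, Lap (U i) = 0.
Proof.
move=> e0 e1.
have [l0 l1 l2] : [/\ Lap (U o0) = 0, Lap (U o1) = 0 & Lap (U o2) = 0].
  exact: (@harmonic_of_curl_free (sfun R) (d o0) (d o1) (d o2) (X o0) (X o1) (dD o0) (dD o1) (dD o2)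
    (dM o0) (dM o1) (d_sym _ _) (d_sym _ _) (d_sym _ _) d00X d10X d01X d11X (U o0) (U o1) (U o2)
    rU0 rU1 divU cancel_r2_sfun no_swirl e0 e1).
exact: ord3P.
Qed.

End Vorticity.
End Solution.
End VectorCalculus.

Section FluxFields.
Context {R : realType}.
Variables (U : 'I_3 -> sfun R) (divU : Div (U o0) (U o1) (U o2) = 0).
Implicit Types f g s rho Pi : sfun R.

Lemma flux_potential_sfun s rho Pi drho :
  (forall i, d i rho = drho * d i s) -> (forall i, d i Pi = rho * d i s) ->
  Div (rho * d o0 s - Pi * U o0) (rho * d o1 s - Pi * U o1) (rho * d o2 s - Pi * U o2) =
  drho * Dot s s + rho * (Lap s - Adv U s).
Proof.
move=> r p.
exact: (@flux_potential (sfun R) (d o0) (d o1) (d o2) (dD o0) (dD o1) (dD o2) (dM o0) (dM o1) (dM o2)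
  (U o0) (U o1) (U o2) divU s rho Pi drho (r o0) (r o1) (r o2) (p o0) (p o1) (p o2)).
Qed.

Lemma flux_green_sfun s rho :
  Div (rho * d o0 s - s * d o0 rho - s * rho * U o0)
    (rho * d o1 s - s * d o1 rho - s * rho * U o1) (rho * d o2 s - s * d o2 rho - s * rho * U o2) =
  rho * (Lap s - Adv U s) - s * (Lap rho + Adv U rho).
Proof.
exact: (@flux_green (sfun R) (d o0) (d o1) (d o2) (dD o0) (dD o1) (dD o2) (dM o0) (dM o1) (dM o2)
  (U o0) (U o1) (U o2) divU s rho).
Qed.

Lemma flux_weighted_sfun s chi c : d o0 c = - (c * c * X o0 *+ 2) ->
  d o1 c = - (c * c * X o1 *+ 2) -> d o2 c = 0 ->
  Div (chi * c * d o0 s - s * d o0 (chi * c) - s * (chi * c) * U o0 - chi * (c * c) * X o0 * s *+ 2)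
    (chi * c * d o1 s - s * d o1 (chi * c) - s * (chi * c) * U o1 - chi * (c * c) * X o1 * s *+ 2)
    (chi * c * d o2 s - s * d o2 (chi * c) - s * (chi * c) * U o2) =
  chi * c * (Lap s - Adv U s) - s * c * (Lap chi + Adv U chi) + c * c * s * Eul chi *+ 2 +
  chi * (c * c) * Rad U * s *+ 2 - chi * (c * c) * Eul s *+ 2.
Proof.
exact: (@flux_weighted (sfun R) (d o0) (d o1) (d o2) (dD o0) (dD o1) (dD o2) (dM o0) (dM o1) (dM o2)
  (U o0) (U o1) (U o2) divU s chi c (X o0) (X o1) d00X d10X d01X d11X).
Qed.

Lemma d_RR : [/\ d o0 (@RR R) = X o0 *+ 2, d o1 (@RR R) = X o1 *+ 2 & d o2 (@RR R) = 0].
Proof.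
rewrite /RR /r2; split; rewrite dD (dM _ (X o0)) (dM _ (X o1)).
- by rewrite d00X d01X mul1r mulr1 mul0r mulr0 !addr0 mulr2n.
- by rewrite d10X d11X mul1r mulr1 mul0r mulr0 !add0r mulr2n.
- by rewrite d20X d21X !mul0r !mulr0 !addr0.
Qed.

Lemma csupp_I3_div (f0 f1 f2 : sfun R) : csupp f0 -> csupp f1 -> csupp f2 ->
  integrable3 (Div f0 f1 f2) /\ I3 (Div f0 f1 f2) = 0.
Proof.
move=> c0 c1 c2.
have i0 := csupp_sfun_integrable (csupp_d o0 c0).
have i1 := csupp_sfun_integrable (csupp_d o1 c1).
have i2 := csupp_sfun_integrable (csupp_d o2 c2).
have i01 := integrable3D i0 i1.
split; first exact: (integrable3D i01 i2).
apply: (etrans (I3D i01 i2)); rewrite (I3D i0 i1).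
by rewrite (I3_d _ c0) (I3_d _ c1) (I3_d _ c2) !addr0.
Qed.

End FluxFields.

Section Pointwise.
Context {R : realType}.
Implicit Types (f : sfun R) (U : 'I_3 -> sfun R).

Lemma lapE f x : Lap f x = d o0 (d o0 f) x + d o1 (d o1 f) x + d o2 (d o2 f) x.
Proof. by []. Qed.
Lemma advE U f x : Adv U f x = U o0 x * d o0 f x + U o1 x * d o1 f x + U o2 x * d o2 f x.
Proof. by []. Qed.
Lemma dotE f g x : Dot f g x = d o0 f x * d o0 g x + d o1 f x * d o1 g x + d o2 f x * d o2 g x.
Proof. by []. Qed.
Lemma divE f0 f1 f2 x : Div f0 f1 f2 x = d o0 f0 x + d o1 f1 x + d o2 f2 x :> R.
Proof. by []. Qed.
Lemma radE U x : Rad U x = x 0 o0 * U o0 x + x 0 o1 * U o1 x.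
Proof. by []. Qed.
Lemma gradUE U x : GradU U x = gradsq (U o0) x + gradsq (U o1) x + gradsq (U o2) x.
Proof. by []. Qed.

End Pointwise.
Global Opaque Lap Adv Dot Div Rad Eul Hsq Hgrad Vgrad GradU Om0 Om1 Rot RR.

(** * Vanishing of the swirl *)

Section SwirlArithmetic.
Context {R : realType}.

(** Here N = |grad s|^2, G = |grad v|^2, m = s / r^2, A = u_r / r and F is the strong inflow. The
    first term on the left is at most k (G - m) b^2 because k s <= 1 + k s, and -m absorbs the weak
    inflow. The last one is an error: k s b3 = b2 + b3 and 1 + k s <= 2 k s. The middle one
    reappears unchanged on the right, as part of the flux. *)
Lemma energy_arith (k s G N m A F b b2 b3 : R) : 0 < k -> 1 < k * s -> 0 <= m <= G -> 0 <= N ->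
  N <= 4 * s * (G - m) -> - m - F * s <= A * s -> 0 <= F -> 0 <= b2 -> 0 <= b3 ->
  (k * s - 1) * b3 = b2 ->
  k ^+ 2 * N * (b ^+ 2 / (4 * (1 + k * s)) + b * b3 + (1 + k * s) * b3 ^+ 2) <=
  k ^+ 2 * (b * b3) * N + k * b ^+ 2 * (A * s + G) + k * (8 * (b2 + b3) ^+ 2 * G) +
  F * ((1 + k * s) * b ^+ 2).
Proof.
move=> k0 ks /andP[m0 mG] N0 hN hA F0 b20 b30 hb.
have q0 : 0 < 1 + k * s by lra.
have G0 : 0 <= G by lra.
have s0 : 0 < s by rewrite -(pmulr_rgt0 _ k0); lra.
have h1 : k * N * (b ^+ 2 / (4 * (1 + k * s))) <= (G - m) * b ^+ 2.
  rewrite mulrA ler_pdivrMr ?mulr_gt0//.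
  rewrite (_ : _ * (4 * _) = (4 * (1 + k * s) * (G - m)) * b ^+ 2); last by ring.
  apply: ler_wpM2r; first exact: sqr_ge0.
  apply: (@le_trans _ _ (k * (4 * s * (G - m)))); first by apply: ler_wpM2l => //; exact: ltW.
  rewrite -subr_ge0 (_ : _ - _ = 4 * (G - m)); last by ring.
  by rewrite mulr_ge0 ?subr_ge0.
have h2 : k * N * ((1 + k * s) * b3 ^+ 2) <= 8 * (b2 + b3) ^+ 2 * G.
  apply: (@le_trans _ _ (k * (4 * s * G) * ((1 + k * s) * b3 ^+ 2))).
    apply: ler_wpM2r; first by rewrite mulr_ge0 ?sqr_ge0// ltW.
    apply: ler_wpM2l; first exact: ltW.
    by apply: (le_trans hN); apply: ler_wpM2l; [rewrite mulr_ge0 ?ltW|lra].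
  rewrite (_ : _ * _ = 4 * ((k * s) * (1 + k * s) * b3 ^+ 2) * G); last by ring.
  apply: ler_wpM2r => //; rewrite -hb -subr_ge0.
  rewrite (_ : _ - _ = 4 * (k * s) * (k * s - 1) * b3 ^+ 2); last by ring.
  by rewrite !mulr_ge0 ?sqr_ge0//; lra.
have h3 : - (m * b ^+ 2) - F * s * b ^+ 2 <= A * s * b ^+ 2.
  rewrite -mulNr -mulrBl; apply: ler_wpM2r => //; exact: sqr_ge0.
have h4 : 0 <= F * b ^+ 2 by rewrite mulr_ge0 ?sqr_ge0.
have := ler_wpM2l (ltW k0) h1; have := ler_wpM2l (ltW k0) h2; have := ler_wpM2l (ltW k0) h3.
rewrite -subr_ge0 => e3; rewrite -subr_ge0 => e2; rewrite -subr_ge0 => e1.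
rewrite -subr_ge0.
rewrite (_ : _ - _ = (k * (A * s * b ^+ 2) - k * (- (m * b ^+ 2) - F * s * b ^+ 2)) +
 (k * (8 * (b2 + b3) ^+ 2 * G) - k * (k * N * ((1 + k * s) * b3 ^+ 2))) +
 (k * ((G - m) * b ^+ 2) - k * (k * N * (b ^+ 2 / (4 * (1 + k * s))))) + F * b ^+ 2).
  by do 3! (apply: addr_ge0 => //).
by move: (b ^+ 2 / _) => z; ring.
Qed.

Lemma beta_shift n (t : R) : beta n.+2 t * beta n t = beta n.+1 t ^+ 2.
Proof.
have [t0|t0] := ltP 0 t; last by rewrite !beta_npos// mulr0 expr0n.
by rewrite !beta_pos// !exprS; ring.
Qed.

Lemma beta0_homo (t t' : R) : t <= t' -> beta 0 t <= beta 0 t'.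
Proof.
move=> tt'; have [t0|t0] := ltP 0 t; last by rewrite (beta_npos _ t0) beta_ge0.
have t'0 := lt_le_trans t0 tt'.
by rewrite !beta_pos// !expr0 !mul1r ler_expR lerN2 lef_pV2.
Qed.

Lemma csuppN (f : sfun R) : csupp f -> csupp (- f : sfun R).
Proof. by move=> [M hM]; exists M => x; rewrite sfN oppr_eq0; exact: hM. Qed.

Definition decays (s : 'rV[R]_3 -> R) : Prop :=
  forall e, 0 < e -> exists M, forall x, e < s x -> forall i, `|x 0 i| <= M.

Lemma decays_csupp (s f : 'rV[R]_3 -> R) (k : R) : 0 < k -> decays s ->
  (forall x, k * s x <= 1 -> f x = 0) -> csupp f.
Proof.
move=> k0 ds h; have [|M hM] := ds k^-1; first by rewrite invr_gt0.
exists M => x fx; apply: hM; rewrite -div1r ltr_pdivrMr// mulrC ltNge.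
by apply: contraNN fx => /h ->.
Qed.

End SwirlArithmetic.

Section SwirlDecay.
Context {R : realType}.
(** In the application s = |v|^2, G = |grad v|^2, A = u_r / r, F is the strong inflow and [m] in
    [s_grad] is s / r^2. *)
Variables (U : 'I_3 -> sfun R) (s G : sfun R) (A F : 'rV[R]_3 -> R) (th : R).
Hypotheses (divU : Div (U o0) (U o1) (U o2) = 0) (s_ge0 : forall x, 0 <= s x)
  (s_eq : forall x, Lap s x - Adv U s x = 2 * (A x * s x + G x))
  (s_grad : forall x, 0 < s x -> exists m, [/\ 0 <= m <= G x,
    gradsq s x <= 4 * s x * (G x - m) & - m - `|F x| * s x <= A x * s x])
  (G_ge0 : forall x, 0 <= G x) (G_int : integrable3 G)
  (s_decay : decays s)
  (th01 : 0 <= th < 1)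
  (F_small : forall f : sfun R, csupp f -> integrable3 (fun x => `|F x| * f x ^+ 2) /\
    I3 (fun x => `|F x| * f x ^+ 2) <= th * I3 (gradsq f)).

Section Level.
Variables (k : R) (k0 : 0 < k).

Definition level : sfun R := sfc k * s - 1.
Lemma levelE x : level x = k * s x - 1.
Proof. by rewrite /level sfD sfN sfM sfcE sf1. Qed.

Lemma d_level i : d i level = sfc k * d i s.
Proof. by rewrite /level dB d1 dM dc mul0r add0r subr0. Qed.

(** [beta 0] has derivative [beta 2] and [beta 1] has derivative [beta 3] - [beta 2]: the sum has
    the single nonnegative derivative [beta 3]. *)
Definition bump : sfun R := sfbeta 0 level + sfbeta 1 level.
Definition bump' : sfun R := sfbeta 3 level.

Lemma d_bump i : d i bump = bump' * (sfc k * d i s).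
Proof.
rewrite /bump dD !d_beta d_level -mulrDl; congr (_ * _).
by rewrite mulr0n subr0 mulr1n addrC subrK.
Qed.

Definition prim : sfun R := (level + sfc 2^-1) * sfbeta 0 level ^+ 2.

Lemma d_prim i : d i prim = bump ^+ 2 * (sfc k * d i s).
Proof.
rewrite /prim dM dD dc addr0 (expr2 (sfbeta 0 level)) dM d_beta mulr0n subr0 d_level.
apply: square_primitive; apply: sfun_eq => x.
- by rewrite (sfM level) !sfbetaE beta_mul.
- by rewrite (sfM (sfbeta 2 level)) sfX !sfbetaE beta_shift.
- by rewrite sfD !sfcE sf1 -[RHS](@divff _ 2)//; field.
Qed.

Lemma root_arg_gt0 x : 0 < (1 + sfc k * s : sfun R) x.
Proof. by rewrite sfD sf1 sfM sfcE ltr_wpDr// mulr_ge0// ltW. Qed.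
Definition root : sfun R := sfsqrt root_arg_gt0.

Lemma rootE x : root x ^+ 2 = 1 + k * s x.
Proof. by rewrite /root sfsqrtE sqr_sqrtr; [rewrite sfD sf1 sfM sfcE|exact/ltW/root_arg_gt0]. Qed.

Lemma root_gt0 x : 0 < root x.
Proof. by rewrite /root sfsqrtE sqrtr_gt0; exact: root_arg_gt0. Qed.

Lemma d_root i x : 2 * root x * d i root x = k * d i s x.
Proof.
have := sfun_eq_at (d_sqrt i root_arg_gt0) x.
by rewrite dD d1 add0r dM dc mul0r add0r (sfM (sfc k)) sfcE => <-; rewrite !sfM sfcE.
Qed.

(* The weight sqrt(1 + k s) is what makes |grad test|^2 - |F| test^2 bounded by a divergence, up to
   an error that vanishes as k -> oo; [prim] is a primitive of [bump ^+ 2]. *)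
Definition test : sfun R := root * bump.

Lemma test_grad x : gradsq test x = k ^+ 2 * gradsq s x *
  (bump x ^+ 2 / (4 * (1 + k * s x)) + bump x * bump' x + (1 + k * s x) * bump' x ^+ 2).
Proof.
have q0 := root_gt0 x.
have dfl i : d i test x = k * d i s x * (bump x / (2 * root x) + root x * bump' x).
  rewrite /test (dM i root bump) d_bump (sfD (d i root * bump)) !(sfM (d i root), sfM root, sfM bump', sfM (sfc k)) sfcE.
  have := d_root i x; move: (root x) (d i root x) (bump x) (bump' x) (d i s x) q0 => q dq b b' ds q0 e.
  rewrite -e; field; by rewrite gt_eqF.
rewrite (gradsqE test) (gradsqE s) (dfl o0) (dfl o1) (dfl o2) -(rootE x).
set z := bump x / (2 * root x).
have eb : bump x = 2 * root x * z by rewrite /z; field; rewrite gt_eqF.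
have ez : bump x ^+ 2 / (4 * root x ^+ 2) = z ^+ 2 by rewrite /z; field; rewrite gt_eqF.
rewrite ez eb {ez eb}; clearbody z.
by move: z (root x) (bump' x) (d o0 s x) (d o1 s x) (d o2 s x) => z q b' s0 s1 s2; ring.
Qed.

(** Twice the divergence part of |grad test|^2: transport by u is hidden in [prim], and
    [level_flux_int] makes the whole integrate to 0. *)
Definition level_flux : sfun R :=
  let rho := sfc k * bump ^+ 2 in
  Div (rho * d o0 s - prim * U o0) (rho * d o1 s - prim * U o1) (rho * d o2 s - prim * U o2).

Lemma level_fluxE x : level_flux x = 2 * (k ^+ 2 * (bump x * bump' x) * gradsq s x +
  k * bump x ^+ 2 * (A x * s x + G x)).
Proof.
rewrite /level_flux (@flux_potential_sfun _ _ divU _ _ _ (sfc k * (bump * bump' *+ 2) * sfc k)).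
- rewrite sfD (sfM (_ * sfc k)) (sfM (_ * (_ *+ 2))) (sfM (sfc k)) (sfMn (bump * bump')) (sfM bump).
  rewrite (sfM (sfc k * _)) (sfM (sfc k)) (sfX bump) sfcE (sfD (Lap s)) (sfN (Adv U s)) s_eq.
  rewrite (dotE s s x); move: (bump x) (bump' x) (A x) (s x) (G x) => b b' a S g.
  by move: (d o0 s x) (d o1 s x) (d o2 s x) => s0 s1 s2; ring.
- move=> i; rewrite dM dc mul0r add0r expr2 dM d_bump; exact: square_derivative.
- by move=> i; rewrite d_prim mulrA (mulrC (bump ^+ 2)).
Qed.

(** What the derivative of [bump] costs. It is dominated by a multiple of G uniformly in k, and
    tends to 0 pointwise as k grows: [beta 2] and [beta 3] decay where s > 0 and vanish where s =
    0. *)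
Definition level_err (x : 'rV[R]_3) : R := 8 * (beta 2 (level x) + beta 3 (level x)) ^+ 2 * G x.

Lemma test_energy x : gradsq test x <= 2^-1 * level_flux x + (k * level_err x + `|F x| * test x ^+ 2).
Proof.
rewrite test_grad level_fluxE mulKf// /level_err /test (sfM root) exprMn rootE.
have -> : bump x = beta 0 (level x) + beta 1 (level x) by rewrite /bump sfD !sfbetaE.
rewrite /bump' sfbetaE levelE.
have [t0|t0] := ltP 1 (k * s x); last first.
  have t1 : k * s x - 1 <= 0 by lra.
  rewrite !(beta_npos _ t1) addr0 expr0n /= !(mul0r, mulr0, addr0) //.
have s0 : 0 < s x by rewrite -(pmulr_rgt0 _ k0); lra.
have [m [mG hN hA]] := s_grad s0.
rewrite addrA; apply: (@energy_arith _ _ _ _ _ m) => //; rewrite ?gradsq_ge0 ?beta_ge0//.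
by rewrite beta_mul.
Qed.

Lemma bump_csupp : csupp bump.
Proof.
apply: (decays_csupp k0 s_decay) => x h.
rewrite /bump sfD !sfbetaE levelE !beta_npos ?addr0//; lra.
Qed.

Lemma prim_csupp : csupp prim.
Proof.
apply: (decays_csupp k0 s_decay) => x h.
rewrite /prim sfM sfX sfbetaE levelE beta_npos ?expr0n ?mulr0//; lra.
Qed.

Lemma level_flux_int : integrable3 level_flux /\ I3 level_flux = 0.
Proof.
have c i : csupp (sfc k * bump ^+ 2 * d i s - prim * U i : sfun R).
  apply: csuppD; first by apply: csuppM; apply: csuppMr; exact: csuppX bump_csupp.
  by apply: csuppN; apply: csuppM; exact: prim_csupp.
by apply: csupp_I3_div.
Qed.

Lemma level_err_bound x : `|level_err x| <= 8 * 31 ^+ 2 * G x.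
Proof.
rewrite ger0_norm /level_err; last by rewrite mulr_ge0// mulr_ge0// sqr_ge0.
apply: ler_wpM2r => //; apply: ler_wpM2l => //.
apply: lerXn2r; rewrite ?nnegrE ?addr_ge0 ?beta_ge0//.
have := beta_le 2 (level x); have := beta_le 3 (level x); rewrite -!natrX /=.
move: (beta _ _) (beta _ _) => a b; rewrite (_ : 3 ^ 3 = 27)%N// (_ : 2 ^ 2 = 4)%N//; lra.
Qed.

Lemma level_err_meas : meas3 level_err.
Proof.
apply: continuous_meas3.
exact: (sfun_continuous (f := sfc 8 * (sfbeta 2 level + sfbeta 3 level) ^+ 2 * G)).
Qed.

Lemma level_err_int : integrable3 level_err.
Proof.
exact: integrable3_le level_err_meas (integrable3Z (8 * 31 ^+ 2) G_int) level_err_bound.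
Qed.

Lemma test_csupp : csupp test.
Proof. by apply: csuppMr; exact: bump_csupp. Qed.

Lemma test_energy_bound : (1 - th) * I3 (gradsq test) <= k * I3 level_err.
Proof.
have [iF hF] := F_small test_csupp.
have [iT hT] := level_flux_int.
have iE := integrable3Z k level_err_int.
have iT2 := integrable3Z 2^-1 iT.
have := I3_le (csupp_sfun_integrable (csupp_gradsq test_csupp))
  (integrable3D iT2 (integrable3D iE iF)) test_energy.
rewrite (I3D iT2 (integrable3D iE iF)) (I3D iE iF) (I3Z _ iT) (I3Z _ level_err_int) hT.
by move: (I3 _) (I3 _) (I3 _) hF => a b c hF; lra.
Qed.

(** After division by k the squared test functions stay above a fixed function, positive exactly
    where k' s > 2: there (1 + k s) / k >= s >= 1 / k', and the level k s - 1 exceeds k' s - 2. *)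
Lemma test_lower (k' : R) x : 0 < k' <= k ->
  k'^-1 * (beta 0 1 * beta 0 (k' * s x - 2)) ^+ 2 <= k^-1 * test x ^+ 2.
Proof.
move=> /andP[k'0 kk].
have [t0|t0] := leP (k' * s x - 2) 0.
  by rewrite (beta_npos _ t0) mulr0 expr0n mulr0 mulr_ge0 ?sqr_ge0// invr_ge0 ltW.
rewrite /test (sfM root) [in leRHS]exprMn rootE [in leRHS]mulrA.
have ks : k' * s x <= k * s x by apply: ler_wpM2r.
apply: ler_pM; [by rewrite invr_ge0 ltW|exact: sqr_ge0| |].
  rewrite mulrDr mulrA mulVf ?gt_eqF// mul1r mulr1.
  apply: (@le_trans _ _ (s x)); last by rewrite lerDr invr_ge0 ltW.
  by rewrite -div1r ler_pdivrMr// mulrC; lra.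
apply: lerXn2r; rewrite ?nnegrE ?mulr_ge0 ?beta_ge0//.
  by rewrite /bump sfD !sfbetaE addr_ge0 ?beta_ge0.
rewrite -[leRHS]mulr1; apply: ler_pM; rewrite ?beta_ge0 ?beta0_le1//.
rewrite /bump sfD !sfbetaE; apply: (@le_trans _ _ (beta 0 (level x))); last by rewrite lerDl beta_ge0.
by apply: beta0_homo; rewrite levelE; lra.
Qed.

End Level.

(** Squared so that, once (n + 1) s >= 2, the level is at least n + 1 and the error decays like 1 /
    (n + 1). *)
Let scale n : R := n.+1%:R ^+ 2.
Let scale_gt0 n : 0 < scale n. Proof. by rewrite exprn_gt0. Qed.

Lemma level_err_to0 : I3 (level_err (scale n)) @[n --> \oo] --> (0 : R).
Proof.
apply: (I3_dct (g := fun x => 8 * 31 ^+ 2 * G x)).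
- by move=> n; exact: level_err_meas.
- exact: integrable3Z.
- by move=> n x; exact: level_err_bound.
move=> x; have := s_ge0 x; rewrite le_eqVlt => /orP[/eqP s0|s0].
  rewrite (_ : (fun n => _) = fun=> 0); first exact: cvg_cst.
  apply/funext => n; rewrite /level_err levelE -s0 mulr0 sub0r !beta_npos ?oppr_le0//.
  by rewrite addr0 expr0n mulr0 mul0r.
(* One factor of the square is bounded by 31 = 2^2 + 3^3, the other by 5 / t = (1 + 4) / t. *)
pose C := 8 * (31 * 5) * G x.
apply: (squeeze_cvgr (f := fun=> 0) (h := fun n => C * harmonic n)).
- near=> n.
  have n2 : 2 <= n.+1%:R * s x.
    rewrite -ler_pdivrMr//; apply: (@le_trans _ _ n%:R); last by rewrite ler_nat.
    near: n; exact: nbhs_infty_ger.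
  have t1 : n.+1%:R <= level (scale n) x.
    rewrite levelE /scale expr2 -mulrA; have := ler_wpM2l (ler0n R n.+1) n2.
    have : 1 <= n.+1%:R :> R by rewrite ler1n.
    move: (n.+1%:R * (_ * _)) => y; lra.
  have t0 : 0 < level (scale n) x by apply: lt_le_trans t1.
  rewrite /level_err; move: (level (scale n) x) t0 t1 => t t0 t1.
  have hb2 : beta 2 t <= t^-1 by have := @beta_leX R 1 1 t t0; rewrite !expr1 mul1r.
  have hb3 : beta 3 t <= 4 * t^-1 by have := @beta_leX R 2 1 t t0; rewrite expr1 -natrX.
  have ti : t^-1 <= n.+1%:R^-1 by rewrite lef_pV2// posrE.
  have b31 : beta 2 t + beta 3 t <= 31.
    have := beta_le 2 t; have := beta_le 3 t; rewrite -!natrX /=.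
    move: (beta _ _) (beta _ _) => a b; rewrite (_ : 3 ^ 3 = 27)%N// (_ : 2 ^ 2 = 4)%N//; lra.
  have hh : (beta 2 t + beta 3 t) ^+ 2 <= 31 * (5 * n.+1%:R^-1).
    rewrite expr2; apply: ler_pM; rewrite ?addr_ge0 ?beta_ge0//.
    by move: (n.+1%:R^-1) ti hb2 hb3 => y *; lra.
  rewrite mulr_ge0 ?mulr_ge0 ?addr_ge0 ?beta_ge0//= /C.
  rewrite [leRHS](_ : _ = 8 * (31 * (5 * n.+1%:R^-1)) * G x); last by move: (n.+1%:R^-1) => y; ring.
  by apply: ler_wpM2r => //; apply: ler_wpM2l.
- exact: cvg_cst.
- have := cvgMl_tmp (a := C) (@cvg_harmonic R); rewrite mulr0; exact.
Unshelve. all: by end_near.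
Qed.

(** Divided by k^3, the Sobolev inequality bounds the integral of (test^2 / k)^3 by the cube of a
    multiple of I3 of [level_err], which tends to 0. By [test_lower] the fixed function [g] then has
    I3 of g^6 equal to 0, for every m. *)
Lemma swirl_decay x : s x = 0.
Proof.
have [th0 th1] := andP th01.
have key m : forall x, beta 0 1 * beta 0 (scale m * s x - 2) = 0.
  pose g : sfun R := sfc (beta 0 1) * sfbeta 0 (sfc (scale m) * s - 1 *+ 2).
  have gE y : g y = beta 0 1 * beta 0 (scale m * s y - 2).
    by rewrite /g sfM sfcE sfbetaE sfD sfN sfM sfcE sfMn sf1.
  suff g0 y : (g ^+ 6 : sfun R) y = 0.
    by move=> y; have /eqP := g0 y; rewrite sfX expf_eq0 /= gE => /eqP.
  have cg : csupp g.
    apply: (decays_csupp (scale_gt0 m) s_decay) => z h.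
    rewrite gE (beta_npos 0 (t := _ - _)) ?mulr0//; lra.
  have ig : integrable3 (g ^+ 6 : sfun R) by apply: csupp_sfun_integrable; exact: csuppX.
  apply: (I3_eq0 (sfun_continuous (f := g ^+ 6 : sfun R))) => //.
    by move=> z; rewrite sfX exprn_even_ge0.
  pose a n := 8 ^+ 4 * ((1 - th)^-1 * I3 (level_err (scale n))) ^+ 3.
  have a0 : a n @[n --> \oo] --> (0 : R).
    have h : (1 - th)^-1 * I3 (level_err (scale n)) @[n --> \oo] --> (1 - th)^-1 * 0.
      exact: cvgMl_tmp level_err_to0.
    rewrite mulr0 in h.
    have := cvgMl_tmp (a := 8 ^+ 4) (cvgM h (cvgM h h)); rewrite !mulr0; exact.
  have J n : I3 (test (scale_gt0 n) ^+ 6 : sfun R) <= 8 ^+ 4 * I3 (gradsq (test (scale_gt0 n))) ^+ 3.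
    exact: sobolev_gagliardo_nirenberg (test_csupp (scale_gt0 n)).
  have L n : (m <= n)%N -> (scale m)^-1 ^+ 3 * I3 (g ^+ 6 : sfun R) <= a n.
    move=> mn; set f := test (scale_gt0 n).
    have i6 : integrable3 (f ^+ 6 : sfun R).
      by apply: csupp_sfun_integrable; apply: csuppX; exact: test_csupp.
    apply: (@le_trans _ _ ((scale n)^-1 ^+ 3 * I3 (f ^+ 6 : sfun R))).
      rewrite -(I3Z _ ig) -(I3Z _ i6); apply: I3_le; try exact: integrable3Z.
      move=> z; rewrite (sfX g) (sfX f) gE (exprM _ 2 3) (exprM _ 2 3) -!exprMn.
      have km : 0 < scale m <= scale n.
        by rewrite scale_gt0 /= lerXn2r ?nnegrE ?ler_nat.
      have h := test_lower (scale_gt0 n) z km.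
      by apply: lerXn2r => //; rewrite nnegrE mulr_ge0 ?sqr_ge0 ?invr_ge0// ltW.
    apply: (@le_trans _ _ ((scale n)^-1 ^+ 3 * (8 ^+ 4 * I3 (gradsq f) ^+ 3))).
      by apply: ler_wpM2l (J n); rewrite exprn_ge0// invr_ge0 ltW.
    rewrite mulrCA -exprMn /a; apply: ler_wpM2l; first by rewrite exprn_ge0.
    have E0 : 0 <= (scale n)^-1 * I3 (gradsq f).
      apply: mulr_ge0; first by rewrite invr_ge0 ltW.
      by apply: I3_ge0 => z; exact: gradsq_ge0.
    have E1 : (scale n)^-1 * I3 (gradsq f) <= (1 - th)^-1 * I3 (level_err (scale n)).
      have h := test_energy_bound (scale_gt0 n); rewrite -/f in h.
      rewrite [leRHS]mulrC ler_pdivlMr ?subr_gt0// -mulrA mulrC ler_pdivrMr//.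
      by rewrite mulrC [leRHS]mulrC.
    by apply: lerXn2r => //; rewrite nnegrE// (le_trans E0).
  have h0 : (scale m)^-1 ^+ 3 * I3 (g ^+ 6 : sfun R) <= 0.
    apply: (cvgr_to_ge a0); near=> n; apply: L; near: n; exact: nbhs_infty_ge.
  by rewrite pmulr_rle0 ?exprn_gt0 ?invr_gt0// in h0.
apply/eqP; rewrite eq_le s_ge0 andbT leNgt; apply/negP => s0.
(* Chosen so that [scale m * s x] > 2, where [g] would be positive. *)
pose m := Num.truncn (2 / s x).
have m2 : 2 < scale m * s x.
  have : 2 / s x < m.+1%:R by rewrite /m truncnS_gt.
  rewrite ltr_pdivrMr// => /lt_le_trans; apply.
  by apply: ler_wpM2r; [exact: ltW|rewrite /scale expr2 ler_peMr ?ler1n].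
have /eqP := key m x; rewrite mulf_eq0 !gt_eqF//; apply: beta_gt0 => //; lra.
Unshelve. all: by end_near.
Qed.

End SwirlDecay.

(** * Vanishing of the vorticity *)

Section CutoffBounds.
Context {R : realType}.
Variables (r : R) (r1 : 1 <= r).
Let r0 : 0 < r := lt_le_trans ltr01 r1.
Let w : sfun R := 1 - sfc (r ^- 2) * sqnorm.

Lemma d_sqnorm i : d i (@sqnorm R) = X i *+ 2.
Proof.
rewrite /sqnorm !expr2 dD dD !dM !dX.
by move: i; apply: ord3P; rewrite /= !(mul0r, mulr0, addr0, add0r, mul1r, mulr1, mulr2n).
Qed.

Let wE x : w x = 1 - r ^- 2 * sqnorm x.
Proof. by rewrite /w sfD sfN sfM sf1 sfcE. Qed.

Let dw i : d i w = - (sfc (r ^- 2) * (X i *+ 2)).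
Proof. by rewrite /w dB d1 dM dc mul0r !add0r d_sqnorm. Qed.

Let d_cut i : d i (cutoff r) = sfbeta 2 w * - (sfc (r ^- 2) * (X i *+ 2)).
Proof. by rewrite /cutoff -/w d_beta mulr0n subr0 dw. Qed.

Let b n x := beta n (w x).

Lemma d_cutoff i x : d i (cutoff r) x = - (2 * r ^- 2 * x 0 i * b 2 x).
Proof.
rewrite d_cut (sfM (sfbeta 2 w)) sfN (sfM (sfc _)) sfcE sfMn XE sfbetaE -/(b 2 x).
by move: (r ^- 2) (b 2 x) => a c; ring.
Qed.

Let dd_cutoff i x : d i (d i (cutoff r)) x =
  4 * (r ^- 2) ^+ 2 * x 0 i ^+ 2 * (b 4 x - 2 * b 3 x) - 2 * r ^- 2 * b 2 x.
Proof.
rewrite d_cut dM dN dM dc mul0r add0r dMn dX eqxx d_beta dw.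
rewrite sfD (sfM _ (- _)) (sfM (sfbeta 2 w) (- _)) (sfM _ (- _)).
rewrite (sfN (sfc _ * (X i *+ 2))) (sfN (sfc _ * (1 *+ 2))) (sfM (sfc _) (X i *+ 2)) (sfM (sfc _) (1 *+ 2)).
rewrite (sfD (sfbeta 4 w)) sfN !sfMn XE sf1 sfcE !sfbetaE -!/(b _ x).
by move: (r ^- 2) (b 2 x) (b 3 x) (b 4 x) => a b2 b3 b4; ring.
Qed.

Let lap_cutoff x : Lap (cutoff r) x =
  r ^- 2 * (4 * (r ^- 2 * sqnorm x) * (b 4 x - 2 * b 3 x) - 6 * b 2 x).
Proof.
rewrite lapE !dd_cutoff sqnormE.
by move: (r ^- 2) (b 2 x) (b 3 x) (b 4 x) => a b2 b3 b4; ring.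
Qed.

Lemma cutoff_ge0 x : 0 <= cutoff r x. Proof. by rewrite cutoffE beta_ge0. Qed.
Lemma cutoff_le1 x : cutoff r x <= 1. Proof. by rewrite cutoffE beta0_le1. Qed.

(** The factor [sqr_r x] is what compensates the second weight 1/(r^2 + e) in the weighted flux. The
    constant is 2 times the bound 4 on [beta 2]. *)
Lemma eul_cutoff x : `|Eul (cutoff r) x| <= 8 * r ^- 2 * sqr_r x.
Proof.
have -> : Eul (cutoff r) x = - (2 * r ^- 2 * b 2 x * sqr_r x).
  rewrite eul_at !d_cutoff /sqr_r; move: (r ^- 2) (b 2 x) => a c; ring.
have a0 : 0 <= r ^- 2 by rewrite invr_ge0 exprn_ge0// ltW.
have b2 := beta_le 2 (w x); rewrite -natrX -/(b 2 x) in b2.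
rewrite normrN ger0_norm; last by rewrite !mulr_ge0 ?beta_ge0 ?sqr_r_ge0.
apply: ler_wpM2r; first exact: sqr_r_ge0.
rewrite mulrAC; apply: ler_wpM2r => //.
by rewrite (_ : (2 ^ 2)%N = 4%N) // in b2; lra.
Qed.

Variables (U : 'I_3 -> sfun R) (M : R).
Hypothesis U_le : forall i x, `|U i x| <= M.

(** On the support |x_i| <= r. Then [beta 4] <= 4^4 and [beta 3] <= 3^3 keep [beta 4] - 2 [beta 3]
    below 8^3, while [beta 2] <= 4 gives 6 * 4 = 24 for the Laplacian and 2 * 4 * 3 M for the
    transport. *)
Lemma cutoff_flux_le x : `|Lap (cutoff r) x + Adv U (cutoff r) x| <= (4 * 8 ^+ 3 + 24 + 24 * M) / r.
Proof.
have M0 : 0 <= M by apply: (le_trans _ (U_le o0 x)).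
have K0 : 0 <= (4 * 8 ^+ 3 + 24 + 24 * M) / r.
  apply: mulr_ge0; last by rewrite invr_ge0 ltW.
  by apply: addr_ge0; [apply: addr_ge0 => //; apply: mulr_ge0 => //; exact: exprn_ge0|exact: mulr_ge0].
have [w0|w0] := leP (w x) 0.
  by rewrite lap_cutoff advE !d_cutoff /b !(beta_npos _ w0) !(mulr0, subr0, oppr0, addr0) normr0.
have q1 : r ^- 2 * sqnorm x <= 1 by move: w0; rewrite wE; lra.
have xr : sqnorm x <= r ^+ 2.
  by move: q1; rewrite mulrC ler_pdivrMr ?exprn_gt0// mul1r.
have xi i : `|x 0 i| <= r by apply: coord_le_sqnorm => //; exact: ltW.
have ri0 : 0 < r^-1 by rewrite invr_gt0.
have ri1 : r^-1 <= 1 by rewrite invf_le1.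
have q0 : 0 <= r ^- 2 * sqnorm x.
  apply: mulr_ge0; first by rewrite invr_ge0 exprn_ge0// ltW.
  by rewrite sqnormE !addr_ge0 ?sqr_ge0.
have b2 := beta_le 2 (w x); have b3 := beta_le 3 (w x); have b4 := beta_le 4 (w x).
have b20 := beta_ge0 2 (w x); have b30 := beta_ge0 3 (w x); have b40 := beta_ge0 4 (w x).
have hU i : `|U i x * (r^-1 * x 0 i)| <= M.
  rewrite normrM -[leRHS]mulr1; apply: ler_pM => //.
  by rewrite normrM gtr0_norm// mulrC ler_pdivrMr// mul1r.
have hL : `|4 * (r ^- 2 * sqnorm x) * (b 4 x - 2 * b 3 x) - 6 * b 2 x| <= 4 * 8 ^+ 3 + 24.
  have hD : `|b 4 x - 2 * b 3 x| <= 8 ^+ 3.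
    by rewrite ler_norml; apply/andP; split; rewrite /b; lra.
  apply: (le_trans (ler_normB _ _)).
  apply: lerD; last first.
    by rewrite normrM ger0_norm// ger0_norm//; rewrite /b; lra.
  rewrite normrM; apply: ler_pM => //.
  by move: (r ^- 2 * _) q0 q1 => q q0 q1; rewrite ger0_norm ?mulr_ge0//; lra.
have -> : Lap (cutoff r) x + Adv U (cutoff r) x =
  r^-1 * (r^-1 * (4 * (r ^- 2 * sqnorm x) * (b 4 x - 2 * b 3 x) - 6 * b 2 x) -
   2 * b 2 x * (U o0 x * (r^-1 * x 0 o0) + U o1 x * (r^-1 * x 0 o1) + U o2 x * (r^-1 * x 0 o2))).
  rewrite lap_cutoff advE !d_cutoff.
  move: (sqnorm x) (b 2 x) (b 3 x) (b 4 x) (U o0 x) (U o1 x) (U o2 x) (x 0 o0) (x 0 o1) (x 0 o2) => *.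
  rewrite -exprVn; move: r^-1 => y; ring.
rewrite normrM gtr0_norm// mulrC; apply: ler_wpM2r; first exact: ltW.
apply: (le_trans (ler_normB _ _)); apply: lerD.
  rewrite normrM gtr0_norm// -[leRHS]mul1r; apply: ler_pM => //; exact: ltW.
rewrite normrM ger0_norm ?mulr_ge0 ?beta_ge0//.
apply: (@le_trans _ _ (2 * 4 * (M + M + M))); last by lra.
apply: ler_pM => //; first by rewrite mulr_ge0 ?beta_ge0.
  by rewrite /b; lra.
by do 2! (apply: (le_trans (ler_normD _ _)); apply: lerD => //).
Qed.

Lemma cutoff_homo (r' : R) x : r <= r' -> cutoff r x <= cutoff r' x.
Proof.
move=> rr; rewrite !cutoffE; apply: beta0_homo; rewrite lerD2l lerN2.
apply: ler_wpM2r; first by rewrite sqnormE !addr_ge0 ?sqr_ge0.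
by rewrite lef_pV2 ?posrE ?exprn_gt0 ?(lt_le_trans r0)// lerXn2r ?nnegrE ?(le_trans _ rr)// ltW.
Qed.

End CutoffBounds.

(** * Pointwise inequalities for the vorticity *)

Section VorticityArithmetic.
Context {R : realType}.

(** Young's inequality for a = r u_r: near the axis the stretching takes at most half of the Hardy
    term. *)
Lemma radial_le (r2 a M : R) : a ^+ 2 <= 2 * M ^+ 2 * r2 -> a <= 2^-1 + M ^+ 2 * r2.
Proof.
move=> h; have := sqr_ge0 (a - 1).
rewrite (_ : (a - 1) ^+ 2 = a ^+ 2 - 2 * a + 1); last by ring.
by move: (M ^+ 2 * r2) (mulrA 2 (M ^+ 2) r2) h => y <- h; lra.
Qed.

(** By S <= r^2 H and [radial_le], H - a S / r^2 is at least S / (2 r^2) - M^2 S; the factor 2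
    restores S / r^2. *)
Lemma green_arith (r2 a M S H VG chi L K : R) : 0 < r2 -> a ^+ 2 <= 2 * M ^+ 2 * r2 -> 0 <= S ->
  S <= r2 * H -> 0 <= VG -> 0 <= chi <= 1 -> `|L| <= K ->
  chi * (S / r2) <= chi * (2 * (- a / r2 * S + H + VG)) - S * L + (2 * M ^+ 2 + K) * S.
Proof.
move=> r0 /radial_le ha S0 hH VG0 /andP[c0 c1] hL.
have ir0 : 0 < r2^-1 by rewrite invr_gt0.
have h1 : S / r2 <= 2 * (- a / r2 * S + H + VG) + 2 * M ^+ 2 * S.
  have e : r2^-1 * r2 = 1 by rewrite mulVf// gt_eqF.
  apply: (@le_trans _ _ (2 * (- a / r2 * S + r2^-1 * S + 0) + 2 * M ^+ 2 * S)).
    have := ler_wpM2l (mulr_ge0 S0 (ltW ir0)) ha.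
    rewrite (_ : S / r2 * (2^-1 + M ^+ 2 * r2) = 2^-1 * (S / r2) + M ^+ 2 * S * (r2^-1 * r2)); last by ring.
    rewrite e mulr1 -[- a / r2 * S]mulrA mulNr (_ : a * (r2^-1 * S) = S / r2 * a); last by ring.
    by rewrite (mulrC r2^-1 S) -(mulrA 2 (M ^+ 2)); move: (S / r2 * a) (S / r2) (M ^+ 2 * S) => *; lra.
  rewrite lerD2r ler_pM2l// lerD// lerD2l.
  by rewrite mulrC ler_pdivrMr// mulrC.
have h2 : S * L <= K * S by rewrite mulrC ler_wpM2r// (le_trans (ler_norm _)).
have := ler_wpM2l c0 h1; rewrite mulrDr.
have : chi * (2 * M ^+ 2 * S) <= 2 * M ^+ 2 * S.
  rewrite -[leRHS]mul1r ler_wpM2r//; do 2! apply: mulr_ge0 => //.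
    exact: sqr_ge0.
move: (chi * (S / r2)) (chi * (2 * (- a / r2 * S + H + VG))) => y z.
by rewrite mulrDl; lra.
Qed.

(** Here c = 1/(r^2 + e), [Es] = [Eul S] and [E] = [Eul chi]. The derivative [Es] of the flux
    cancels against the lower bound for H, so that everything on the last line is S / r^2 times a
    factor that is small off the axis when e, K and rho are. *)
Lemma weighted_arith (r2 c e a M S H VG chi L K E Es rho : R) : 0 < r2 -> 0 < e ->
  c * (r2 + e) = 1 -> a ^+ 2 <= 2 * M ^+ 2 * r2 -> 0 <= S ->
  c * r2 * Es + (1 - c ^+ 2 * r2 ^+ 2) * S <= r2 * H ->
  0 <= chi <= 1 -> `|L| <= K -> `|E| <= 8 * rho * r2 ->
  2 * (chi * c * VG) <= (chi * c * (2 * (- a / r2 * S + H + VG)) - S * c * L + c * c * S * E *+ 2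
    + chi * (c * c) * a * S *+ 2 - chi * (c * c) * Es *+ 2) +
  (2 * M ^+ 2 * (e * c) * (S / r2) + (K + 16 * rho) * (S / r2)).
Proof.
move=> r0 e0 hc /radial_le ha S0 hH /andP[c0 c1] hL hE.
have re0 : 0 < r2 + e by rewrite addr_gt0.
have cp : 0 < c by rewrite -(pmulr_lgt0 _ re0) hc.
set h := S / r2.
have Sh : S = r2 * h by rewrite /h mulrCA mulfV ?mulr1// gt_eqF.
have h0 : 0 <= h by rewrite /h divr_ge0// ltW.
have cr : c * r2 <= 1 by rewrite -hc ler_wpM2l ?ltW// ltrDl.
have cr0 : 0 <= c * r2 by rewrite mulr_ge0 ?ltW.
have cS : c * S <= h by rewrite Sh mulrA -[leRHS]mul1r ler_wpM2r.
have cS0 : 0 <= c * S by rewrite mulr_ge0// ltW.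
have hH' : c * Es + (1 - c ^+ 2 * r2 ^+ 2) * h <= H.
  rewrite -(ler_pM2l r0); apply: le_trans hH.
  by rewrite Sh [leLHS](_ : _ = c * r2 * Es + (1 - c ^+ 2 * r2 ^+ 2) * (r2 * h))//; ring.
have ec : e * c = 1 - c * r2 by rewrite -hc; ring.
have aS : - a / r2 * S = - (a * h) by rewrite Sh; field; rewrite gt_eqF.
(* (1 - c^2 r^4) - a (1 - c r^2) = e c (1 + c r^2 - a) >= - M^2 e c r^2 *)
have main : - (2 * M ^+ 2 * (e * c) * h) <=
    chi * (c * (2 * (- a / r2 * S + H)) + c * c * a * S *+ 2 - c * c * Es *+ 2).
  have k1 : c * Es + (1 - c ^+ 2 * r2 ^+ 2) * h - a * h + c * a * S - c * Es <=
     - a / r2 * S + H + c * a * S - c * Es by rewrite aS; lra.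
  have k2 : - (M ^+ 2 * r2 * (e * c) * h) <=
    c * Es + (1 - c ^+ 2 * r2 ^+ 2) * h - a * h + c * a * S - c * Es.
    rewrite Sh (_ : _ - c * Es = (1 - c * r2) * h * (1 + c * r2 - a)); last by ring.
    rewrite -ec (_ : M ^+ 2 * r2 * _ * h = e * c * h * (M ^+ 2 * r2)); last by ring.
    rewrite -mulrN; apply: ler_wpM2l; first by apply: mulr_ge0 => //; exact/ltW/mulr_gt0.
    by move: (M ^+ 2 * r2) (c * r2) cr0 ha => y z z0 ha; lra.
  have k3 := le_trans k2 k1.
  have p0 : 0 <= M ^+ 2 * (e * c) * h.
    by apply: mulr_ge0 => //; apply: mulr_ge0; [exact: sqr_ge0|exact/ltW/mulr_gt0].
  have k4 : - (M ^+ 2 * (e * c) * h) <= c * (- a / r2 * S + H + c * a * S - c * Es).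
    apply: le_trans (ler_wpM2l (ltW cp) k3).
    rewrite (_ : c * _ = - (c * r2 * (M ^+ 2 * (e * c) * h))); last by ring.
    by rewrite lerN2 -[leRHS]mul1r; apply: ler_wpM2r => //.
  have k5 : - (M ^+ 2 * (e * c) * h) <= chi * (c * (- a / r2 * S + H + c * a * S - c * Es)).
    apply: (@le_trans _ _ (chi * - (M ^+ 2 * (e * c) * h))); last exact: ler_wpM2l.
    by rewrite mulrN lerN2 -[leRHS]mul1r ler_wpM2r.
  rewrite (_ : chi * _ = 2 * (chi * (c * (- a / r2 * S + H + c * a * S - c * Es)))); last by ring.
  by move: k5; rewrite -!mulrA; lra.
have e1 : S * c * L <= K * h.
  rewrite mulrC [S * c]mulrC; apply: (@le_trans _ _ (K * (c * S))).
    by rewrite ler_wpM2r// (le_trans (ler_norm _)).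
  by rewrite ler_wpM2l// (le_trans _ hL).
have e2 : - (8 * rho * h) <= c * c * S * E.
  have : `|c * c * S * E| <= 8 * rho * h.
    rewrite normrM ger0_norm; last by rewrite -mulrA mulr_ge0// ltW.
    have E0 : 0 <= 8 * rho * r2 by rewrite (le_trans _ hE).
    apply: (@le_trans _ _ (c * c * S * (8 * rho * r2))).
      by apply: ler_wpM2l => //; rewrite -mulrA mulr_ge0// ltW.
    have r0' : 0 <= 8 * rho by move: E0; rewrite pmulr_lge0.
    rewrite (_ : _ * _ = (8 * rho) * (c * r2 * (c * S))); last by ring.
    apply: ler_wpM2l => //; apply: le_trans cS; rewrite -[leRHS]mul1r.
    by apply: ler_wpM2r.
  by rewrite ler_norml => /andP[].
rewrite -subr_ge0 (_ : _ - _ =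
 (chi * (c * (2 * (- a / r2 * S + H)) + c * c * a * S *+ 2 - c * c * Es *+ 2) -
  - (2 * M ^+ 2 * (e * c) * h)) + (K * h - S * c * L) + 2 * (c * c * S * E - - (8 * rho * h))).
  by apply: addr_ge0; [apply: addr_ge0|apply: mulr_ge0 => //]; rewrite subr_ge0.
by move: (- a / r2 * S) => z; ring.
Qed.

End VorticityArithmetic.

(** * Regularised division by r^2 *)

Section AxisQuotients.
Context {R : realType}.
Implicit Types f : sfun R.

Section Weight.
Variables (e : R) (e0 : 0 < e).

Lemma weight_neq0 x : (RR + sfc e : sfun R) x != 0.
Proof. by rewrite sfD sqr_rE sfcE gt_eqF// ltr_wpDl// sqr_r_ge0. Qed.

Definition weight : sfun R := sfinv weight_neq0.

Lemma weightE x : weight x = (sqr_r x + e)^-1.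
Proof. by rewrite /weight sfinvE sfD sqr_rE sfcE. Qed.

Lemma weightK x : weight x * (sqr_r x + e) = 1.
Proof. by rewrite weightE mulVf// gt_eqF// ltr_wpDl// sqr_r_ge0. Qed.

Lemma weight_gt0 x : 0 < weight x.
Proof. by rewrite weightE invr_gt0 ltr_wpDl// sqr_r_ge0. Qed.

Lemma d_weight : [/\ d o0 weight = - (weight * weight * X o0 *+ 2),
  d o1 weight = - (weight * weight * X o1 *+ 2) & d o2 weight = 0].
Proof.
have [r0 r1 r2] := @d_RR R.
have dw i : d i weight = - (weight * weight * d i RR).
  by rewrite /weight d_inv dD dc addr0 expr2.
by rewrite !dw r0 r1 r2 mulr0 oppr0 !mulrnAr.
Qed.

End Weight.

Lemma weight_homo (e e' : R) (e0 : 0 < e) (e0' : 0 < e') x : e' <= e -> weight e0 x <= weight e0' x.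
Proof.
move=> ee; have r0 := sqr_r_ge0 x; rewrite !weightE lef_pV2 ?posrE ?lerD2l//; exact: ltr_wpDl.
Qed.

Let eps n : R := n.+1%:R^-1.
Let eps_gt0 n : 0 < eps n. Proof. by rewrite invr_gt0. Qed.

Lemma weight_cvg x : 0 < sqr_r x -> weight (eps_gt0 n) x @[n --> \oo] --> (sqr_r x)^-1.
Proof.
move=> r0; rewrite (_ : (fun n => _) = fun n => (sqr_r x + harmonic n)^-1); last first.
  by apply/funext => n; rewrite weightE.
apply: cvgV; first by rewrite gt_eqF.
rewrite -[X in _ --> X]addr0; apply: cvgD; [exact: cvg_cst|exact: cvg_harmonic].
Qed.

(** A pointwise limit of the continuous functions f / (r^2 + e); on the axis both sides are 0. *)
Lemma meas3_quotient f : (forall x, sqr_r x = 0 -> f x = 0) -> meas3 (fun x => f x / sqr_r x).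
Proof.
move=> f0.
have mf n : meas3 (fun x => f x * weight (eps_gt0 n) x).
  exact: continuous_meas3 (sfun_continuous (f := f * weight (eps_gt0 n))).
apply: (measurable_fun_cvg mf).
move=> q _; have := sqr_r_ge0 (pt3 q); rewrite le_eqVlt => /orP[/eqP r0|r0].
  rewrite f0 -?r0// mul0r (_ : (fun n => _) = fun=> 0); first exact: cvg_cst.
  by apply/funext => n; rewrite mul0r.
by apply: cvgMl_tmp; exact: weight_cvg.
Qed.

(** Monotone convergence with a factor c, since the cut-offs increase to [beta 0 1] = 1/e and not to
    1. *)
Lemma integrable3_monotone (F : nat -> 'rV[R]_3 -> R) (h : 'rV[R]_3 -> R) (c K : R) : 0 < c ->
  (forall n, integrable3 (F n)) -> (forall n x, 0 <= F n x) ->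
  (forall x, {homo F^~ x : m n / (m <= n)%N >-> m <= n}) -> (forall n, I3 (F n) <= K) ->
  meas3 h -> (forall x, 0 <= h x) -> (forall x, \forall n \near \oo, c * h x <= F n x) ->
  integrable3 h.
Proof.
move=> c0 iF F0 Fhomo FK mh h0 hF.
suff i : integrable3 (fun x => c * h x).
  rewrite (_ : h = fun x => c^-1 * (c * h x)); first exact: integrable3Z.
  by apply/funext => x; rewrite mulrA mulVf ?mul1r// gt_eqF.
have mch : meas3 (fun x => c * h x) by apply: measurable_funM => //; exact: measurable_cst.
apply: integrable3_fin => //; first by move=> x; rewrite mulr_ge0// ltW.
have mF n : measurable_fun setT (fun q => (F n (pt3 q))%:E).
  by apply/measurable_EFinP; exact: integrable3_meas.
have F0' n q : setT q -> (0 <= (F n (pt3 q))%:E)%E by rewrite lee_fin.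
have Fh' q : setT q -> {homo (fun n => (F n (pt3 q))%:E) : m n / (m <= n)%N >-> (m <= n)%E}.
  by move=> _ m n mn; rewrite lee_fin; exact: Fhomo.
have cv := cvg_monotone_convergence measurableT mF F0' Fh' (mu := @leb3 R).
apply: (@le_lt_trans _ _ K%:E); last exact: ltry.
apply: (@le_trans _ _ (\int[@leb3 R]_q limn (fun n => (F n (pt3 q))%:E))%E).
  apply: ge0_le_integral => //.
  - by move=> q _; rewrite lee_fin mulr_ge0// ltW.
  - by apply/measurable_EFinP.
  - apply: (emeasurable_fun_cvg (fun n q => (F n (pt3 q))%:E)) => // q _.
    by apply: ereal_nondecreasing_is_cvgn; exact: Fh'.
  - move=> q _; apply: lime_ge.
      by apply: ereal_nondecreasing_is_cvgn; exact: Fh'.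
    by have := hF (pt3 q); apply: filterS => n; rewrite lee_fin.
rewrite -(cvg_lim _ cv)//; apply: lime_le; first by apply/cvg_ex; eexists; exact: cv.
by near=> n; rewrite -I3E// lee_fin.
Unshelve. all: by end_near.
Qed.

End AxisQuotients.

(** * Integral estimates for the squared vorticity *)

Section VorticityDecay.
Context {R : realType}.
Variables (U : 'I_3 -> sfun R) (a b : sfun R) (M : R).
Hypotheses (divU : Div (U o0) (U o1) (U o2) = 0) (U_le : forall i x, `|U i x| <= M)
  (ra : Rot a = - b) (rb : Rot b = a).
Let S : sfun R := Hsq a b.
Hypotheses (S_eq : forall x, Lap S x - Adv U S x =
    2 * (- Rad U x / sqr_r x * S x + Hgrad a b x + Vgrad a b x))
  (S_int : integrable3 S).

Let S_ge0 x : 0 <= S x. Proof. exact: hsq_ge0. Qed.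
Let S_axis x : sqr_r x = 0 -> S x = 0.
Proof. by move=> /(horizontal_axis ra rb)[a0 b0]; rewrite /S hsqE a0 b0 expr0n addr0. Qed.
Let M_ge0 : 0 <= M. Proof. by apply: (le_trans _ (U_le o0 0)). Qed.

Lemma rad_sq_le x : Rad U x ^+ 2 <= 2 * M ^+ 2 * sqr_r x.
Proof.
have h i : U i x ^+ 2 <= M ^+ 2.
  by rewrite -[U i x ^+ 2]real_normK ?num_real// lerXn2r ?nnegrE.
rewrite radE /sqr_r; have := h o0; have := h o1.
move: (U o0 x) (U o1 x) (x 0 o0) (x 0 o1) => u0 u1 x0 x1 h1 h0.
apply: (@le_trans _ _ ((u0 ^+ 2 + u1 ^+ 2) * (x0 ^+ 2 + x1 ^+ 2))).
  rewrite -subr_ge0 (_ : _ - _ = (x0 * u1 - x1 * u0) ^+ 2); last by ring.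
  exact: sqr_ge0.
by apply: ler_wpM2r; [rewrite addr_ge0 ?sqr_ge0|lra].
Qed.

Definition quot (x : 'rV[R]_3) : R := S x / sqr_r x.

Lemma quot_ge0 x : 0 <= quot x.
Proof. by rewrite /quot divr_ge0 ?sqr_r_ge0. Qed.

Lemma quot_meas : meas3 quot.
Proof. exact: meas3_quotient. Qed.

Let K : R := 4 * 8 ^+ 3 + 24 + 24 * M.
Let K_ge0 : 0 <= K.
Proof. by rewrite /K; do ?apply: addr_ge0 => //; apply: mulr_ge0. Qed.

Let rad n : R := n.+1%:R.
Let rad_ge1 n : 1 <= rad n. Proof. by rewrite /rad ler1n. Qed.
Let rad_gt0 n : 0 < rad n. Proof. by []. Qed.
Let chi n : sfun R := cutoff (rad n).
Let chi_csupp n : csupp (chi n). Proof. exact: csupp_cutoff. Qed.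
Let chi_ge0 n x : 0 <= chi n x. Proof. exact: cutoff_ge0. Qed.
Let chi_le1 n x : chi n x <= 1. Proof. exact: cutoff_le1. Qed.
Let chi_homo x : {homo (fun n => chi n x) : m n / (m <= n)%N >-> m <= n}.
Proof. by move=> m n mn; apply: cutoff_homo => //; rewrite ler_nat. Qed.

Let chi_flux n x : `|Lap (chi n) x + Adv U (chi n) x| <= K.
Proof.
apply: (le_trans (cutoff_flux_le (rad_ge1 n) U_le x)).
by rewrite ler_pdivrMr// -/K ler_peMr.
Qed.

Let flux1 n : sfun R :=
  Div (chi n * d o0 S - S * d o0 (chi n) - S * chi n * U o0)
    (chi n * d o1 S - S * d o1 (chi n) - S * chi n * U o1)
    (chi n * d o2 S - S * d o2 (chi n) - S * chi n * U o2).

Let flux1_int n : integrable3 (flux1 n) /\ I3 (flux1 n) = 0.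
Proof.
have c i : csupp (chi n * d i S - S * d i (chi n) - S * chi n * U i : sfun R).
  have cc := chi_csupp n.
  apply: csuppD; first apply: csuppD; first exact: csuppM.
    by apply: csuppN; apply: csuppMr; exact: csupp_d.
  by apply: csuppN; apply: csuppM; exact: csuppMr.
by apply: csupp_I3_div.
Qed.

Let quot_le n x : chi n x * quot x <= flux1 n x + (2 * M ^+ 2 + K) * S x.
Proof.
have e : flux1 n x = chi n x * (2 * (- Rad U x / sqr_r x * S x + Hgrad a b x + Vgrad a b x)) -
    S x * (Lap (chi n) x + Adv U (chi n) x).
  exact: etrans (sfun_eq_at (flux_green_sfun divU S (chi n)) x)
    (congr1 (fun y => chi n x * y - S x * (Lap (chi n) x + Adv U (chi n) x)) (S_eq x)).
rewrite e {e}.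
have := sqr_r_ge0 x; rewrite le_eqVlt => /orP[/eqP/esym r0|r0].
  rewrite /quot S_axis// !(mul0r, mulr0, add0r, addr0, subr0).
  by do 2! apply: mulr_ge0 => //; rewrite addr_ge0 ?hgrad_ge0 ?vgrad_ge0.
apply: green_arith => //; rewrite ?chi_ge0 ?chi_le1 ?rad_sq_le ?vgrad_ge0//.
have := hgrad_lower ra rb x 0.
by rewrite expr0n /= !mul0r add0r subr0 mul1r.
Qed.

Let chiM_meas n (f : 'rV[R]_3 -> R) : meas3 f -> meas3 (fun x => chi n x * f x).
Proof.
by move=> mf; apply: measurable_funM => //; exact: (continuous_meas3 (sfun_continuous (f := chi n))).
Qed.

Let quot_chi_int n : integrable3 (fun x => chi n x * quot x) /\
  I3 (fun x => chi n x * quot x) <= (2 * M ^+ 2 + K) * I3 S.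
Proof.
have [i1 e1] := flux1_int n.
have iC := integrable3Z (2 * M ^+ 2 + K) S_int.
have i : integrable3 (fun x => chi n x * quot x).
  apply: (integrable3_le (chiM_meas n quot_meas) (integrable3D i1 iC)) => x.
  rewrite ger0_norm; [exact: quot_le|by apply: mulr_ge0; [exact: chi_ge0|exact: quot_ge0]].
split=> //; apply: (le_trans (I3_le i (integrable3D i1 iC) (quot_le n))).
by rewrite (I3D i1 iC) e1 add0r (I3Z _ S_int).
Qed.

Let chi_near x : \forall n \near \oo, beta 0 2^-1 <= chi n x.
Proof.
have q0 : 0 <= sqnorm x by rewrite sqnormE !addr_ge0 ?sqr_ge0.
near=> n; rewrite /chi cutoffE; apply: beta0_homo.
suff : rad n ^- 2 * sqnorm x <= 2^-1 by move: (rad n ^- 2 * _) => y; lra.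
rewrite mulrC ler_pdivrMr ?exprn_gt0//.
have : 2 * sqnorm x <= rad n.
  apply: (@le_trans _ _ n%:R); last by rewrite ler_nat.
  near: n; exact: nbhs_infty_ger.
have : rad n <= rad n ^+ 2 by rewrite expr2 ler_peMr.
by move: (rad n ^+ 2) (rad n) => y z; lra.
Unshelve. all: by end_near.
Qed.

Lemma quot_int : integrable3 quot.
Proof.
apply: (@integrable3_monotone _ (fun n x => chi n x * quot x) quot (beta 0 2^-1) ((2 * M ^+ 2 + K) * I3 S)).
- exact: beta_gt0.
- by move=> n; have [] := quot_chi_int n.
- by move=> n x; rewrite mulr_ge0 ?chi_ge0 ?quot_ge0.
- by move=> x m n mn; apply: ler_wpM2r; [exact: quot_ge0|exact: chi_homo].
- by move=> n; have [] := quot_chi_int n.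
- exact: quot_meas.
- exact: quot_ge0.
- move=> x; have := chi_near x; apply: filterS => n h.
  by apply: ler_wpM2r => //; exact: quot_ge0.
Qed.

Let eps n : R := (rad n)^-1.
Let eps_gt0 n : 0 < eps n. Proof. by rewrite invr_gt0. Qed.
Let eps_le1 n : eps n <= 1. Proof. by rewrite invf_le1. Qed.
Let eps_cvg : eps n @[n --> \oo] --> (0 : R). Proof. exact: cvg_harmonic. Qed.
Let c n : sfun R := weight (eps_gt0 n).
Let c_gt0 n x : 0 < c n x. Proof. exact: weight_gt0. Qed.

Let flux2 n : sfun R :=
  Div (chi n * c n * d o0 S - S * d o0 (chi n * c n) - S * (chi n * c n) * U o0
      - chi n * (c n * c n) * X o0 * S *+ 2)
    (chi n * c n * d o1 S - S * d o1 (chi n * c n) - S * (chi n * c n) * U o1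
      - chi n * (c n * c n) * X o1 * S *+ 2)
    (chi n * c n * d o2 S - S * d o2 (chi n * c n) - S * (chi n * c n) * U o2).

Let flux2_int n : integrable3 (flux2 n) /\ I3 (flux2 n) = 0.
Proof.
have cc : csupp (chi n * c n : sfun R) by apply: csuppM; exact: chi_csupp.
have k i : csupp (chi n * c n * d i S - S * d i (chi n * c n) - S * (chi n * c n) * U i : sfun R).
  apply: csuppD; first apply: csuppD; first exact: csuppM.
    by apply: csuppN; apply: csuppMr; exact: csupp_d.
  by apply: csuppN; apply: csuppM; exact: csuppMr.
have l i : csupp (- (chi n * (c n * c n) * X i * S *+ 2) : sfun R).
  have h : csupp (chi n * (c n * c n) * X i * S : sfun R) by do 3! apply: csuppM; exact: chi_csupp.
  by rewrite mulr2n; apply: csuppN; exact: csuppD.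
by apply: csupp_I3_div => //; exact: csuppD.
Qed.

(** Dominated by a multiple of the integrable [quot], and tending to 0 pointwise: off the axis eps /
    (r^2 + eps) tends to 0, on the axis [quot] is 0. *)
Let err2 n x : R := 2 * M ^+ 2 * (eps n * c n x) * quot x + (K / rad n + 16 * rad n ^- 2) * quot x.

Let vgrad_le n x : 2 * (chi n x * c n x * Vgrad a b x) <= flux2 n x + err2 n x.
Proof.
have [w0 w1 w2] := d_weight (eps_gt0 n).
have e : flux2 n x = chi n x * c n x * (2 * (- Rad U x / sqr_r x * S x + Hgrad a b x + Vgrad a b x)) -
    S x * c n x * (Lap (chi n) x + Adv U (chi n) x) + c n x * c n x * S x * Eul (chi n) x *+ 2 +
    chi n x * (c n x * c n x) * Rad U x * S x *+ 2 - chi n x * (c n x * c n x) * Eul S x *+ 2.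
  exact: etrans (sfun_eq_at (flux_weighted_sfun divU S (chi n) w0 w1 w2) x)
    (congr1 (fun y => chi n x * c n x * y - S x * c n x * (Lap (chi n) x + Adv U (chi n) x)
     + c n x * c n x * S x * Eul (chi n) x *+ 2 +
    chi n x * (c n x * c n x) * Rad U x * S x *+ 2 - chi n x * (c n x * c n x) * Eul S x *+ 2) (S_eq x)).
rewrite e {e w0 w1 w2} /err2.
have := sqr_r_ge0 x; rewrite le_eqVlt => /orP[/eqP/esym r0|r0].
  have [x0 x1] := sqr_r_coord0 r0.
  have z p q : x 0 o0 * p + x 0 o1 * q = 0 :> R by rewrite x0 x1 !mul0r addr0.
  have Es : Eul S x = 0 := etrans (eul_at S x) (z _ _).
  rewrite Es /quot S_axis// !(mul0r, mulr0, mul0rn, add0r, addr0, subr0).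
  have : 0 <= chi n x * c n x * Hgrad a b x.
    by do 2? apply: mulr_ge0; rewrite ?hgrad_ge0 ?chi_ge0// ltW.
  move: (chi n x * c n x) (Hgrad a b x) (Vgrad a b x) => y H V hh.
  by rewrite -subr_ge0 (_ : _ - _ = 2 * (y * H)); [apply: mulr_ge0|ring].
apply: (@weighted_arith _ _ _ (eps n)) => //; rewrite ?chi_ge0 ?chi_le1 ?rad_sq_le ?vgrad_ge0//.
- exact: weightK.
- exact: hgrad_lower.
- exact: cutoff_flux_le.
- exact: eul_cutoff.
Qed.

Let err2_bound n x : `|err2 n x| <= (2 * M ^+ 2 + (K + 16)) * quot x.
Proof.
have q0 := quot_ge0 x.
have ec0 : 0 <= eps n * c n x by apply/ltW/mulr_gt0.
have ec1 : eps n * c n x <= 1.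
  rewrite -(weightK (eps_gt0 n) x) mulrC; apply: ler_wpM2l; first exact/ltW/weight_gt0.
  by rewrite lerDr sqr_r_ge0.
have k0 : 0 <= K / rad n by apply: mulr_ge0 => //; rewrite invr_ge0 ltW.
have k1 : K / rad n <= K by rewrite ler_pdivrMr// ler_peMr.
have r0 : 0 <= rad n ^- 2 by rewrite invr_ge0 exprn_ge0// ltW.
have r1 : rad n ^- 2 <= 1 by rewrite invf_le1 ?exprn_gt0// exprn_ege1.
have m0 : 0 <= 2 * M ^+ 2 by apply: mulr_ge0 => //; exact: sqr_ge0.
rewrite /err2 -mulrDl ger0_norm.
  apply: ler_wpM2r => //; apply: lerD; first by rewrite -[leRHS]mulr1; exact: ler_wpM2l.
  by apply: lerD => //; rewrite -[leRHS]mulr1; exact: ler_wpM2l.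
apply: mulr_ge0 => //; apply: addr_ge0; first exact: mulr_ge0.
by apply: addr_ge0 => //; exact: mulr_ge0.
Qed.

Let err2_meas n : meas3 (err2 n).
Proof.
apply: measurable_funD; apply: measurable_funM; try exact: quot_meas.
  exact: (continuous_meas3 (sfun_continuous (f := sfc (2 * M ^+ 2) * (sfc (eps n) * c n)))).
exact: measurable_cst.
Qed.

Let err2_cvg : I3 (err2 n) @[n --> \oo] --> (0 : R).
Proof.
apply: (I3_dct (g := fun x => (2 * M ^+ 2 + (K + 16)) * quot x)).
- exact: err2_meas.
- exact: integrable3Z quot_int.
- exact: err2_bound.
move=> x; rewrite /err2; have := sqr_r_ge0 x; rewrite le_eqVlt => /orP[/eqP/esym r0|r0].
  rewrite (_ : (fun n => _) = fun=> 0); first exact: cvg_cst.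
  by apply/funext => n; rewrite /quot S_axis// mul0r !mulr0 addr0.
have e1 : eps n * c n x @[n --> \oo] --> (0 : R) * (sqr_r x)^-1.
  by apply: cvgM; [exact: eps_cvg|exact: weight_cvg].
have e2 : rad n ^- 2 @[n --> \oo] --> (0 : R).
  rewrite (_ : (fun n => _) = fun n => eps n * eps n); last first.
    by apply/funext => n; rewrite /eps -invfM -expr2.
  by rewrite -[X in _ --> X](mulr0 (0 : R)); apply: cvgM; exact: eps_cvg.
have -> : (0 : R) = 2 * M ^+ 2 * (0 * (sqr_r x)^-1) * quot x + (K * 0 + 16 * 0) * quot x.
  by rewrite mul0r !mulr0 addr0 !mul0r addr0.
apply: cvgD; apply: cvgMr_tmp; first exact: cvgMl_tmp.
by apply: cvgD; apply: cvgMl_tmp => //; exact: eps_cvg.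
Qed.

(** Both [chi n] and [c n] increase with n, so the integral with index m is below every later one,
    hence below the limit 0 of the errors. *)
Lemma vertical_grad x : Vgrad a b x = 0.
Proof.
have key m : forall x, (chi m * c m * Vgrad a b : sfun R) x = 0.
  have ig n : integrable3 (chi n * c n * Vgrad a b : sfun R).
    by apply: csupp_sfun_integrable; do 2! apply: csuppM; exact: chi_csupp.
  have g0 n y : 0 <= (chi n * c n * Vgrad a b : sfun R) y.
    have h : 0 <= chi n y * c n y * Vgrad a b y.
      by apply: mulr_ge0; [apply: mulr_ge0; [exact: chi_ge0|exact/ltW/c_gt0]|exact: vgrad_ge0].
    exact: h.
  apply: (I3_eq0 (sfun_continuous (f := chi m * c m * Vgrad a b))) => //.
  have L n : (m <= n)%N -> 2 * I3 (chi m * c m * Vgrad a b : sfun R) <= I3 (err2 n).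
    move=> mn; have [i2 e2] := flux2_int n.
    have ie : integrable3 (err2 n) := integrable3_le (err2_meas n) (integrable3Z _ quot_int) (err2_bound n).
    have h := I3_le (integrable3Z 2 (ig n)) (integrable3D i2 ie) (vgrad_le n).
    rewrite (I3D i2 ie) e2 add0r in h; apply: le_trans h; rewrite -(I3Z _ (ig m)).
    apply: I3_le; try exact: integrable3Z.
    move=> y; have h : 2 * (chi m y * c m y * Vgrad a b y) <= 2 * (chi n y * c n y * Vgrad a b y).
      apply: ler_wpM2l => //; apply: ler_wpM2r; first exact: vgrad_ge0.
      apply: ler_pM; [exact: chi_ge0|exact/ltW/c_gt0|exact: chi_homo|apply: weight_homo].
      by rewrite /eps lef_pV2 ?posrE// ler_nat.
    exact: h.
  have : 2 * I3 (chi m * c m * Vgrad a b : sfun R) <= 0.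
    apply: (cvgr_to_ge err2_cvg); near=> n; apply: L; near: n; exact: nbhs_infty_ge.
  by rewrite pmulr_rle0.
pose m := Num.truncn (sqnorm x).
have mx : sqnorm x < rad m ^+ 2.
  apply: (@lt_le_trans _ _ (rad m)); first exact: truncnS_gt.
  by rewrite expr2 ler_peMr.
have h : chi m x * c m x * Vgrad a b x = 0 := key m x.
have /eqP := h; rewrite mulf_eq0 gt_eqF//=; first by move/eqP.
by apply: mulr_gt0 => //; exact: cutoff_gt0.
Unshelve. all: by end_near.
Qed.

Let d2_S x : d o2 S x = 0.
Proof.
apply: (etrans (d_hsq_at a b o2 x)).
have := vertical_grad x; rewrite vgrad_at.
move: (d o2 a x) (d o2 b x) => p q pq; have := sqr_ge0 p; have := sqr_ge0 q => q0 p0.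
have /eqP : p ^+ 2 = 0 by lra.
have /eqP : q ^+ 2 = 0 by lra.
by rewrite !sqrf_eq0 => /eqP -> /eqP ->; rewrite !mulr0 addr0 mulr0.
Qed.

(* Since S does not depend on z, d_z (z chi S) = chi S + z S d_z chi has integral 0. *)
Let flux3 n : sfun R := d o2 (X o2 * (chi n * S)).

Let flux3E n x : flux3 n x = chi n x * S x + x 0 o2 * (d o2 (chi n) x * S x).
Proof.
have e : flux3 n = chi n * S + X o2 * (d o2 (chi n) * S + chi n * d o2 S).
  by rewrite /flux3 dM d22X mul1r (dM o2 (chi n)).
have e' : flux3 n x = chi n x * S x + x 0 o2 * (d o2 (chi n) x * S x + chi n x * d o2 S x).
  exact: sfun_eq_at e x.
apply: (etrans e'); move: (d2_S x); move: (d o2 S x) => y ->.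
by rewrite mulr0 addr0.
Qed.

Let err3 n (x : 'rV[R]_3) : R := - (x 0 o2 * (d o2 (chi n) x * S x)).

Let err3E n x : err3 n x = 2 * rad n ^- 2 * x 0 o2 ^+ 2 *
  beta 2 ((1 - sfc (rad n ^- 2) * sqnorm : sfun R) x) * S x.
Proof.
have e : d o2 (chi n) x =
  - (2 * rad n ^- 2 * x 0 o2 * beta 2 ((1 - sfc (rad n ^- 2) * sqnorm : sfun R) x)).
  exact: d_cutoff.
rewrite /err3 e; move: (beta 2 _) => y; move: (S x) (rad n ^- 2) => z t; ring.
Qed.

Let err3_meas n : meas3 (err3 n).
Proof.
exact: (continuous_meas3 (sfun_continuous (f := - (X o2 * (d o2 (chi n) * S))))).
Qed.

(** On the support of the cut-off |z| <= [rad n], and [beta 2] <= 4. This uniform bound is where the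
    integrability of S enters. *)
Let err3_bound n x : 0 <= err3 n x <= 8 * S x.
Proof.
rewrite err3E; set w := (_ : sfun R) x.
have r0 : 0 <= rad n ^- 2 by rewrite invr_ge0 exprn_ge0// ltW.
have [w0|w0] := leP w 0.
  by rewrite (beta_npos _ w0) mulr0 mul0r lexx; apply: mulr_ge0.
have xr : rad n ^- 2 * x 0 o2 ^+ 2 <= 1.
  rewrite mulrC ler_pdivrMr ?exprn_gt0// mul1r -real_normK ?num_real//.
  apply: lerXn2r; rewrite ?nnegrE//.
  apply: coord_le_sqnorm; first exact: ltW.
  move: w0; rewrite /w sfD sfN sfM sf1 sfcE => w0; exact/ltW/cutoff_arg_gt0.
have x0 : 0 <= rad n ^- 2 * x 0 o2 ^+ 2 by apply: mulr_ge0 => //; exact: sqr_ge0.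
have b0 := beta_ge0 2 w; have b4 : beta 2 w <= 4 by have := beta_le 2 w; move: (beta 2 w) => y; lra.
move: (rad n ^- 2) (x 0 o2 ^+ 2) (beta 2 w) xr x0 b0 b4 => p q t xr x0 b0 b4.
rewrite -(mulrA 2 p) -(mulrA 2) -(mulrA 2); apply/andP; split.
  by apply: mulr_ge0 => //; apply: mulr_ge0 => //; exact: mulr_ge0.
rewrite mulrA; apply: ler_wpM2r => //.
have : p * q * t <= 1 * 4 by exact: ler_pM.
by rewrite mul1r; lra.
Qed.

Let err3_cvg : I3 (err3 n) @[n --> \oo] --> (0 : R).
Proof.
apply: (I3_dct (g := fun x => 8 * S x)).
- by move=> n; exact: err3_meas.
- exact: integrable3Z S_int.
- by move=> n x; have /andP[h0 h1] := err3_bound n x; rewrite ger0_norm.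
move=> x; apply: (squeeze_cvgr (f := fun=> 0) (h := fun n => (8 * x 0 o2 ^+ 2 * S x) * eps n)).
- near=> n; have /andP[-> _] /= := err3_bound n x; rewrite err3E.
  set w := (_ : sfun R) x.
  have r0 : rad n ^- 2 <= eps n.
    by rewrite /eps lef_pV2 ?posrE ?exprn_gt0// expr2 ler_peMr.
  have r1 : 0 <= rad n ^- 2 by rewrite invr_ge0 exprn_ge0// ltW.
  have b0 := beta_ge0 2 w; have b4 : beta 2 w <= 4 by have := beta_le 2 w; move: (beta 2 w) => y; lra.
  have h : rad n ^- 2 * beta 2 w <= eps n * 4 by exact: ler_pM.
  have p0 : 0 <= 2 * x 0 o2 ^+ 2 * S x.
    by apply: mulr_ge0 => //; apply: mulr_ge0 => //; exact: sqr_ge0.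
  have := ler_wpM2l p0 h.
  move: (rad n ^- 2) (eps n) (beta 2 w) (x 0 o2 ^+ 2) (S x) => p q t y z.
  congr (_ <= _); ring.
- exact: cvg_cst.
- by rewrite -[X in _ --> X](mulr0 (8 * x 0 o2 ^+ 2 * S x)); apply: cvgMl_tmp; exact: eps_cvg.
Unshelve. all: by end_near.
Qed.

Lemma vorticity_decay x : S x = 0.
Proof.
have key m : forall x, (chi m * S : sfun R) x = 0.
  have ig n : integrable3 (chi n * S : sfun R).
    by apply: csupp_sfun_integrable; apply: csuppM; exact: chi_csupp.
  have g0 n y : 0 <= (chi n * S : sfun R) y.
    have h : 0 <= chi n y * S y by apply: mulr_ge0; [exact: chi_ge0|exact: S_ge0].
    exact: h.
  apply: (I3_eq0 (sfun_continuous (f := chi m * S))) => //.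
  have L n : (m <= n)%N -> I3 (chi m * S : sfun R) <= I3 (err3 n).
    move=> mn.
    have c3 : csupp (X o2 * (chi n * S) : sfun R) by apply: csuppMr; apply: csuppM; exact: chi_csupp.
    have i3 : integrable3 (flux3 n) := csupp_sfun_integrable (csupp_d o2 c3).
    have e3 : I3 (flux3 n) = 0 := I3_d o2 c3.
    have ie : integrable3 (err3 n).
      apply: (integrable3_le (err3_meas n) (integrable3Z 8 S_int)) => y.
      by have /andP[h0 h1] := err3_bound n y; rewrite ger0_norm.
    have hh y : (chi m * S : sfun R) y <= ((flux3 n : 'rV[R]_3 -> R) + err3 n) y.
      have h : chi m y * S y <= flux3 n y + err3 n y.
        by rewrite flux3E /err3 addrK; apply: ler_wpM2r; [exact: S_ge0|exact: chi_homo].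
      exact: h.
    apply: (le_trans (I3_le (ig m) (integrable3D i3 ie) hh)).
    by rewrite (I3D i3 ie) e3 add0r.
  apply: (cvgr_to_ge err3_cvg); near=> n; apply: L; near: n; exact: nbhs_infty_ge.
pose m := Num.truncn (sqnorm x).
have mx : sqnorm x < rad m ^+ 2.
  apply: (@lt_le_trans _ _ (rad m)); first exact: truncnS_gt.
  by rewrite expr2 ler_peMr.
have h : chi m x * S x = 0 := key m x.
have /eqP := h; rewrite mulf_eq0 gt_eqF//=; first by move/eqP.
exact: cutoff_gt0.
Unshelve. all: by end_near.
Qed.

End VorticityDecay.

(** * Harmonic fields *)

Section Liouville.
Context {R : realType}.
Implicit Types f : sfun R.

Lemma decays_le (s t : 'rV[R]_3 -> R) : (forall x, s x <= t x) -> decays t -> decays s.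
Proof.
move=> st dt e e0; have [M hM] := dt e e0.
by exists M => x ex; apply: hM; exact: lt_le_trans (st x).
Qed.

Section Truncation.
Variables (f : sfun R) (f_decay : decays (fun x => f x ^+ 2)) (k : R) (k0 : 0 < k).

Let lev : sfun R := sfc k * f ^+ 2 - 1.
Let levE x : lev x = k * f x ^+ 2 - 1.
Proof. by rewrite /lev sfD sfN sfM sfcE sfX sf1. Qed.

(** It vanishes where k f^2 <= 1, hence has compact support although f is only known to tend to
    0. *)
Definition trunc : sfun R := f * sfbeta 0 lev.
Definition trunc' : sfun R := sfbeta 0 lev + sfc (2 * k) * f ^+ 2 * sfbeta 2 lev.

Lemma truncE x : trunc x = f x * beta 0 (k * f x ^+ 2 - 1).
Proof. by rewrite /trunc sfM sfbetaE levE. Qed.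

Lemma trunc'E x : trunc' x =
  beta 0 (k * f x ^+ 2 - 1) + 2 * k * f x ^+ 2 * beta 2 (k * f x ^+ 2 - 1).
Proof. by rewrite /trunc' sfD (sfM _ (sfbeta 2 lev)) (sfM (sfc _)) sfX sfcE !sfbetaE levE. Qed.

Lemma d_trunc i x : d i trunc x = trunc' x * d i f x.
Proof.
have dl : d i lev x = 2 * k * f x * d i f x.
  have e : d i lev = sfc k * (d i f * f + f * d i f).
    by rewrite /lev dB d1 subr0 dM dc mul0r add0r expr2 dM.
  apply: (etrans (sfun_eq_at e x)).
  by rewrite (sfM (sfc k)) sfcE sfD (sfM (d i f)) (sfM f); move: (f x) (d i f x) => y z; ring.
have e : d i trunc = d i f * sfbeta 0 lev + f * (sfbeta 2 lev * d i lev).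
  by rewrite /trunc dM d_beta mulr0n subr0.
have e' : d i trunc x = d i f x * beta 0 (lev x) + f x * (beta 2 (lev x) * d i lev x).
  exact: sfun_eq_at e x.
rewrite e' dl trunc'E levE; move: (f x) (d i f x) (beta 0 _) (beta 2 _) => y z b0 b2; ring.
Qed.

Lemma trunc_csupp : csupp trunc.
Proof.
apply: (decays_csupp k0 f_decay) => x h.
rewrite truncE beta_npos ?mulr0//; lra.
Qed.

(* trunc is a function of f whose derivative trunc' is nonnegative, so that
   div (trunc grad f) = trunc' |grad f|^2 for a harmonic f. *)
Lemma trunc_grad : Lap f = 0 -> forall x, trunc' x * gradsq f x = 0.
Proof.
move=> f_harm.
have t0 x : 0 <= trunc' x.
  rewrite trunc'E; apply: addr_ge0; first exact: beta_ge0.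
  apply: mulr_ge0; last exact: beta_ge0.
  by apply: mulr_ge0; [apply/ltW/mulr_gt0|exact: sqr_ge0].
have eT x : (trunc' * gradsq f : sfun R) x =
  Div (trunc * d o0 f) (trunc * d o1 f) (trunc * d o2 f) x.
  have e : Div (trunc * d o0 f) (trunc * d o1 f) (trunc * d o2 f) x =
    (d o0 trunc x * d o0 f x + trunc x * d o0 (d o0 f) x) +
    (d o1 trunc x * d o1 f x + trunc x * d o1 (d o1 f) x) +
    (d o2 trunc x * d o2 f x + trunc x * d o2 (d o2 f) x).
    apply: (etrans (divE _ _ _ x)).
    congr (_ + _ + _); [exact: sfun_eq_at (dM o0 trunc (d o0 f)) x|
      exact: sfun_eq_at (dM o1 trunc (d o1 f)) x|exact: sfun_eq_at (dM o2 trunc (d o2 f)) x].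
  have h := sfun_eq_at f_harm x; rewrite lapE sf0 in h.
  rewrite e (d_trunc o0) (d_trunc o1) (d_trunc o2) (sfM trunc') (gradsqE f x).
  move: (trunc x) (trunc' x) (d o0 f x) (d o1 f x) (d o2 f x) (d o0 (d o0 f) x) (d o1 (d o1 f) x)
    (d o2 (d o2 f) x) h => t t' f0 f1 f2 f00 f11 f22 h.
  rewrite [RHS](_ : _ = t' * (f0 ^+ 2 + f1 ^+ 2 + f2 ^+ 2) + t * (f00 + f11 + f22)); last by ring.
  by rewrite h mulr0 addr0.
have [iT I0] : integrable3 (Div (trunc * d o0 f) (trunc * d o1 f) (trunc * d o2 f)) /\
  I3 (Div (trunc * d o0 f) (trunc * d o1 f) (trunc * d o2 f)) = 0.
  by apply: csupp_I3_div; apply: csuppM; exact: trunc_csupp.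
have eF : ((trunc' * gradsq f : sfun R) : _ -> _) = Div (trunc * d o0 f) (trunc * d o1 f) (trunc * d o2 f).
  exact/funext.
rewrite -eF in iT I0.
move=> x; have := I3_eq0 (sfun_continuous (f := trunc' * gradsq f)) iT; apply; last by rewrite I0.
by move=> y; have h : 0 <= trunc' y * gradsq f y by apply: mulr_ge0; [exact: t0|exact: gradsq_ge0].
Qed.

(** The gradient of [trunc] is [trunc'] grad f, whose square vanishes by [trunc_grad]; a compactly
    supported function without gradient is 0 by the Sobolev inequality. *)
Lemma trunc_eq0 : Lap f = 0 -> forall x, trunc x = 0.
Proof.
move=> f_harm; have ct := trunc_csupp.
have g0 x : gradsq trunc x = 0.
  have h := trunc_grad f_harm x.
  rewrite (gradsqE f x) in h.
  have sq3 (t p q r p' q' r' : R) : p = t * p' -> q = t * q' -> r = t * r' ->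
      t * (p' ^+ 2 + q' ^+ 2 + r' ^+ 2) = 0 -> p ^+ 2 + q ^+ 2 + r ^+ 2 = 0.
    by move=> -> -> ->; rewrite !exprMn -!mulrDr expr2 -mulrA => ->; rewrite mulr0.
  exact: etrans (gradsqE trunc x) (sq3 _ _ _ _ _ _ _ (d_trunc o0 x) (d_trunc o1 x) (d_trunc o2 x) h).
have I0 : I3 (gradsq trunc) = 0.
  rewrite /I3 (_ : (fun q => _) = cst 0%E) ?integral0//.
  by apply/funext => q; rewrite g0.
have := sobolev_gagliardo_nirenberg ct; rewrite I0 expr0n mulr0 => h x.
have := I3_eq0 (sfun_continuous (f := trunc ^+ 6)) (csupp_sfun_integrable (csuppX _ ct)) _ h x.
suff p y : 0 <= (trunc ^+ 6 : sfun R) y.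
  by move=> /(_ p) /eqP; rewrite sfX expf_eq0 /= => /eqP.
by rewrite sfX exprn_even_ge0.
Qed.

End Truncation.

Lemma liouville f : decays (fun x => f x ^+ 2) -> Lap f = 0 -> forall x, f x = 0.
Proof.
move=> fd fh x; apply/eqP/negPn/negP => fx.
have f2 : 0 < f x ^+ 2 by rewrite lt_neqAle eq_sym sqrf_eq0 fx sqr_ge0.
(* With k = 2 / f(x)^2 the level k f^2 - 1 equals 1 at x, so the truncation would not vanish
   there. *)
have k0 : 0 < 2 / f x ^+ 2 by rewrite divr_gt0.
have /eqP := trunc_eq0 fd k0 fh x.
rewrite truncE (divfK (lt0r_neq0 f2)) mulf_eq0 (negbTE fx) /= gt_eqF// beta_gt0//; lra.
Qed.

(** The truncation with k = 2 is continuous with compact support, hence bounded, and where |f| > 1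
    it is at least [beta 0 1] |f| in absolute value. *)
Lemma decays_bounded f : decays (fun x => f x ^+ 2) -> exists C, forall x, `|f x| <= C.
Proof.
move=> fd; have k0 : 0 < 2 :> R by [].
have [C hC] := csupp_bounded (sfun_continuous (f := trunc f 2)) (trunc_csupp fd k0).
have b1 : 0 < beta 0 1 :> R by exact: beta_gt0.
exists (1 + C / beta 0 1) => x.
have C0 : 0 <= C / beta 0 1 by apply: divr_ge0; [exact: le_trans (hC 0)|exact: ltW].
have [f1|f1] := leP `|f x| 1; first by rewrite -[leLHS]addr0 lerD.
have f2 : 1 < f x ^+ 2 by rewrite -real_normK ?num_real// exprn_egt1.
have hb : beta 0 1 <= beta 0 (2 * f x ^+ 2 - 1) by apply: beta0_homo; lra.
rewrite -[leLHS]add0r; apply: lerD => //; rewrite ler_pdivlMr//.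
apply: le_trans (hC x); rewrite truncE normrM (ger0_norm (beta_ge0 _ _)).
exact: ler_wpM2l.
Qed.

End Liouville.

Lemma divided_gradient (R : realType) (s N g r : R) : 0 < r ->
  r * N + 4 * s ^+ 2 <= 4 * s * (r * g) -> N <= 4 * s * (g - s / r).
Proof.
move=> r0 h.
rewrite -(ler_pM2l r0) (_ : r * (4 * s * (g - s / r)) = 4 * s * (r * g) - 4 * s ^+ 2 * (r / r)).
  by rewrite divff ?gt_eqF// mulr1; lra.
by ring.
Qed.

(** * The theorem *)

Section Inflow.
Context {R : realType}.
Variables (u : 'rV[R]_3 -> 'rV[R]_3) (ur ut uz : R -> R -> R) (U : 'I_3 -> sfun R).
Hypotheses (u_axi : axisymmetric_with ur ut uz u) (Uu : forall i x, U i x = u x 0 i).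

Lemma cyl_r_axis (x : 'rV[R]_3) : sqr_r x = 0 -> cyl_r x = 0.
Proof. by move=> r0; rewrite cyl_rE r0 sqrtr0. Qed.

Lemma rad_axis x : sqr_r x = 0 -> Rad U x = 0.
Proof. by move=> /sqr_r_coord0[x0 x1]; rewrite radE x0 x1 !mul0r addr0. Qed.

(** Multiplied by r, the condition u_r < -1/r reads r u_r < -1, a condition on a smooth function. On
    the axis both sides are 0, by the default value of the inverse and because [Rad U] is 0
    there. *)
Lemma strong_inflowE x :
  strong_inflow ur x = if Rad U x < -1 then Rad U x / sqr_r x else 0.
Proof.
have := sqr_r_ge0 x; rewrite le_eqVlt => /orP[/eqP/esym r0|r0].
  rewrite /strong_inflow (cyl_r_axis r0) invr0 mulr0 mul0r rad_axis//.
  by rewrite ltr0N1.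
have c0 : 0 < cyl_r x by rewrite cyl_rE sqrtr_gt0.
have c2 : cyl_r x ^+ 2 = sqr_r x by rewrite cyl_rE sqr_sqrtr// ltW.
have e := ur_radial u_axi Uu r0; rewrite -radE in e.
have e' : Rad U x = ur (cyl_r x) (cyl_z x) * cyl_r x.
  have : Rad U x / sqr_r x * sqr_r x = Rad U x by rewrite divfK// gt_eqF.
  by rewrite -e -c2 => <-; field; rewrite gt_eqF.
have lE : (ur (cyl_r x) (cyl_z x) < - (1 / cyl_r x)) = (Rad U x < -1).
  by rewrite -mulNr ltr_pdivlMr// e'.
have mE : (x \in [set y | ur (cyl_r y) (cyl_z y) < - (1 / cyl_r y)]) = (Rad U x < -1).
  by rewrite -lE; apply/idP/idP; rewrite inE.
rewrite /strong_inflow e indicE mE.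
by case: ifP => _; rewrite ?mulr1 ?mulr0.
Qed.

Lemma strong_inflow_meas : meas3 (strong_inflow ur).
Proof.
rewrite (_ : strong_inflow ur = fun x => if Rad U x < -1 then Rad U x / sqr_r x else 0); last first.
  by apply/funext => x; exact: strong_inflowE.
apply: measurable_fun_ifT.
- by apply: measurable_fun_ltr; [exact: continuous_meas3 (sfun_continuous (f := Rad U))|exact: measurable_cst].
- by apply: meas3_quotient => x; exact: rad_axis.
- exact: measurable_cst.
Qed.

(** Either the inflow is strong and u_r / r is minus its absolute value, or r u_r >= -1 and the loss
    is at most 1 / r^2. Multiplied by s, that loss is the Hardy term. *)
Lemma inflow_bound x : 0 < sqr_r x ->
  - (sqr_r x)^-1 - `|strong_inflow ur x| <= Rad U x / sqr_r x.
Proof.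
move=> r0; have i0 : 0 < (sqr_r x)^-1 by rewrite invr_gt0.
rewrite strong_inflowE; case: ifPn => [h|].
  rewrite ler0_norm; last by rewrite mulrC pmulr_rle0//; lra.
  lra.
rewrite -leNgt normr0 subr0 => h; rewrite -mulN1r.
by apply: ler_wpM2r => //; exact: ltW.
Qed.

End Inflow.

(** The strong inflow is identically 0, on the axis by the default value of the inverse, and the
    threshold is positive by [sobolev_const_gt0]. *)
Lemma small_inflow0 (R : realType) (ur : R -> R -> R) :
  (forall r z : R, 0 < r -> - (1 / r) <= ur r z) -> small_inflow ur.
Proof.
move=> h; rewrite /small_inflow.
have -> : strong_inflow ur = cst 0.
  apply/funext => x; rewrite /strong_inflow.
  have : 0 <= cyl_r x by rewrite /cyl_r sqrtr_ge0.
  rewrite le_eqVlt => /orP[/eqP <-|c0]; first by rewrite invr0 mulr0 mul0r.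
  by rewrite indicE memNset ?mulr0//= => hx; have := h _ (cyl_z x) c0; rewrite leNgt hx.
rewrite /LpNorm [X in (X < _)%E](_ : _ = 0%E).
  by rewrite lte_fin divr_gt0// mulr_gt0// exprn_gt0// sobolev_const_gt0.
have n0 : (3 / 2)%:E != 0%E :> \bar R by rewrite eqe mulf_neq0// invr_neq0.
exact: (@Lnorm0 _ _ _ (@leb3 R) _ n0).
Qed.

Section Uniqueness.
Context (R : realType).
Variables (u : 'rV[R]_3 -> 'rV[R]_3) (p : 'rV[R]_3 -> R) (ur ut uz : R -> R -> R).
Hypotheses (u_axi : axisymmetric_with ur ut uz u) (u_smooth : smooth u) (p_smooth : smooth p)
  (u_ns : steady_navier_stokes u p) (u_infty : vanishes_at_infinity u)
  (u_dirichlet : (dirichlet_integral u < +oo)%E).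

Let U i : sfun R := mksf (smooth_comp_mx i u_smooth).
Let P : sfun R := mksf p_smooth.
Let Uu i x : U i x = u x 0 i. Proof. by []. Qed.

Lemma speed_decays : decays (fun x => U o0 x ^+ 2 + U o1 x ^+ 2 + U o2 x ^+ 2).
Proof.
move=> e e0; have se0 : 0 < Num.sqrt e by rewrite sqrtr_gt0.
have [M hM] := u_infty se0; exists (Num.max M 0) => x ex i.
have xM : enorm x <= Num.max M 0.
  rewrite le_max leNgt; case: (ltP M (enorm x)) => //= /hM.
  rewrite /enorm sum3 => h; exfalso; move: ex; apply/negP; rewrite -leNgt.
  by move: h; rewrite ltr_sqrt ?addr_ge0 ?sqr_ge0// => /ltW; rewrite !Uu.
apply: le_trans xM; rewrite /enorm sum3 -sqrtr_sqr ler_sqrt ?addr_ge0 ?sqr_ge0//.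
have [h0 h1 h2] := sq_le_sum (x 0 o0) (x 0 o1) (x 0 o2).
by move: i; apply: ord3P.
Qed.

Lemma coord_decays i : decays (fun x => U i x ^+ 2).
Proof.
apply: decays_le speed_decays => x.
have [h0 h1 h2] := sq_le_sum (U o0 x) (U o1 x) (U o2 x).
by move: i; apply: ord3P.
Qed.

Lemma coord_bounded : exists M, forall i x, `|U i x| <= M.
Proof.
have [C0 h0] := decays_bounded (coord_decays o0).
have [C1 h1] := decays_bounded (coord_decays o1).
have [C2 h2] := decays_bounded (coord_decays o2).
exists (Num.max C0 (Num.max C1 C2)); apply: ord3P => x; rewrite !le_max.
- by rewrite h0.
- by rewrite h1 orbT.
- by rewrite h2 !orbT.
Qed.

Lemma gradU_int : integrable3 (GradU U).
Proof.
apply: integrable3_fin.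
- exact: continuous_meas3 (sfun_continuous (f := GradU U)).
- move=> x; have g i := gradsq_ge0 (U i) x.
  rewrite gradUE; exact: (addr_ge0 (addr_ge0 (g o0) (g o1)) (g o2)).
rewrite (_ : (\int[leb3]_q (GradU U (pt3 q))%:E)%E = dirichlet_integral u)//.
apply: eq_integral => q _; congr (_%:E).
have e i j : partial i u (pt3 q) 0 j = d i (U j) (pt3 q).
  exact: etrans (partial_mx i (pt3 q) j u_smooth) (esym (dE i (U j) (pt3 q))).
have sum9 (F : 'I_3 -> 'I_3 -> R) : \sum_(i < 3) \sum_(j < 3) F i j ^+ 2 =
    (F o0 o0 ^+ 2 + F o1 o0 ^+ 2 + F o2 o0 ^+ 2) + (F o0 o1 ^+ 2 + F o1 o1 ^+ 2 + F o2 o1 ^+ 2) +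
    (F o0 o2 ^+ 2 + F o1 o2 ^+ 2 + F o2 o2 ^+ 2).
  by rewrite !sum3; ring.
apply: etrans (esym (sum9 (fun i j => partial i u (pt3 q) 0 j))).
apply: (etrans (gradUE U (pt3 q))).
rewrite (gradsqE (U o0) (pt3 q)) (gradsqE (U o1) (pt3 q)) (gradsqE (U o2) (pt3 q)).
by rewrite -(e o0 o0) -(e o1 o0) -(e o2 o0) -(e o0 o1) -(e o1 o1) -(e o2 o1) -(e o0 o2) -(e o1 o2) -(e o2 o2).
Qed.

Let eqs := navier_stokes_components u_smooth p_smooth Uu (fun x => erefl (P x)) u_ns.
Let ns j : Adv U (U j) + d j P = Lap (U j). Proof. by have [h _] := eqs; exact: h. Qed.
Let divU : Div (U o0) (U o1) (U o2) = 0. Proof. by have [_ h] := eqs. Qed.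
Let rU0 : Rot (U o0) = - U o1. Proof. by have [] := rot_field u_axi Uu. Qed.
Let rU1 : Rot (U o1) = U o0. Proof. by have [] := rot_field u_axi Uu. Qed.
Let rU2 : Rot (U o2) = 0. Proof. by have [] := rot_field u_axi Uu. Qed.

Let V0 : sfun R := swirl0 U.
Let V1 : sfun R := swirl1 U.
Let rV0 : Rot V0 = - V1. Proof. by have [] := rot_swirl u_axi Uu. Qed.
Let rV1 : Rot V1 = V0. Proof. by have [] := rot_swirl u_axi Uu. Qed.
Let tV : X o0 * V0 + X o1 * V1 = 0. Proof. exact: swirl_tangent u_axi Uu. Qed.
Let tW : X o0 * (U o1 - V1) - X o1 * (U o0 - V0) = 0. Proof. exact: swirl_radial u_axi Uu. Qed.

(** V is tangential and the horizontal part of U - V radial; by Pythagoras the swirl tends to 0 with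
    u. *)
Lemma swirl_hsq_le x : Hsq V0 V1 x <= U o0 x ^+ 2 + U o1 x ^+ 2 + U o2 x ^+ 2.
Proof.
rewrite hsqE.
have := sqr_r_ge0 x; rewrite le_eqVlt => /orP[/eqP/esym r0|r0].
  have [-> ->] := horizontal_axis rV0 rV1 r0.
  by rewrite expr0n !addr0 !addr_ge0 ?sqr_ge0.
have hV : x 0 o0 * V0 x + x 0 o1 * V1 x = 0 := sfun_eq_at tV x.
have hW : x 0 o0 * (U o1 x - V1 x) - x 0 o1 * (U o0 x - V0 x) = 0 := sfun_eq_at tW x.
move: hV hW r0; rewrite /sqr_r.
move: (V0 x) (V1 x) (U o0 x) (U o1 x) (U o2 x) (x 0 o0) (x 0 o1) => v0 v1 u0 u1 u2 x0 x1 hV hW r0.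
have o : v0 * (u0 - v0) + v1 * (u1 - v1) = 0.
  apply: (mulfI (lt0r_neq0 r0)); rewrite mulr0.
  apply: (@etrans _ _ ((x0 * v0 + x1 * v1) * (x0 * (u0 - v0) + x1 * (u1 - v1)) +
    (x0 * v1 - x1 * v0) * (x0 * (u1 - v1) - x1 * (u0 - v0)))); first by ring.
  by rewrite hV hW mul0r mulr0 addr0.
rewrite -subr_ge0 (_ : _ - _ = (u0 - v0) ^+ 2 + (u1 - v1) ^+ 2 + u2 ^+ 2 +
  2 * (v0 * (u0 - v0) + v1 * (u1 - v1))); last by ring.
by rewrite o mulr0 addr0 !addr_ge0 ?sqr_ge0.
Qed.

Section SmallInflow.
Hypothesis u_small : small_inflow ur.

Lemma no_swirl : V0 = 0 /\ V1 = 0.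
Proof.
pose G : sfun R := Hgrad V0 V1 + Vgrad V0 V1.
have G0 x : 0 <= G x := addr_ge0 (hgrad_ge0 V0 V1 x) (vgrad_ge0 V0 V1 x).
have Gint : integrable3 G.
  apply: (integrable3_le (continuous_meas3 (sfun_continuous (f := G))) gradU_int) => x.
  rewrite ger0_norm//; exact: (@swirl_grad_le _ U rU0 rU1 V0 V1 rV0 rV1 tV tW x).
have seq x : Lap (Hsq V0 V1) x - Adv U (Hsq V0 V1) x =
    2 * (Rad U x / sqr_r x * Hsq V0 V1 x + G x).
  apply: (etrans (@swirl_identity _ U P rU0 rU1 rU2 ns V0 V1 rV0 rV1 tV tW x)).
  by congr (2 * _); rewrite -addrA.
have [th th01 hth] := sobolev_hoelder (strong_inflow_meas u_axi Uu) u_small.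
suff s0 x : Hsq V0 V1 x = 0.
  have z x : V0 x = 0 /\ V1 x = 0.
    have := s0 x; rewrite hsqE; move: (V0 x) (V1 x) => a b e.
    have := sqr_ge0 a; have := sqr_ge0 b => b0 a0.
    by split; apply/eqP; rewrite -sqrf_eq0; apply/eqP; lra.
  by split; apply: sfun_eq => x; have [] := z x.
apply: (@swirl_decay _ U (Hsq V0 V1) G (fun x => Rad U x / sqr_r x) (strong_inflow ur) th divU
  (hsq_ge0 V0 V1) seq _ G0 Gint _ th01 hth).
- move=> y s0.
  have r0 : 0 < sqr_r y.
    rewrite lt_neqAle sqr_r_ge0 andbT eq_sym; apply: contraTneq s0 => r0.
    by have [a0 b0] := horizontal_axis rV0 rV1 r0; rewrite hsqE a0 b0 expr0n addr0 ltxx.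
  have i0 : 0 < (sqr_r y)^-1 by rewrite invr_gt0.
  (* The Hardy term s / r^2: it is at most |grad v|^2, it improves the gradient bound, and it pays
     for the weak inflow. *)
  exists (Hsq V0 V1 y / sqr_r y); split.
  + rewrite mulr_ge0 ?(ltW s0) ?(ltW i0)//= ler_pdivrMr// mulrC.
    have h : Hsq V0 V1 y <= sqr_r y * Hgrad V0 V1 y.
      rewrite (hgrad_polar_at rV0 rV1 y) hsqE; have := sqr_ge0 (Eul V0 y); have := sqr_ge0 (Eul V1 y).
      by move: (_ ^+ 2) (_ ^+ 2) (_ ^+ 2) (_ ^+ 2) => q1 q2 q3 q4; lra.
    apply: (le_trans h); apply: ler_wpM2l; first exact: ltW.
    have e : G y = Hgrad V0 V1 y + Vgrad V0 V1 y by [].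
    by rewrite e lerDl vgrad_ge0.
  + have h := grad_hsq_le rV0 rV1 y.
    have e : G y = Hgrad V0 V1 y + Vgrad V0 V1 y by [].
    by rewrite -e in h; exact: divided_gradient r0 h.
  + have h := inflow_bound u_axi Uu r0.
    have := ler_wpM2r (ltW s0) h.
    by rewrite mulrBl mulNr (mulrC (sqr_r y)^-1).
- exact: decays_le swirl_hsq_le speed_decays.
Qed.

Lemma small_inflow_eq0 x : u x = 0.
Proof.
have [v0 v1] := no_swirl.
have ns0 : X o0 * U o1 - X o1 * U o0 = 0 by have := tW; rewrite v0 v1 !subr0.
have [M hM] := coord_bounded.
have S_int : integrable3 (Hsq (Om0 U) (Om1 U)).
  apply: (integrable3_le (continuous_meas3 (sfun_continuous (f := Hsq (Om0 U) (Om1 U))))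
    (integrable3Z 2 gradU_int)) => y.
  by rewrite ger0_norm ?hsq_ge0//; exact: vorticity_le.
have rO0 : Rot (Om0 U) = - Om1 U := rot_Om0 rU1 rU2.
have rO1 : Rot (Om1 U) = Om0 U := rot_Om1 rU0 rU2.
have om y : Hsq (Om0 U) (Om1 U) y = 0.
  apply: (@vorticity_decay _ U (Om0 U) (Om1 U) M divU hM rO0 rO1 _ S_int) => z.
  exact: (@vorticity_identity _ U P rU0 rU1 rU2 ns divU ns0 z).
have z y : Om0 U y = 0 /\ Om1 U y = 0.
  have := om y; rewrite hsqE; move: (Om0 U y) (Om1 U y) => a b e.
  have := sqr_ge0 a; have := sqr_ge0 b => b0 a0.
  by split; apply/eqP; rewrite -sqrf_eq0; apply/eqP; lra.
have O0 : Om0 U = 0 by apply: sfun_eq => y; have [] := z y.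
have O1 : Om1 U = 0 by apply: sfun_eq => y; have [] := z y.
apply/rowP => i; rewrite mxE.
exact: (liouville (coord_decays i) (irrotational_harmonic rU0 rU1 divU ns0 O0 O1 i) x).
Qed.

End SmallInflow.
End Uniqueness.

Theorem theorem2p3 (R : realType) (u : 'rV[R]_3 -> 'rV[R]_3)
    (p : 'rV[R]_3 -> R) (ur ut uz : R -> R -> R)
    (u_axi : axisymmetric_with ur ut uz u)
    (u_smooth : smooth u) (p_smooth : smooth p)
    (u_ns : steady_navier_stokes u p)
    (u_infty : vanishes_at_infinity u)
    (u_dirichlet : (dirichlet_integral u < +oo)%E) :
  (small_inflow ur -> forall x, u x = 0) /\
  ((forall r z : R, 0 < r -> - (1 / r) <= ur r z) ->
     small_inflow ur /\ forall x, u x = 0).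
Proof.
have main : small_inflow ur -> forall x, u x = 0.
  exact: small_inflow_eq0 u_axi u_smooth p_smooth u_ns u_infty u_dirichlet.
split=> // h; have s := small_inflow0 h.
by split=> //; exact: main.
Qed.
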